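(* Let $X_1,X_2,\dots$ be an i.i.d. sequence of $\mathbb{R}$-valued random variables, distributed as $X$, with mean zero, $\mathbb{E}[X]=0$, and variance $\sigma^2=\mathbb{E}[X^2]$. Let $S_n=\frac{1}{\sqrt n}\sum_{j=1}^nX_j$ be the normalized sum of $n$ such random variables. Let $k\ge3$ be the first value for which the higher cumulant $\kappa_k$ of $X$ is non-zero and finite. Suppose also that the characteristic function $\phi_X$ satisfies $\int_{-\infty}^\infty|\phi_X(u)|^v\,du<\infty$ for some power $v\ge1$. Then the leading order correction to the central limit theorem is of size $\frac{1}{\sqrt n^{\,k-2}}$ and is given by the Hermite polynomial $He_k$: as $n\to\infty$, the density $\rho_{S_n}$ of $S_n$ satisfies $$\rho_{S_n}(x)=\frac{1}{\sqrt{2\pi\sigma^2}}e^{-\frac{x^2}{2\sigma^2}}+\frac{1}{\sqrt n^{\,k-2}}\,\frac{\kappa_k}{k!\,\sigma^k}\,He_k\Big(\frac{x}{\sigma}\Big)\frac{1}{\sqrt{2\pi\sigma^2}}e^{-\frac{x^2}{2\sigma^2}}+O\Big(\frac{1}{\sqrt n^{\,k-1}}\Big).$$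
   Context: $He_k(x)=\mathbb{E}_{Z\sim\mathcal{N}(0,1)}[(x+\imath Z)^k]$ ($\imath=\sqrt{-1}$) is the probabilist's Hermite polynomial. The characteristic function of $X$ is $\phi_X(u)=\mathbb{E}[e^{\imath uX}]$, and the cumulants $\kappa_j$ of $X$ are the coefficients in $\phi_X(u)=\exp\big(\frac{\kappa_1}{1!}(\imath u)+\frac{\kappa_2}{2!}(\imath u)^2+\frac{\kappa_3}{3!}(\imath u)^3+\cdots\big)$. *)

(* Defs.v *)
From HB Require Import structures.
From mathcomp Require Import all_boot all_order all_algebra.
From mathcomp Require Import all_classical all_reals all_analysis.
From mathcomp Require Import complex.

Set Implicit Arguments.
Unset Strict Implicit.
Unset Printing Implicit Defensive.

Import Order.TTheory GRing.Theory Num.Theory.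
Import numFieldNormedType.Exports.
Import ComplexField.Normc.

Local Open Scope classical_set_scope.
Local Open Scope ring_scope.
Local Open Scope complex_scope.

Definition cexp (R : realType) (z : R[i]) : R[i] :=
  let: a +i* b := z in (expR a * cos b) +i* (expR a * sin b).

Definition cexpectation d (T : measurableType d) (R : realType)
    (P : probability T R) (Z : T -> R[i]) : R[i] :=
  fine ('E_P[fun t => complex.Re (Z t)])%E +i*
  fine ('E_P[fun t => complex.Im (Z t)])%E.

Definition char_fun d (T : measurableType d) (R : realType)
    (P : probability T R) (X : T -> R) (u : R) : R[i] :=
  cexpectation P (fun t => cexp (0 +i* (u * X t))).

(* The expectation is real because Z and - Z have the same law; [Re] only
   moves it from R[i] to R. *)
Definition hermite (R : realType) (k : nat) (x : R) : R :=
  complex.Re (cexpectation (@normal_prob R 0 1) (fun z => (x +i* z) ^+ k)).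

(* kappa 1, ..., kappa m are the cumulants of X of order at most m: as u -> 0,
     phi_X(u) = exp (sum_(1 <= j <= m) kappa_j / j! (iu)^j + O(u^(m+1))).
   This determines kappa 1, ..., kappa m; the other values of kappa are
   irrelevant.  The series in the exponent is read as an asymptotic expansion,
   with no claim that it converges. *)
Definition is_cumulants d (T : measurableType d) (R : realType)
    (P : probability T R) (X : T -> R) (m : nat) (kappa : nat -> R) : Prop :=
  exists C : R, \forall u \near (0 : R),
    exists2 r : R[i], normc r <= C * `|u| ^+ m.+1 &
      char_fun P X u =
      cexp (\sum_(1 <= j < m.+1) (kappa j / j`!%:R)%:C * (0 +i* u) ^+ j + r).

Definition independent_RVs d (T : measurableType d) (R : realType)
    (P : probability T R) (X : nat -> {RV P >-> R}) : Prop :=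
  forall (J : seq nat) (A : nat -> set R), uniq J ->
    (forall j, measurable (A j)) ->
    P (\big[setI/setT]_(j <- J) (X j @^-1` A j)) =
    (\prod_(j <- J) P (X j @^-1` A j))%E.

Definition same_law d (T : measurableType d) (R : realType)
    (P : probability T R) (X Y : {RV P >-> R}) : Prop :=
  forall A : set R, measurable A -> distribution P X A = distribution P Y A.

Definition normalized_sum d (T : measurableType d) (R : realType)
    (P : probability T R) (X : nat -> {RV P >-> R}) (n : nat) (t : T) : R :=
  (Num.sqrt n%:R)^-1 * \sum_(j < n) X j t.

Definition is_density d (T : measurableType d) (R : realType)
    (P : probability T R) (Y : T -> R) (f : R -> R) : Prop :=
  [/\ measurable_fun setT f, forall x, 0 <= f x &
      forall A : set R, measurable A ->
        P (Y @^-1` A) = (\int[lebesgue_measure]_(x in A) (f x)%:E)%E].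

Definition gauss_density (R : realType) (sigma x : R) : R :=
  (Num.sqrt (2 * pi * sigma ^+ 2))^-1 * expR (- (x ^+ 2 / (2 * sigma ^+ 2))).

(* Main.v *)
Require Import Defs.
From HB Require Import structures.
From mathcomp Require Import all_boot all_order all_algebra.
From mathcomp Require Import all_classical all_reals all_analysis.
From mathcomp Require Import complex.
From mathcomp Require Import measurable_realfun.
From mathcomp Require Import ring lra.

Set Implicit Arguments.
Unset Strict Implicit.
Unset Printing Implicit Defensive.

Import Order.TTheory GRing.Theory Num.Theory.
Import numFieldNormedType.Exports.
Import ComplexField.Normc.

Local Open Scope classical_set_scope.
Local Open Scope ring_scope.

(** Write phi for the characteristic function of X, s for sqrt n and c for
    kappa_k / k!.  By independence, S_n has the characteristic function
    phi (u / s) ^ n, so everything is read off its Fourier transform.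

    The cumulant hypothesis says that near the origin
      phi t = exp (- sigma^2 t^2 / 2 + c (i t)^k + O(t^(k+1))):
    the first two cumulants are forced to be the mean and the variance, because
    the second-order expansion of phi at 0 is known independently (dominated
    convergence), and the cumulants between 3 and k vanish.  Hence, for
    |u| <= delta s,
      phi (u / s) ^ n = e^(- sigma^2 u^2 / 2) exp W,
      W = s^(-(k-2)) c (i u)^k + O(s^(-(k-1)) |u|^(k+1)).
    Replacing exp W by 1 + s^(-(k-2)) c (i u)^k costs O(|W|^2), which is of order
    s^(-2(k-2)) <= s^(-(k-1)) since k >= 3, up to a factor polynomial in u; for
    delta small |W| <= sigma^2 u^2 / 4, so half of the Gaussian factor survives
    and makes the error integrable (edgeworth_low_frequency).

    For |u| >= delta s, the approximation is Gaussian-small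
    (edgeworth_high_frequency), and |phi (u / s)| <= q < 1
    (char_fun_bounded_away).  This is where the integrability of |phi|^v enters:
    with the Lipschitz continuity of phi it makes |phi| small far from the
    origin, and the inequality
      1 - |phi (2 u)| <= 4 (1 - |phi u|)
    transports this to every u outside a neighbourhood of 0.  Keeping V >= v of
    the n factors for integrability, the others contribute q^(n - V), smaller
    than any power of n.  In particular phi (u / s) ^ n is integrable for n >= V.

    So phi (u / s) ^ n and its approximation differ by O(s^(-(k-1))) in L^1, and
    their inverse Fourier transforms by as much, uniformly in x
    (edgeworth_fourier_inv).  The inverse transform of phi (u / s) ^ n is a
    continuous density of S_n (fourier_inversion): smoothing by a Gaussian of
    small width makes the inversion formula an instance of Fubini, and the
    smoothing is removed on intervals by a sandwich argument.  The inverse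
    transform of the approximation is the right-hand side of the theorem, because
    the Fourier transform of (i u)^k e^(- sigma^2 u^2 / 2) and the Hermite polynomials
    obey the same recurrence, obtained from the same Gaussian integration by parts
    (stein, fourier_monomial_gauss). *)

(** * Integrals of real functions and elementary estimates *)

Section real_integral.
Context d (T : measurableType d) (R : realType) (mu : {measure set T -> \bar R}).
Implicit Types f g : T -> R.

Lemma dominated_integrable f g : measurable_fun setT f ->
  mu.-integrable setT (EFin \o g) -> (forall x, `|f x| <= g x) ->
  mu.-integrable setT (EFin \o f).
Proof.
move=> mf ig fg; apply: le_integrable ig => //; first exact/measurable_EFinP.
by move=> x _ /=; rewrite lee_fin (le_trans (fg x)) ?ler_norm.
Qed.

Lemma dominated_Rintegral f g : measurable_fun setT f ->
  mu.-integrable setT (EFin \o g) -> (forall x, `|f x| <= g x) ->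
  `|\int[mu]_x f x| <= \int[mu]_x g x.
Proof.
move=> mf ig fg.
have jf := dominated_integrable mf ig fg.
apply: (le_trans (le_normr_Rintegral _ jf)) => //.
by apply: le_Rintegral => //; exact: integrable_norm.
Qed.

Lemma integrable_addR f g : mu.-integrable setT (EFin \o f) ->
  mu.-integrable setT (EFin \o g) ->
  mu.-integrable setT (EFin \o (fun x => f x + g x)).
Proof. by move=> jf ig; have := integrableD measurableT jf ig. Qed.

Lemma integrable_subR f g : mu.-integrable setT (EFin \o f) ->
  mu.-integrable setT (EFin \o g) ->
  mu.-integrable setT (EFin \o (fun x => f x - g x)).
Proof. by move=> jf ig; have := integrableB measurableT jf ig. Qed.

Lemma integrable_scaleR (c : R) f : mu.-integrable setT (EFin \o f) ->
  mu.-integrable setT (EFin \o (fun x => c * f x)).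
Proof. by move=> jf; have := @integrableZl _ _ _ _ _ measurableT c _ jf. Qed.

Lemma measurable_of_integrable f : mu.-integrable setT (EFin \o f) ->
  measurable_fun setT f.
Proof. by move/measurable_int/measurable_EFinP. Qed.

Lemma EFin_Rintegral f : mu.-integrable setT (EFin \o f) ->
  (\int[mu]_x (f x)%:E)%E = (\int[mu]_x f x)%:E.
Proof. by move=> jf; rewrite /Rintegral fineK//; exact: integrable_fin_num. Qed.

Lemma dominated_cvg_Rintegral (f_ : nat -> T -> R) f g :
  (forall n, measurable_fun setT (f_ n)) -> measurable_fun setT f ->
  mu.-integrable setT (EFin \o g) -> (forall n x, `|f_ n x| <= g x) ->
  (forall x, f_ n x @[n --> \oo] --> f x) ->
  \int[mu]_x f_ n x @[n --> \oo] --> \int[mu]_x f x.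
Proof.
move=> mf_ mf ig f_g f_f; apply: fine_cvg.
have gf x : `|f x| <= g x.
  have h : `|f_ n x| @[n --> \oo] --> `|f x| by apply: cvg_norm; exact: f_f.
  by apply: (cvgr_to_le h); exact: nearW.
rewrite -EFin_Rintegral; last exact: (dominated_integrable mf ig gf).
have [||||| _ _] := @dominated_convergence _ _ _ mu setT measurableT
  (fun n => EFin \o f_ n) (EFin \o f) (EFin \o g); last by apply.
- by move=> n; exact/measurable_EFinP.
- exact/measurable_EFinP.
- by apply: aeW => x _ /=; apply: cvg_EFin; [exact: nearW|exact: f_f].
- by [].
- by apply: aeW => x n _ /=; rewrite lee_fin.
Qed.

End real_integral.

Section elementary.
Variable R : realType.
Implicit Types x y a b : R.

(** The bound on the derivative is required on a ball around 0, not only between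
    x and y, which keeps the applications free of a case distinction on signs. *)
Lemma MVT_bound (f df : R -> R) (K : R) x y :
  (forall z : R, is_derive z 1 f (df z)) ->
  (forall z, `|z| <= Num.max `|x| `|y| -> `|df z| <= K) ->
  `|f y - f x| <= K * `|y - x|.
Proof.
have cf (z : R) : is_derive z 1 f (df z) -> {for z, continuous f}.
  by move=> [h _]; apply/differentiable_continuous; exact/derivable1_diffP.
wlog xy : x y / x <= y.
  move=> H dfE b; have [xy|/ltW yx] := leP x y; first exact: H.
  rewrite distrC [`|y - x|]distrC; apply: H => // z; rewrite maxC; exact: b.
move=> dfE b.
have [|c cxy ->] := @MVT_segment R f df x y xy (fun z _ => dfE z).
  by apply: continuous_subspaceT => z; exact: cf.
rewrite normrM ler_wpM2r// b//.
move: cxy; rewrite in_itv/= => /andP[xc cy].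
rewrite le_max; have [c0|c0] := leP 0 c; apply/orP; [right|left].
  by rewrite ger0_norm// (le_trans cy)// ler_norm.
by rewrite ltr0_norm// -normrN (le_trans _ (ler_norm _))// lerN2.
Qed.

Lemma cos_lipschitz x y : `|cos y - cos x| <= `|y - x|.
Proof.
rewrite -[leRHS]mul1r; apply: (@MVT_bound cos (fun z => - sin z)) => z _.
by rewrite normrN sin_max.
Qed.

Lemma sin_lipschitz x y : `|sin y - sin x| <= `|y - x|.
Proof.
rewrite -[leRHS]mul1r; apply: (@MVT_bound sin cos) => z _.
by rewrite cos_max.
Qed.

Lemma sin_norm_le x : `|sin x| <= `|x|.
Proof. by have := sin_lipschitz 0 x; rewrite sin0 !subr0. Qed.

Lemma one_sub_cos_le x : `|1 - cos x| <= x ^+ 2 / 2.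
Proof.
have -> : x = (x / 2) *+ 2 by rewrite -mulr_natr mulfVK.
rewrite cos_mulr2n cos2sin2.
have := sin_norm_le (x / 2); rewrite -ler_sqr ?nnegrE// !real_normK ?num_real// => h.
by rewrite ger0_norm; nra.
Qed.

Lemma sin_sub_le x : `|sin x - x| <= x ^+ 2.
Proof.
have -> : sin x - x = (sin x - x) - (sin 0 - 0) by rewrite sin0; ring.
have -> : x ^+ 2 = `|x| * `|x - 0| by rewrite subr0 -normrM ger0_norm ?sqr_ge0.
apply: (@MVT_bound (fun z => sin z - z) (fun z => cos z - 1)) => z zx.
have := cos_lipschitz 0 z; rewrite cos0 subr0 => /le_trans; apply.
by rewrite (le_trans zx)// normr0 ge_max lexx normr_ge0.
Qed.

Lemma expR_sub1_le x : `|expR x - 1| <= `|x| * expR `|x|.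
Proof.
rewrite -[X in _ - X]expR0 -[X in `|X| * _]subr0 mulrC.
apply: (@MVT_bound expR expR) => z; rewrite normr0 max_r ?normr_ge0// => zx.
by rewrite gtr0_norm ?expR_gt0// ler_expR (le_trans (ler_norm _)).
Qed.

Lemma expR_sub1D_le x : `|expR x - 1 - x| <= x ^+ 2 * expR `|x|.
Proof.
have -> : expR x - 1 - x = (expR x - x) - (expR 0 - 0) by rewrite expR0; ring.
have -> : x ^+ 2 * expR `|x| = (`|x| * expR `|x|) * `|x - 0|.
  by rewrite subr0 [RHS]mulrAC -normrM ger0_norm ?sqr_ge0.
apply: (@MVT_bound (fun z => expR z - z) (fun z => expR z - 1)) => z.
rewrite normr0 max_r ?normr_ge0// => zx.
by rewrite (le_trans (expR_sub1_le z))// ler_pM ?expR_ge0// ler_expR.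
Qed.

Lemma pow_le_expR (n : nat) x : 0 <= x -> x ^+ n <= n`!%:R * expR x.
Proof.
case: n => [|n] x0; first by rewrite expr0 fact0 mul1r -[leLHS]expR0 ler_expR.
rewrite -ler_pdivrMl ?ltr0n ?fact_gt0// mulrC.
by apply: le_trans (expR_ge1Dxn n x0); rewrite lerDr.
Qed.

Lemma geometric_pow_bounded (q : R) (k : nat) : 0 < q < 1 ->
  exists K, forall n : nat, q ^+ n * n%:R ^+ k <= K.
Proof.
move=> /andP[q0 q1]; set c := - ln q.
have c0 : 0 < c by rewrite oppr_gt0 ln_lt0// q0.
exists (k`!%:R / c ^+ k) => n.
have -> : q ^+ n = expR (- (c * n%:R)).
  by rewrite -mulNr opprK mulrC expRM_natl lnK.
rewrite ler_pdivlMr ?exprn_gt0// -mulrA -exprMn mulrC expRN.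
rewrite ler_pdivrMr ?expR_gt0// [n%:R * c]mulrC.
by apply: pow_le_expR; rewrite mulr_ge0// ltW.
Qed.

Lemma normc_ge_Re (z : R[i]) : `|complex.Re z| <= normc z.
Proof. by have := normc_ge_Re z; rewrite lecR. Qed.

Lemma normc_ge_Im (z : R[i]) : `|complex.Im z| <= normc z.
Proof.
case: z => a b /=; rewrite -[leLHS]sqrtr_sqr ler_sqrt ?addr_ge0 ?sqr_ge0//.
by rewrite lerDr sqr_ge0.
Qed.

Lemma normc_le_ReIm (z : R[i]) : normc z <= `|complex.Re z| + `|complex.Im z|.
Proof.
case: z => a b /=; rewrite -[leRHS]ger0_norm ?addr_ge0// -sqrtr_sqr.
rewrite ler_sqrt ?sqr_ge0// sqrrD !real_normK ?num_real//.
by rewrite -addrA lerD2l lerDr mulrn_wge0// mulr_ge0.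
Qed.

Lemma normc_ge0 (z : R[i]) : 0 <= normc z.
Proof. exact: le_trans (normr_ge0 _) (normc_ge_Re z). Qed.

Lemma normcX (z : R[i]) n : normc (z ^+ n) = normc z ^+ n.
Proof. by elim: n => [|n IH]; rewrite ?expr0 ?normc1// !exprS normcM IH. Qed.

Lemma normc_real (a : R) : normc (a%:C)%C = `|a|.
Proof. by rewrite /= expr0n addr0 sqrtr_sqr. Qed.

Lemma cexpD (z w : R[i]) : cexp (z + w) = cexp z * cexp w.
Proof.
case: z w => [a b] [c e] /=; rewrite expRD cosD sinD.
by apply/eqP; rewrite eq_complex /=; apply/andP; split; apply/eqP; ring.
Qed.

Lemma cexp0 : cexp (0 : R[i]) = 1.
Proof. by rewrite /cexp /= expR0 cos0 sin0 !mul1r. Qed.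

Lemma cexpM_nat n (z : R[i]) : cexp (n%:R * z) = cexp z ^+ n.
Proof.
elim: n => [|n IH]; first by rewrite mul0r cexp0 expr0.
by rewrite -natr1 mulrDl mul1r cexpD IH exprSr.
Qed.

Lemma normc_cexp (z : R[i]) : normc (cexp z) = expR (complex.Re z).
Proof.
case: z => a b /=; rewrite !exprMn -mulrDr cos2Dsin2 mulr1 sqrtr_sqr.
by rewrite gtr0_norm ?expR_gt0.
Qed.

(** The constant 5 is what comes out of bounding the real and imaginary parts
    separately. *)
Lemma cexp_sub1D_le (z : R[i]) :
  normc (cexp z - 1 - z) <= 5 * normc z ^+ 2 * expR (normc z).
Proof.
set m := normc z.
have ram : `|complex.Re z| <= m := normc_ge_Re z.
have ibm : `|complex.Im z| <= m := normc_ge_Im z.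
have m0 : 0 <= m := normc_ge0 z.
apply: (le_trans (normc_le_ReIm _)); case: z @m ram ibm m0 => a b m /= am bm m0.
set E := expR m.
have E1 : 1 <= E by rewrite -expR0 ler_expR.
have ea : expR a <= E by rewrite ler_expR (le_trans (ler_norm a)).
have e0 := expR_gt0 a.
have a2 : a ^+ 2 <= m ^+ 2 by rewrite -[a ^+ 2]real_normK ?num_real// lerXn2r.
have b2 : b ^+ 2 <= m ^+ 2 by rewrite -[b ^+ 2]real_normK ?num_real// lerXn2r.
have em : expR `|a| <= E by rewrite ler_expR.
have h1 : `|expR a * cos b - 1 - a| <= m ^+ 2 * E + E * (m ^+ 2 / 2).
  have -> : expR a * cos b - 1 - a = (expR a - 1 - a) - expR a * (1 - cos b).
    by ring.
  apply: (le_trans (ler_normB _ _)); apply: lerD.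
    by apply: (le_trans (expR_sub1D_le a)); rewrite ler_pM// ?sqr_ge0 ?expR_ge0.
  rewrite normrM (gtr0_norm e0) ler_pM ?(ltW e0)//.
  by apply: (le_trans (one_sub_cos_le b)); rewrite ler_pM2r.
have h2 : `|expR a * sin b - b| <= m ^+ 2 * E + m ^+ 2 * E.
  have -> : expR a * sin b - b = (expR a - 1) * sin b + (sin b - b) by ring.
  apply: (le_trans (ler_normD _ _)); apply: lerD.
    rewrite normrM expr2 -mulrA [m * E]mulrC mulrA ler_pM//.
      by apply: (le_trans (expR_sub1_le a)); rewrite ler_pM ?expR_ge0.
    exact: le_trans (sin_norm_le b) bm.
  apply: (le_trans (sin_sub_le b)); apply: (le_trans b2).
  by rewrite ler_peMr ?sqr_ge0.
rewrite !subr0; apply: (le_trans (lerD h1 h2)).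
have : 0 <= m ^+ 2 * E by rewrite mulr_ge0 ?sqr_ge0 ?expR_ge0.
lra.
Qed.

Lemma cexp_sub1D_bound (z : R[i]) (M L : R) : normc z <= M -> normc z <= L ->
  normc (cexp z - 1 - z) <= 5 * M ^+ 2 * expR L.
Proof.
move=> zM zL; apply: (le_trans (cexp_sub1D_le z)).
have z0 := normc_ge0 z.
apply: ler_pM; [|exact: expR_ge0| |by rewrite ler_expR].
  by apply: mulr_ge0 => //; exact: sqr_ge0.
by rewrite ler_pM2l// lerXn2r// nnegrE (le_trans z0).
Qed.

End elementary.

(** * Characteristic functions *)

Section probability_integral.
Context d (T : measurableType d) (R : realType) (P : probability T R).
Implicit Types f g : T -> R.

Lemma bounded_integrable f (M : R) : measurable_fun setT f ->
  (forall t, `|f t| <= M) -> P.-integrable setT (EFin \o f).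
Proof.
move=> mf fM; apply: (dominated_integrable mf (g := cst M)) => //.
exact: finite_measure_integrable_cst.
Qed.

Lemma Rintegral_prob_cst (c : R) : \int[P]_t c = c.
Proof. by rewrite Rintegral_cst// [X in fine X](@probability_setT _ _ _ P) mulr1. Qed.

End probability_integral.

Section characteristic_function.
Context d (T : measurableType d) (R : realType) (P : probability T R).
Variable X : T -> R.
Hypothesis mX : measurable_fun setT X.
Local Notation phi := (char_fun P X).

Lemma measurable_cosX (u : R) : measurable_fun setT (fun t => cos (u * X t)).
Proof.
apply: (@measurableT_comp _ _ _ _ _ _ (@cos R)).
  by apply: continuous_measurable_fun; exact: continuous_cos.
exact: measurable_funM.
Qed.

Lemma measurable_sinX (u : R) : measurable_fun setT (fun t => sin (u * X t)).
Proof.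
apply: (@measurableT_comp _ _ _ _ _ _ (@sin R)).
  by apply: continuous_measurable_fun; exact: continuous_sin.
exact: measurable_funM.
Qed.

Lemma integrable_cosX (u : R) :
  P.-integrable setT (EFin \o (fun t => cos (u * X t))).
Proof.
by apply: (@bounded_integrable _ _ _ P _ 1) => [|t];
  [exact: measurable_cosX|exact: cos_max].
Qed.

Lemma integrable_sinX (u : R) :
  P.-integrable setT (EFin \o (fun t => sin (u * X t))).
Proof.
by apply: (@bounded_integrable _ _ _ P _ 1) => [|t];
  [exact: measurable_sinX|exact: sin_max].
Qed.

Lemma Re_char_fun (u : R) : complex.Re (phi u) = \int[P]_t cos (u * X t).
Proof.
rewrite /= unlock /Rintegral; congr fine; apply: eq_integral => t _ /=.
by rewrite expR0 mul1r.
Qed.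

Lemma Im_char_fun (u : R) : complex.Im (phi u) = \int[P]_t sin (u * X t).
Proof.
rewrite /= unlock /Rintegral; congr fine; apply: eq_integral => t _ /=.
by rewrite expR0 mul1r.
Qed.

Lemma Rintegral_cos_sin (c s u : R) :
  \int[P]_t (c * cos (u * X t) + s * sin (u * X t)) =
  c * complex.Re (phi u) + s * complex.Im (phi u).
Proof.
have ic := integrable_cosX u; have js := integrable_sinX u.
rewrite RintegralD ?RintegralZl ?Re_char_fun ?Im_char_fun//;
  exact: integrable_scaleR.
Qed.

Lemma cauchy_schwarz2 (a b c s : R) : c ^+ 2 + s ^+ 2 = 1 ->
  `|c * a + s * b| <= Num.sqrt (a ^+ 2 + b ^+ 2).
Proof.
move=> cs; rewrite -sqrtr_sqr ler_sqrt ?addr_ge0 ?sqr_ge0//.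
rewrite -subr_ge0.
have -> : a ^+ 2 + b ^+ 2 - (c * a + s * b) ^+ 2 =
  (s * a - c * b) ^+ 2 + (1 - (c ^+ 2 + s ^+ 2)) * (a ^+ 2 + b ^+ 2) by ring.
by rewrite cs subrr mul0r addr0 sqr_ge0.
Qed.

Lemma cos_sin_bound (c s y : R) : c ^+ 2 + s ^+ 2 = 1 ->
  `|c * cos y + s * sin y| <= 1.
Proof. by move=> cs; have := cauchy_schwarz2 (cos y) (sin y) cs; rewrite cos2Dsin2 sqrtr1. Qed.

(** The pair (c, s) is the direction of phi u in the plane.  It writes the modulus
    of phi u as the expectation of the real variable c cos (u X) + s sin (u X), of
    absolute value at most 1. *)
Lemma char_fun_polar (u : R) : exists c s, c ^+ 2 + s ^+ 2 = 1 /\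
  c * complex.Re (phi u) + s * complex.Im (phi u) = normc (phi u).
Proof.
case: (phi u) => a b /=; set m := Num.sqrt _.
have m2 : m ^+ 2 = a ^+ 2 + b ^+ 2 by rewrite sqr_sqrtr// addr_ge0 ?sqr_ge0.
have [m0|m0] := eqVneq m 0.
  move: m2; rewrite m0 expr0n/= => /esym/eqP; rewrite paddr_eq0 ?sqr_ge0//.
  rewrite !sqrf_eq0 => /andP[/eqP-> /eqP->].
  by exists 1, 0; split; ring.
exists (a / m), (b / m); split.
  by rewrite !expr_div_n -mulrDl -m2 divff// expf_neq0.
by rewrite mulrAC -expr2 [_ / m * b]mulrAC -expr2 -mulrDl -m2 expr2 mulfK.
Qed.

Lemma normc_char_fun_le1 (u : R) : normc (phi u) <= 1.
Proof.
have [c [s [cs <-]]] := char_fun_polar u; rewrite -Rintegral_cos_sin.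
rewrite (le_trans (ler_norm _))// -[leRHS](Rintegral_prob_cst P).
apply: dominated_Rintegral => [||t].
- by apply: measurable_funD; apply: measurable_funM => //;
    [exact: measurable_cosX|exact: measurable_sinX].
- exact: finite_measure_integrable_cst.
- exact: cos_sin_bound.
Qed.

(** With Y = c cos (u X) + s sin (u X) of mean |phi u|, the variable 2 Y^2 - 1 is
    the projection of e^(2 i u X) on the direction of doubled angle, so its mean
    is at most |phi (2 u)|; and E[Y^2] >= E[Y]^2 gives
    |phi (2 u)| >= 2 |phi u|^2 - 1. *)
Lemma char_fun_doubling (u : R) :
  1 - normc (phi (2 * u)) <= 4 * (1 - normc (phi u)).
Proof.
have [c [s [cs mE]]] := char_fun_polar u; set m := normc (phi u) in mE *.
have m1 : m <= 1 := normc_char_fun_le1 u.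
(* Y has mean m by the choice of the direction (c, s) *)
pose Y t := c * cos (u * X t) + s * sin (u * X t).
have mY : measurable_fun setT Y.
  by apply: measurable_funD; apply: measurable_funM => //;
    [exact: measurable_cosX|exact: measurable_sinX].
have Y1 t : `|Y t| <= 1 by exact: cos_sin_bound.
have iY := bounded_integrable P mY Y1.
have iY2 : P.-integrable setT (EFin \o (fun t => Y t ^+ 2)).
  apply: (@bounded_integrable _ _ _ P _ 1) => [|t]; first exact: measurable_funX.
  by rewrite normrX expr_le1.
have EY : \int[P]_t Y t = m by rewrite Rintegral_cos_sin.
have var : 0 <= \int[P]_t (Y t ^+ 2) - m ^+ 2.
  have -> : \int[P]_t (Y t ^+ 2) - m ^+ 2 = \int[P]_t ((Y t - m) ^+ 2).
    have -> : (fun t => (Y t - m) ^+ 2) =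
        (fun t => Y t ^+ 2 + ((- (2 * m)) * Y t + m ^+ 2)).
      by apply/funext => t; ring.
    rewrite RintegralD//; last first.
      apply: integrable_addR; first exact: integrable_scaleR.
      exact: finite_measure_integrable_cst.
    rewrite RintegralD//; last 2 first.
    - exact: integrable_scaleR.
    - exact: finite_measure_integrable_cst.
    by rewrite RintegralZl// EY Rintegral_prob_cst; ring.
  by apply: Rintegral_ge0 => t _; rewrite sqr_ge0.
have E2 : 2 * \int[P]_t (Y t ^+ 2) - 1 =
    (c ^+ 2 - s ^+ 2) * complex.Re (phi (2 * u)) +
    (2 * c * s) * complex.Im (phi (2 * u)).
  rewrite -Rintegral_cos_sin -RintegralZl//.
  rewrite -[X in _ - X](Rintegral_prob_cst P) -RintegralB//; last 2 first.
  - exact: integrable_scaleR.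
  - exact: finite_measure_integrable_cst.
  apply: eq_Rintegral => t _.
  have -> : 2 * u * X t = (u * X t) *+ 2 by rewrite -mulr_natl; ring.
  rewrite cos_mulr2n sin_mulr2n /Y.
  have := cos2Dsin2 (u * X t); move: (cos _) (sin _) => C S CS.
  apply/eqP; rewrite -subr_eq0; apply/eqP.
  transitivity (2 * s ^+ 2 * (C ^+ 2 + S ^+ 2 - 1) + (c ^+ 2 + s ^+ 2 - 1)).
    by ring.
  by rewrite CS cs !subrr mulr0 addr0.
have : (c ^+ 2 - s ^+ 2) * complex.Re (phi (2 * u)) +
    (2 * c * s) * complex.Im (phi (2 * u)) <= normc (phi (2 * u)).
  apply: (le_trans (ler_norm _)).
  case: (phi (2 * u)) => a b /=; apply: cauchy_schwarz2.
  have -> : (c ^+ 2 - s ^+ 2) ^+ 2 + (2 * c * s) ^+ 2 = (c ^+ 2 + s ^+ 2) ^+ 2.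
    by ring.
  by rewrite cs expr1n.
rewrite -E2; have : 0 <= m := normc_ge0 _; nra.
Qed.

End characteristic_function.

Section lipschitz.
Variable R : realType.

Lemma lipschitz_continuous (f : R -> R) (K : R) :
  (forall x y, `|f x - f y| <= K * `|x - y|) -> continuous f.
Proof.
move=> fK x; apply/cvgrPdist_le => e e0; near=> y.
apply: (le_trans (fK x y)).
apply: (@le_trans _ _ ((`|K| + 1) * `|x - y|)).
  by rewrite ler_wpM2r// (le_trans (ler_norm _))// lerDl.
rewrite mulrC -ler_pdivlMr ?ltr_wpDl//.
near: y; apply: cvgr_dist_le; first exact: cvg_id.
by rewrite divr_gt0// ltr_wpDl.
Unshelve. all: by end_near. Qed.

Lemma normc_lipschitz (z w : R[i]) :
  `|normc z - normc w| <=
  `|complex.Re z - complex.Re w| + `|complex.Im z - complex.Im w|.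
Proof.
wlog zw : z w / normc w <= normc z => [H|].
  have [/H//|/ltW wz] := leP (normc w) (normc z).
  rewrite distrC [X in _ <= X + _]distrC [X in _ <= _ + X]distrC; exact: H.
rewrite ger0_norm ?subr_ge0// lerBlDr.
have {1}-> : z = (z - w) + w by rewrite subrK.
rewrite (le_trans (le_normcD _ _))// lerD2r (le_trans (normc_le_ReIm _))//.
by case: z {zw} => a b; case: w.
Qed.

(** Where f exceeds 1/2, the Lipschitz condition keeps it above 1/4 on an interval
    of fixed length, which costs a fixed amount of the integral of f^v; far from
    the origin that amount is no longer available. *)
Lemma lipschitz_integrable_pow_tail (f : R -> R) (K v : R) : 0 < K -> 0 <= v ->
  (forall x y, `|f x - f y| <= K * `|x - y|) -> (forall x, 0 <= f x) ->
  (\int[lebesgue_measure]_u ((f u) `^ v)%:E < +oo)%E ->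
  exists M : R, forall x, M <= `|x| -> f x <= 2^-1.
Proof.
move=> K0 v0 fK f0 fv.
have cf := lipschitz_continuous fK.
pose g u := f u `^ v.
have g0 u : 0 <= g u by exact: powR_ge0.
have mg : measurable_fun setT g.
  apply: (measurableT_comp (measurable_powR v)).
  exact: continuous_measurable_fun.
have ig : lebesgue_measure.-integrable setT (EFin \o g).
  apply/integrableP; split; first exact/measurable_EFinP.
  by under eq_integral do rewrite /= ger0_norm//.
pose A (n : nat) := ~` `[- n%:R, n%:R]%classic : set R.
pose g_ n u := g u * \1_(A n) u.
have mA n : measurable (A n) by apply: measurableC; exact: measurable_itv.
have mg_ n : measurable_fun setT (g_ n) by exact: measurable_funM.
have g_g n u : `|g_ n u| <= g u.
  rewrite /g_ indicE; case: (u \in _); first by rewrite mulr1 ger0_norm.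
  by rewrite mulr0 normr0.
have g_cvg u : g_ n u @[n --> \oo] --> (0 : R).
  apply: cvg_near_cst; near=> n.
  rewrite /g_ indicE memNset ?mulr0//= /A /setC/= in_itv/= -ler_norml.
  by apply; near: n; exact: nbhs_infty_ger.
have m0 : @measurable_fun _ _ (measurableTypeR R) R setT (cst 0) by [].
have : \int[lebesgue_measure]_x g_ n x @[n --> \oo] --> (0 : R).
  have := @dominated_cvg_Rintegral _ _ _ lebesgue_measure _ _ _ mg_ m0 ig g_g g_cvg.
  by rewrite {2}/Rintegral integral0.
(* an interval of length h lowers f by at most K h = 1/4 *)
set h := (4 * K)^-1.
have h0 : 0 < h by rewrite invr_gt0 mulr_gt0.
set c := (4^-1) `^ v * h.
have c0 : 0 < c by rewrite mulr_gt0// powR_gt0// invr_gt0.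
move=> /cvgrPdist_lt /(_ _ c0) [n _ /(_ n (leqnn n))] /=.
rewrite sub0r normrN => gn.
exists (n%:R + h + 1) => x Mx; rewrite leNgt; apply/negP => fx.
move: gn; apply/negP; rewrite -leNgt; apply: le_trans (ler_norm _).
have -> : c = \int[lebesgue_measure]_u ((4^-1) `^ v * \1_(`[x, x + h]) u).
  rewrite RintegralZl//; last exact: integrable_indic_itv.
  rewrite /Rintegral integral_indic//= setIT lebesgue_measure_itv/= lte_fin.
  by rewrite ltrDl h0/= addrAC subrr add0r.
apply: le_Rintegral => //.
- by apply: integrable_scaleR; exact: integrable_indic_itv.
- exact: (@dominated_integrable _ _ _ lebesgue_measure _ _ (mg_ n) ig).
move=> u _; rewrite /g_ !indicE.
have [|_] := boolP (u \in `[x, x + h]%classic); last first.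
  by rewrite mulr0 mulr_ge0.
rewrite inE/= in_itv/= => /andP[xu uh].
have xuh : `|x - u| <= h by rewrite ler0_norm; lra.
rewrite mem_set/=; last first.
  rewrite /A /setC/= in_itv/= -ler_norml.
  have := ler_normD (x - u) u; rewrite subrK => H.
  by apply/negP; rewrite -ltNge; lra.
rewrite !mulr1 /g ge0_ler_powR ?nnegrE ?invr_ge0//.
have := fK x u; rewrite ler_norml => /andP[_ H].
have : K * `|x - u| <= K * h by rewrite ler_pM2l.
have : K * h = 4^-1 by rewrite /h invfM mulrCA divff ?mulr1// gt_eqF.
by lra.
Unshelve. all: by end_near. Qed.

End lipschitz.

(** * Characteristic functions of square-integrable variables *)

Section second_moment.
Context d (T : measurableType d) (R : realType) (P : probability T R).
Variable X : T -> R.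
Hypothesis mX : measurable_fun setT X.
Hypothesis iX2 : P.-integrable setT (EFin \o (fun t => X t ^+ 2)).
Local Notation phi := (char_fun P X).

Lemma integrable_of_square : P.-integrable setT (EFin \o X).
Proof.
apply: (@dominated_integrable _ _ _ P X (fun t => 1 + X t ^+ 2)) => //.
  by apply: integrable_addR => //; exact: finite_measure_integrable_cst.
move=> t; have := sqr_ge0 (`|X t| - 1); rewrite sqrrB1 real_normK ?num_real//.
by have := normr_ge0 (X t); lra.
Qed.

Let iX : P.-integrable setT (EFin \o X) := integrable_of_square.
Let iaX : P.-integrable setT (EFin \o (fun t => `|X t|)).
Proof. exact: integrable_norm. Qed.

Lemma lipschitz_Rintegral_RV (f : R -> R) (x y : R) :
  (forall a b, `|f a - f b| <= `|a - b|) ->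
  P.-integrable setT (EFin \o (fun t => f (x * X t))) ->
  P.-integrable setT (EFin \o (fun t => f (y * X t))) ->
  `|\int[P]_t f (x * X t) - \int[P]_t f (y * X t)| <=
  `|x - y| * \int[P]_t `|X t|.
Proof.
move=> fl ix iy; rewrite -RintegralB// -RintegralZl//.
apply: dominated_Rintegral => [||t].
- by apply: (@measurable_of_integrable _ _ _ P); exact: integrable_subR.
- exact: integrable_scaleR.
- by rewrite (le_trans (fl _ _))// -mulrBl normrM.
Qed.

Lemma char_fun_lipschitz : exists2 K : R, 0 < K &
  forall x y, `|complex.Re (phi x) - complex.Re (phi y)| +
   `|complex.Im (phi x) - complex.Im (phi y)| <= K * `|x - y|.
Proof.
exists (\int[P]_t `|X t| * 2 + 1).
  by rewrite ltr_wpDl// mulr_ge0//; apply: Rintegral_ge0.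
move=> x y; rewrite !Re_char_fun// !Im_char_fun//.
have hc := @lipschitz_Rintegral_RV cos x y (fun a b => cos_lipschitz b a)
  (integrable_cosX P mX x) (integrable_cosX P mX y).
have hs := @lipschitz_Rintegral_RV sin x y (fun a b => sin_lipschitz b a)
  (integrable_sinX P mX x) (integrable_sinX P mX y).
apply: (le_trans (lerD hc hs)).
have := normr_ge0 (x - y); move: (\int[P]_t `|X t|) => A; nra.
Qed.

Lemma continuous_Re_char_fun : continuous (fun u => complex.Re (phi u)).
Proof.
have [K _ H] := char_fun_lipschitz.
apply: (@lipschitz_continuous _ _ K) => x y; apply: le_trans (H x y).
by rewrite lerDl.
Qed.

Lemma continuous_Im_char_fun : continuous (fun u => complex.Im (phi u)).
Proof.
have [K _ H] := char_fun_lipschitz.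
apply: (@lipschitz_continuous _ _ K) => x y; apply: le_trans (H x y).
by rewrite lerDr.
Qed.

Lemma continuous_normc_char_fun : continuous (fun u => normc (phi u)).
Proof.
have [K _ H] := char_fun_lipschitz.
apply: (@lipschitz_continuous _ _ K) => x y; apply: le_trans (H x y).
exact: normc_lipschitz.
Qed.

(** |phi| <= 1/2 far from the origin, and every u with |u| >= delta gets there
    after m doublings, each of which multiplies 1 - |phi| by at most 4. *)
Lemma char_fun_bounded_away (v delta : R) : 0 <= v -> 0 < delta ->
  (\int[lebesgue_measure]_u (normc (phi u) `^ v)%:E < +oo)%E ->
  exists2 q : R, 0 < q < 1 & forall u, delta <= `|u| -> normc (phi u) <= q.
Proof.
move=> v0 d0 phiv.
have [K K0 H] := char_fun_lipschitz.
have [M HM] : exists M : R, forall x, M <= `|x| -> normc (phi x) <= 2^-1.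
  apply: (lipschitz_integrable_pow_tail K0 v0 _ _ phiv) => x *.
    by apply: (le_trans _ (H _ _)); exact: normc_lipschitz.
  exact: normc_ge0.
have [m Mm] : exists m : nat, M <= 2 ^+ m * delta.
  exists (Num.bound `|M / delta|); rewrite -ler_pdivrMr//.
  apply: (le_trans (ler_norm _)); apply: ltW.
  apply: lt_le_trans (archi_boundP (normr_ge0 _)) _ => //.
  by rewrite -natrX ler_nat ltnW// ltn_expl.
have dbl n u : 1 - normc (phi (2 ^+ n * u)) <= 4 ^+ n * (1 - normc (phi u)).
  elim: n => [|n IH]; first by rewrite !expr0 !mul1r.
  rewrite exprS -mulrA; apply: (le_trans (char_fun_doubling P mX _)).
  by rewrite [4 ^+ n.+1]exprS -mulrA ler_pM2l.
have f0 : 0 < 4 ^+ m :> R by rewrite exprn_gt0.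
exists (1 - (4 ^+ m)^-1 / 2).
  have : (4 ^+ m)^-1 <= 1 :> R by rewrite invf_le1// exprn_ege1// ler1n.
  have : 0 < (4 ^+ m)^-1 :> R by rewrite invr_gt0.
  by move=> ? ?; apply/andP; split; lra.
move=> u du.
have := dbl m u; have := HM (2 ^+ m * u); rewrite normrM ger0_norm ?exprn_ge0//.
move=> /(_ (le_trans Mm _)); rewrite ler_pM2l ?exprn_gt0// => /(_ du) h1 h2.
have : 2^-1 <= 4 ^+ m * (1 - normc (phi u)) by apply: le_trans h2; lra.
by rewrite mulrC -ler_pdivrMr// [2^-1 / _]mulrC; lra.
Qed.

Lemma cos_taylor2 (y : R) : `|1 - cos y - y ^+ 2 / 2| <= `|y| ^+ 3.
Proof.
have -> : 1 - cos y - y ^+ 2 / 2 =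
    (1 - cos y - y ^+ 2 / 2) - (1 - cos 0 - 0 ^+ 2 / 2).
  by rewrite cos0 expr0n/=; ring.
have -> : `|y| ^+ 3 = `|y| ^+ 2 * `|y - 0| by rewrite subr0 -exprSr.
apply: (@MVT_bound _ (fun z => 1 - cos z - z ^+ 2 / 2) (fun z => sin z - z)).
  move=> z; apply: is_derive_eq; rewrite /GRing.scale/=.
  by field.
move=> z; rewrite normr0 max_r// => zy; apply: (le_trans (sin_sub_le z)).
by rewrite -real_normK ?num_real// lerXn2r.
Qed.

Let u_ n : R := n.+1%:R^-1.

(** Along a sequence tending to 0 the limit follows by dominated convergence, with
    X^2 as the dominating function; a sequence is enough to identify kappa_2. *)
Lemma Re_char_fun_second_order :
  (1 - complex.Re (phi (u_ n))) / u_ n ^+ 2 @[n --> \oo] --> \int[P]_t (X t ^+ 2) / 2.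
Proof.
have un0 n : 0 < u_ n by rewrite invr_gt0.
have cvg0 : u_ n @[n --> \oo] --> (0:R) by exact: cvg_harmonic.
have -> : (fun n => (1 - complex.Re (phi (u_ n))) / u_ n ^+ 2) =
    (fun n => \int[P]_t ((1 - cos (u_ n * X t)) / u_ n ^+ 2)).
  apply/funext => n; rewrite Re_char_fun// RintegralZr//; last first.
    apply: integrable_subR; first exact: finite_measure_integrable_cst.
    exact: integrable_cosX.
  rewrite RintegralB//; last 2 first.
  - exact: finite_measure_integrable_cst.
  - exact: integrable_cosX.
  by rewrite Rintegral_prob_cst.
rewrite -RintegralZr//.
apply: (@dominated_cvg_Rintegral _ _ _ P _ _ (fun t => X t ^+ 2)) => //.
- move=> n; apply: measurable_funM => //; apply: measurable_funB => //.
  exact: measurable_cosX.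
- by apply: measurable_funM => //; exact: measurable_funX.
- move=> n t; rewrite normrM normfV [`|u_ n ^+ 2|]ger0_norm ?sqr_ge0//.
  rewrite ler_pdivrMr ?exprn_gt0// (le_trans (one_sub_cos_le _))//.
  by have := sqr_ge0 (u_ n * X t); rewrite exprMn [X t ^+ 2 * _]mulrC; lra.
- move=> t; apply/cvgrPdist_le => e e0.
  have : u_ n * `|X t| ^+ 3 @[n --> \oo] --> (0 : R).
    by rewrite -(mul0r (`|X t| ^+ 3)); apply: cvgMl.
  move/cvgrPdist_le => /(_ e e0); apply: filterS => n.
  rewrite sub0r normrN ger0_norm ?mulr_ge0 ?(ltW (un0 n)) ?exprn_ge0//.
  apply: le_trans.
  have -> : X t ^+ 2 / 2 - (1 - cos (u_ n * X t)) / u_ n ^+ 2 =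
      - (1 - cos (u_ n * X t) - (u_ n * X t) ^+ 2 / 2) / u_ n ^+ 2.
    have := lt0r_neq0 (un0 n); move: (u_ n) => w w0; field; exact: w0.
  rewrite normrM normrN normfV [`|u_ n ^+ 2|]ger0_norm ?sqr_ge0//.
  rewrite ler_pdivrMr ?exprn_gt0// (le_trans (cos_taylor2 _))//.
  by rewrite normrM exprMn ger0_norm ?(ltW (un0 n))// exprS; lra.
Qed.

Lemma Im_char_fun_first_order :
  complex.Im (phi (u_ n)) / u_ n @[n --> \oo] --> \int[P]_t X t.
Proof.
have un0 n : 0 < u_ n by rewrite invr_gt0.
have cvg0 : u_ n @[n --> \oo] --> (0:R) by exact: cvg_harmonic.
have -> : (fun n => complex.Im (phi (u_ n)) / u_ n) =
    (fun n => \int[P]_t (sin (u_ n * X t) / u_ n)).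
  apply/funext => n; rewrite Im_char_fun// RintegralZr//.
  exact: integrable_sinX.
apply: (@dominated_cvg_Rintegral _ _ _ P _ _ (fun t => `|X t|)) => //.
- by move=> n; apply: measurable_funM => //; exact: measurable_sinX.
- move=> n t; rewrite normrM normfV [`|u_ n|]gtr0_norm//.
  rewrite ler_pdivrMr// (le_trans (sin_norm_le _))//.
  by rewrite normrM gtr0_norm// mulrC.
- move=> t; apply/cvgrPdist_le => e e0.
  have : u_ n * X t ^+ 2 @[n --> \oo] --> (0 : R).
    by rewrite -(mul0r (X t ^+ 2)); apply: cvgMl.
  move/cvgrPdist_le => /(_ e e0); apply: filterS => n.
  rewrite sub0r normrN ger0_norm ?(mulr_ge0 (ltW (un0 n)) (sqr_ge0 _))//.
  apply: le_trans.
  have -> : X t - sin (u_ n * X t) / u_ n =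
      - (sin (u_ n * X t) - u_ n * X t) / u_ n.
    have := lt0r_neq0 (un0 n); move: (u_ n) => w w0; field; exact: w0.
  rewrite normrM normrN normfV [`|u_ n|]gtr0_norm//.
  rewrite ler_pdivrMr// (le_trans (sin_sub_le _))//.
  by rewrite exprMn; lra.
Qed.

Lemma harmonic_rate_cvg (x_ : nat -> R) (l B : R) :
  (\forall n \near \oo, `|x_ n - l| <= B * u_ n) -> x_ n @[n --> \oo] --> l.
Proof.
move=> H; apply/cvgrPdist_le => e e0.
have : B * u_ n @[n --> \oo] --> (0 : R).
  by rewrite -(mulr0 B); apply: cvgMr; exact: cvg_harmonic.
move/cvgrPdist_le => /(_ e e0) Be; near=> n.
rewrite distrC; have /le_trans -> // : `|x_ n - l| <= B * u_ n by near: n.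
apply: (le_trans (ler_norm _)); rewrite -normrN -sub0r.
by near: n.
Unshelve. all: by end_near. Qed.

Lemma near_harmonic (Q : R -> Prop) :
  (\forall u \near (0 : R), Q u) -> \forall n \near \oo, Q (u_ n).
Proof. by have := @cvg_harmonic R; apply. Qed.

End second_moment.

(** * Cumulants *)

Section cumulants.
Context d (T : measurableType d) (R : realType) (P : probability T R).
Variable X : T -> R.
Hypothesis mX : measurable_fun setT X.
Hypothesis iX2 : P.-integrable setT (EFin \o (fun t => X t ^+ 2)).
Variables (k : nat) (kappa : nat -> R).
Hypothesis k_ge3 : (3 <= k)%N.
Hypothesis kappa_lt_k : forall j, (3 <= j < k)%N -> kappa j = 0.
Hypothesis cumX : is_cumulants P X k kappa.
Local Notation phi := (char_fun P X).
Local Open Scope complex_scope.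

Lemma cumulant_sum (u : R) :
  \sum_(1 <= j < k.+1) (kappa j / j`!%:R)%:C * (0 +i* u) ^+ j =
  (0 +i* (kappa 1%N * u)) + (- (kappa 2%N / 2 * u ^+ 2))%:C +
  (kappa k / k`!%:R)%:C * (0 +i* u) ^+ k.
Proof.
have k1 : (1 <= k)%N by apply: leq_trans k_ge3.
have k2 : (2 <= k)%N by apply: leq_trans k_ge3.
rewrite big_nat_recr//=; congr (_ + _).
rewrite big_ltn// big_ltn//= big_nat big1 => [|j jk]; last first.
  by rewrite kappa_lt_k// mul0r mul0r.
apply/eqP; rewrite eq_complex expr1 expr2/= factS fact0 divr1.
by apply/andP; split; apply/eqP; ring.
Qed.

Lemma normc_iX (u : R) n : normc ((0 +i* u) ^+ n) = `|u| ^+ n.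
Proof. by rewrite normcX /= expr0n/= add0r sqrtr_sqr. Qed.

Let u_ n : R := n.+1%:R^-1.
Let un0 n : 0 < u_ n. Proof. by rewrite invr_gt0. Qed.
Let un1 n : u_ n <= 1. Proof. by rewrite invf_le1 ?ler1n. Qed.

Let c := kappa k / k`!%:R.

Lemma cumulant_expansion0 : exists C : R, 0 <= C /\
  \forall u \near (0 : R), exists2 r : R[i], normc r <= C * `|u| ^+ k.+1 &
  phi u = cexp ((0 +i* (kappa 1%N * u)) + (- (kappa 2%N / 2 * u ^+ 2))%:C +
     c%:C * (0 +i* u) ^+ k + r).
Proof.
have [C HC] := cumX; exists `|C|; split => //.
apply: filterS HC => u [r rC phiE]; exists r.
  by apply: (le_trans rC); rewrite ler_wpM2r ?exprn_ge0// ler_norm.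
by rewrite phiE cumulant_sum.
Qed.

Let pow_le (u : R) m n : 0 <= u <= 1 -> (m <= n)%N -> u ^+ n <= u ^+ m.
Proof. by move=> /andP[u0 u1] mn; exact: ler_wiXn2l. Qed.

(** Both sides are the limit of Im (phi u) / u along u = 1 / (n + 1): one from the
    cumulant expansion, the other from the integrability of X. *)
Lemma cumulant_mean : kappa 1%N = \int[P]_t X t.
Proof.
have [C [C0 HC]] := cumulant_expansion0.
pose B : R := `|kappa 2%N / 2| + `|c| + C.
pose B1 : R := `|kappa 1%N| + B.
have B0 : 0 <= B by rewrite !addr_ge0.
have B10 : 0 <= B1 by rewrite addr_ge0.
suff h : complex.Im (phi (u_ n)) / u_ n @[n --> \oo] --> kappa 1%N.
  exact: (cvg_unique (@Rhausdorff R) h (Im_char_fun_first_order mX iX2)).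
apply: (@harmonic_rate_cvg _ _ _ (B + 5 * B1 ^+ 2 * expR B1)).
move/near_harmonic : HC; apply: filterS => n [r rC ->].
rewrite -/(u_ n) in rC *; move: (u_ n) (un0 n) (un1 n) rC => u u0 u1.
rewrite (ger0_norm (ltW u0)) => rC.
set W := (- (kappa 2%N / 2 * u ^+ 2))%:C + c%:C * (0 +i* u) ^+ k + r.
rewrite (_ : _ + r = (0 +i* (kappa 1%N * u)) + W); last by rewrite /W !addrA.
have u01 : 0 <= u <= 1 by rewrite (ltW u0) u1.
have WB : normc W <= B * u ^+ 2.
  rewrite !mulrDl; apply: (le_trans (le_normcD _ _)); apply: lerD.
    apply: (le_trans (le_normcD _ _)); apply: lerD.
      by rewrite normc_real normrN normrM (ger0_norm (sqr_ge0 _)).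
    rewrite normcM normc_real normc_iX ler_wpM2l// (ger0_norm (ltW u0)).
    by apply: pow_le => //; exact: ltnW.
  apply: (le_trans rC); rewrite ler_wpM2l// pow_le//.
  by do 2 apply: ltnW.
pose Z : R[i] := (0 +i* (kappa 1%N * u)) + W; rewrite -/Z.
have ZB : normc Z <= B1 * u.
  rewrite mulrDl; apply: (le_trans (le_normcD _ _)); apply: lerD.
    by rewrite /= expr0n add0r sqrtr_sqr normrM (ger0_norm (ltW u0)).
  apply: (le_trans WB); rewrite ler_wpM2l//.
  by have := @pow_le u 1 2 u01 isT; rewrite expr1.
have ZB1 : normc Z <= B1 by apply: (le_trans ZB); rewrite ler_piMr.
have EB : normc (cexp Z - 1 - Z) <= 5 * B1 ^+ 2 * expR B1 * u ^+ 2.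
  apply: (le_trans (cexp_sub1D_bound ZB ZB1)).
  by rewrite le_eqVlt; apply/orP; left; apply/eqP; ring.
have -> : complex.Im (cexp Z) / u - kappa 1%N =
    (complex.Im (cexp Z) - kappa 1%N * u) / u.
  by rewrite mulrBl mulfK// gt_eqF.
rewrite normrM normfV (gtr0_norm u0) ler_pdivrMr//.
have -> : complex.Im (cexp Z) - kappa 1%N * u =
    complex.Im (cexp Z - 1 - Z) + complex.Im W.
  have key (E V : R[i]) a : complex.Im E - a =
      complex.Im (E - 1 - ((0 +i* a) + V)) + complex.Im V.
    by case: E V => a1 b1 [a2 b2] /=; ring.
  exact: key.
rewrite -[leRHS]mulrA -expr2 mulrDl [leRHS]addrC.
apply: (le_trans (ler_normD _ _)); apply: lerD.
  exact: le_trans (normc_ge_Im _) EB.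
exact: le_trans (normc_ge_Im _) WB.
Qed.

Lemma cumulant_variance : \int[P]_t X t = 0 ->
  kappa 2%N = \int[P]_t (X t ^+ 2).
Proof.
rewrite -cumulant_mean => k10.
have [C [C0 HC]] := cumulant_expansion0.
pose B : R := `|c| + C.
pose B1 : R := `|kappa 2%N / 2| + B.
have B0 : 0 <= B by rewrite !addr_ge0.
have B10 : 0 <= B1 by rewrite addr_ge0.
suff h : (1 - complex.Re (phi (u_ n))) / u_ n ^+ 2 @[n --> \oo] --> kappa 2%N / 2.
  apply: (@mulIf _ (2^-1)); first by rewrite invr_eq0.
  exact: (cvg_unique (@Rhausdorff R) h (Re_char_fun_second_order mX iX2)).
apply: (@harmonic_rate_cvg _ _ _ (B + 5 * B1 ^+ 2 * expR B1)).
move/near_harmonic : HC; apply: filterS => n [r rC ->].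
rewrite -/(u_ n) in rC *; rewrite k10 mul0r add0r.
move: (u_ n) (un0 n) (un1 n) rC => u u0 u1.
rewrite (ger0_norm (ltW u0)) => rC.
set W := c%:C * (0 +i* u) ^+ k + r.
rewrite -addrA -/W.
have u01 : 0 <= u <= 1 by rewrite (ltW u0) u1.
have WB : normc W <= B * u ^+ 3.
  rewrite !mulrDl; apply: (le_trans (le_normcD _ _)); apply: lerD.
    by rewrite normcM normc_real normc_iX ler_wpM2l// (ger0_norm (ltW u0)) pow_le.
  by apply: (le_trans rC); rewrite ler_wpM2l// pow_le// ltnW.
pose Z : R[i] := (- (kappa 2%N / 2 * u ^+ 2))%:C + W; rewrite -/Z.
have ZB : normc Z <= B1 * u ^+ 2.
  rewrite mulrDl; apply: (le_trans (le_normcD _ _)); apply: lerD.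
    by rewrite normc_real normrN normrM (ger0_norm (sqr_ge0 _)).
  by apply: (le_trans WB); rewrite ler_wpM2l// pow_le.
have ZB1 : normc Z <= B1.
  by apply: (le_trans ZB); rewrite ler_piMr// exprn_ile1// ltW.
have EB : normc (cexp Z - 1 - Z) <= 5 * B1 ^+ 2 * expR B1 * u ^+ 3.
  apply: (@le_trans _ _ (5 * B1 ^+ 2 * expR B1 * u ^+ 4)); last first.
    by rewrite ler_wpM2l ?pow_le// !mulr_ge0 ?sqr_ge0 ?expR_ge0.
  apply: (le_trans (cexp_sub1D_bound ZB ZB1)).
  by rewrite le_eqVlt; apply/orP; left; apply/eqP; ring.
have u20 : 0 < u ^+ 2 by rewrite exprn_gt0.
have -> : (1 - complex.Re (cexp Z)) / u ^+ 2 - kappa 2%N / 2 =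
    (1 - complex.Re (cexp Z) - kappa 2%N / 2 * u ^+ 2) / u ^+ 2.
  by rewrite [RHS]mulrBl mulfK// gt_eqF.
rewrite normrM normfV (gtr0_norm u20) ler_pdivrMr//.
have -> : 1 - complex.Re (cexp Z) - kappa 2%N / 2 * u ^+ 2 =
    - (complex.Re (cexp Z - 1 - Z) + complex.Re W).
  have key (E V : R[i]) a : 1 - complex.Re E - a =
      - (complex.Re (E - 1 - ((- a)%:C + V)) + complex.Re V).
    by case: E V => a1 b1 [a2 b2] /=; ring.
  exact: key.
rewrite normrN -[leRHS]mulrA -exprS mulrDl [leRHS]addrC.
apply: (le_trans (ler_normD _ _)); apply: lerD.
  exact: le_trans (normc_ge_Re _) EB.
exact: le_trans (normc_ge_Re _) WB.
Qed.

(** The mean and variance are substituted for the first two cumulants, and the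
    eventual statement is turned into one on an explicit neighbourhood. *)
Lemma cumulant_expansion (sigma2 : R) : \int[P]_t X t = 0 ->
  \int[P]_t (X t ^+ 2) = sigma2 ->
  exists C delta : R, [/\ 0 <= C, 0 < delta & forall u : R, `|u| <= delta ->
  exists2 r : R[i], normc r <= C * `|u| ^+ k.+1 &
  phi u = cexp ((- (sigma2 * u ^+ 2 / 2))%:C + (c%:C * (0 +i* u) ^+ k + r))].
Proof.
move=> EX0 EX2.
have [C [C0 HC]] := cumulant_expansion0.
have k1 : kappa 1%N = 0 by rewrite cumulant_mean.
have k2 : kappa 2%N = sigma2 by rewrite cumulant_variance.
move: HC => [e /= e0 He]; exists C, (e / 2); split => //; first by rewrite divr_gt0.
move=> u ue; have [|r rC phiE] := He u.
  by rewrite /= sub0r normrN (le_lt_trans ue)// ltr_pdivrMr// ltr_pMr// ltr1n.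
exists r => //; rewrite phiE; congr cexp.
by rewrite k1 k2 mul0r add0r [sigma2 / 2 * _]mulrAC addrA.
Qed.

End cumulants.

(** * Sums of independent variables *)

Section step_approximation.
Variable R : realType.

(** The sum counts the integers in [1, z], so it is the integer part of z.  It
    presents a function with values in [0, 1] as a uniform limit of finite sums of
    indicators of its superlevel sets. *)
Lemma count_steps (N : nat) (z : R) : 0 <= z <= N%:R ->
  \sum_(i < N) (if i.+1%:R <= z then 1 else 0) <= z <=
  \sum_(i < N) (if i.+1%:R <= z then 1 else 0) + 1.
Proof.
elim: N => [|N IH] /andP[z0 zN].
  rewrite big_ord0 z0 add0r (le_trans zN)//.
rewrite big_ord_recr/=; case: ifPn => [Nz|]; last first.
  rewrite -ltNge addr0 => zN1.
  have [zN'|Nz] := leP z N%:R; first by apply: IH; rewrite z0.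
  rewrite (eq_bigr (fun=> 1)); last first.
    by move=> i _; rewrite ifT// (le_trans _ (ltW Nz))// ler_nat.
  by rewrite sumr_const card_ord (ltW Nz)/= natr1 ltW.
rewrite (eq_bigr (fun=> 1)); last first.
  by move=> i _; rewrite ifT// (le_trans _ Nz)// ler_nat ltnW// ltnS.
by rewrite sumr_const card_ord natr1 Nz/= (le_trans zN)// lerDl.
Qed.

End step_approximation.

Section factorization.
Context d (T : measurableType d) (R : realType) (P : probability T R).
Variables (W Y : T -> R) (w M : R).
Hypothesis mW : measurable_fun setT W.
Hypothesis WM : forall t, `|W t| <= M.
Hypothesis mY : measurable_fun setT Y.
Hypothesis WY : forall A : set R, measurable A ->
  \int[P]_t (W t * \1_(Y @^-1` A) t) = w * fine (P (Y @^-1` A)).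

Let good (h : R -> R) := [/\ measurable_fun setT h,
  exists K : R, forall x, `|h x| <= K &
  \int[P]_t (W t * h (Y t)) = w * \int[P]_t h (Y t)].

Let M0 : 0 <= M := le_trans (normr_ge0 _) (WM point).

Let good_integrable h : good h ->
  P.-integrable setT (EFin \o (fun t => h (Y t))) /\
  P.-integrable setT (EFin \o (fun t => W t * h (Y t))).
Proof.
move=> [mh [K hK] _]; split.
  by apply: (@bounded_integrable _ _ _ P _ K) => //; exact: measurableT_comp.
apply: (@bounded_integrable _ _ _ P _ (M * K)) => [|t].
  by apply: measurable_funM => //; exact: measurableT_comp.
by rewrite normrM ler_pM.
Qed.

Let good_add h1 h2 : good h1 -> good h2 -> good (fun x => h1 x + h2 x).
Proof.
move=> g1 g2; have [i1 j1] := good_integrable g1; have [i2 j2] := good_integrable g2.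
have [m1 [K1 b1] e1] := g1; have [m2 [K2 b2] e2] := g2; split.
- exact: measurable_funD.
- by exists (K1 + K2) => x; rewrite (le_trans (ler_normD _ _))// lerD.
- under eq_Rintegral do rewrite mulrDr.
  by rewrite [LHS]RintegralD// e1 e2 [in RHS]RintegralD// mulrDr.
Qed.

Let good_scale c h : good h -> good (fun x => c * h x).
Proof.
move=> g; have [i j] := good_integrable g.
have [m [K b] e] := g; split.
- exact: measurable_funM.
- by exists (`|c| * K) => x; rewrite normrM ler_wpM2l.
- under eq_Rintegral do rewrite mulrCA.
  by rewrite [LHS]RintegralZl// e [in RHS]RintegralZl// mulrCA.
Qed.

Let good_indic (A : set R) : measurable A -> good (\1_A).
Proof.
move=> mA; split.
- exact: measurable_indic.
- by exists 1 => x; rewrite indicE normr_nat; case: (_ \in _).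
- rewrite /= (WY mA); congr (_ * _).
  by rewrite /Rintegral integral_indic ?setIT//= -[X in measurable X]setTI; exact: mY.
Qed.

Let good_sum N (h : 'I_N -> R -> R) : (forall i, good (h i)) ->
  good (fun x => \sum_(i < N) h i x).
Proof.
move=> gh; have -> : (fun x => \sum_(i < N) h i x) =
    (\sum_(i < N) h i)%R by apply/funext => x; rewrite fct_sumE.
elim/big_ind : _ => [|h1 h2|i _]; [|exact: good_add|exact: gh].
have := good_scale 0 (good_indic measurableT).
by congr good; apply/funext => x; rewrite mul0r.
Qed.

Let good_limit (f : R -> R) : measurable_fun setT f ->
  (forall e : R, 0 < e -> exists2 h, good h & forall x, `|f x - h x| <= e) -> good f.
Proof.
move=> mf app.
have [h0 gh0 fh0] := app 1 ltr01.
have fK : exists K : R, forall x, `|f x| <= K.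
  have [_ [K hK] _] := gh0; exists (1 + K) => x.
  by rewrite -(subrK (h0 x) (f x)) (le_trans (ler_normD _ _))// lerD.
split => //.
have [K HK] := fK.
have i1 : P.-integrable setT (EFin \o (fun t => f (Y t))).
  by apply: (@bounded_integrable _ _ _ P _ K) => //; exact: measurableT_comp.
have i2 : P.-integrable setT (EFin \o (fun t => W t * f (Y t))).
  apply: (@bounded_integrable _ _ _ P _ (M * K)) => [|t].
    by apply: measurable_funM => //; exact: measurableT_comp.
  by rewrite normrM ler_pM.
apply/eqP; rewrite -subr_eq0 -normr_le0; apply/ler_addgt0Pr => e e0.
rewrite add0r.
pose B := M + `|w| + 1.
have B0 : 0 < B by rewrite ltr_wpDl// addr_ge0.
have [h gh fh] := app (e / B) (divr_gt0 e0 B0).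
have [j1 j2] := good_integrable gh; have [_ _ eh] := gh.
have -> : \int[P]_t (W t * f (Y t)) - w * \int[P]_t f (Y t) =
  \int[P]_t (W t * f (Y t) - W t * h (Y t)) -
  w * \int[P]_t (f (Y t) - h (Y t)).
  by rewrite !RintegralB// eh; ring.
have b1 : `|\int[P]_t (W t * f (Y t) - W t * h (Y t))| <= M * (e / B).
  rewrite -[leRHS](Rintegral_prob_cst P); apply: dominated_Rintegral => [||t].
  - by apply: (@measurable_of_integrable _ _ _ P); exact: integrable_subR.
  - exact: finite_measure_integrable_cst.
  - by rewrite -mulrBr normrM ler_pM.
have b2 : `|\int[P]_t (f (Y t) - h (Y t))| <= e / B.
  rewrite -[leRHS](Rintegral_prob_cst P); apply: dominated_Rintegral => [||t].
  - by apply: (@measurable_of_integrable _ _ _ P); exact: integrable_subR.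
  - exact: finite_measure_integrable_cst.
  - exact: fh.
apply: (le_trans (ler_normB _ _)); rewrite normrM.
apply: (le_trans (lerD b1 (ler_wpM2l (normr_ge0 w) b2))).
rewrite -mulrDl mulrCA ler_piMr ?(ltW e0)// ler_pdivrMr// mul1r /B.
by rewrite lerDl.
Qed.

(** The factorization assumed for indicators of Y passes to linear combinations and
    to uniform limits, hence to all bounded measurable functions of Y. *)
Lemma factor_bounded (f : R -> R) (K : R) : measurable_fun setT f ->
  (forall x, `|f x| <= K) ->
  \int[P]_t (W t * f (Y t)) = w * \int[P]_t f (Y t).
Proof.
move=> mf fK.
pose K1 : R := `|K| + 1.
have K1f x : `|f x| <= K1.
  by rewrite (le_trans (fK x))// (le_trans (ler_norm K))// lerDl.
have K10 : 0 < K1 by rewrite ltr_wpDl.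
(* an affine change of f with values in [0, 1] *)
pose g x := (f x + K1) / (2 * K1).
have g01 x : 0 <= g x <= 1.
  have := K1f x; rewrite ler_norml => /andP[h1 h2].
  rewrite divr_ge0 ?mulr_ge0 ?(ltW K10)//=; last by lra.
  by rewrite ler_pdivrMr ?mulr_gt0//; lra.
have mg : measurable_fun setT g.
  by apply: measurable_funM => //; exact: measurable_funD.
suff gg : good g.
  have : good f.
    have := good_add (good_scale (2 * K1) gg)
      (good_scale (- K1) (good_indic measurableT)).
    congr good; apply/funext => x; rewrite indicE in_setT /g mulr1.
    by rewrite mulrC divfK ?addrK// mulf_neq0 ?lt0r_neq0.
  by case.
apply: good_limit => // e e0.
pose N := (Num.truncn e^-1).+1.
have N0 : 0 < N%:R :> R by rewrite ltr0n.
have eN : N%:R^-1 <= e.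
  rewrite -[leRHS]invrK lef_pV2 ?posrE ?invr_gt0//.
  by rewrite ltW// truncnS_gt.
pose h x := N%:R^-1 * \sum_(i < N) (\1_[set y | i.+1%:R <= N%:R * g y] x : R).
exists h.
  apply: good_scale; apply: good_sum => i; apply: good_indic.
  rewrite -[X in measurable X]setTI.
  apply: (@measurable_fun_le _ _ R setT (cst i.+1%:R) (fun y => N%:R * g y)) => //.
  exact: measurable_funM.
move=> x; apply: le_trans eN.
have /andP[gx0 gx1] := g01 x.
have := @count_steps R N (N%:R * g x).
rewrite mulr_ge0 ?(ltW N0)//= ler_piMr ?(ltW N0)// => /(_ isT).
rewrite /h; set S := \sum_(i < N) _; set S' := \sum_(i < N) _.
have -> : S' = S.
  apply: eq_bigr => i _; rewrite indicE.
  by case: ifPn => H; [rewrite mem_set|rewrite memNset//; apply/negP].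
move=> /andP[h1 h2].
have -> : g x - N%:R^-1 * S = N%:R^-1 * (N%:R * g x - S).
  by rewrite mulrBr mulKf// gt_eqF.
rewrite normrM gtr0_norm ?invr_gt0// ler_piMr ?invr_ge0 ?(ltW N0)//.
by rewrite ger0_norm ?subr_ge0// lerBlDl.
Qed.

End factorization.

Section independent_sum.
Context d (T : measurableType d) (R : realType) (P : probability T R).
Variables (X : {RV P >-> R}) (Xs : nat -> {RV P >-> R}).
Hypothesis Xs_indep : independent_RVs Xs.
Hypothesis Xs_law : forall j, same_law (Xs j) X.
Local Notation phi := (char_fun P X).

Lemma same_law_Rintegral (Y : {RV P >-> R}) (f : R -> R) (K : R) :
  same_law Y X -> measurable_fun setT f -> (forall x, `|f x| <= K) ->
  \int[P]_t f (Y t) = \int[P]_t f (X t).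
Proof.
move=> YX mf fK.
have dist (Z : {RV P >-> R}) :
    (\int[P]_t (f (Z t))%:E = \int[distribution P Z]_x (f x)%:E)%E.
  rewrite integral_distribution//; first exact/measurable_EFinP.
  apply: (@bounded_integrable _ _ _ P (f \o Z) K) => [|t]; last exact: fK.
  exact: measurableT_comp.
rewrite /Rintegral; congr fine; rewrite !dist; apply: eq_measure_integral.
by move=> A mA _; exact: YX.
Qed.

Let evt (J : seq nat) (A : nat -> set R) : set T :=
  \big[setI/setT]_(j <- J) (Xs j @^-1` A j).
Let prb (J : seq nat) (A : nat -> set R) : R :=
  \prod_(j <- J) fine (P (Xs j @^-1` A j)).
Let S (m : nat) (t : T) : R := \sum_(j < m) Xs j t.

Let measurable_pre j (A : set R) : measurable A -> measurable (Xs j @^-1` A).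
Proof. by move=> mA; rewrite -[X in measurable X]setTI; exact: measurable_funPT. Qed.

Let measurable_evt J A : (forall j, measurable (A j)) -> measurable (evt J A).
Proof.
by move=> mA; apply: bigsetI_measurable => j _; exact: measurable_pre.
Qed.

Let prob_evt J A : uniq J -> (forall j, measurable (A j)) ->
  fine (P (evt J A)) = prb J A.
Proof.
move=> uJ mA; rewrite /evt Xs_indep// /prb.
elim: J {uJ} => [|j J IH]; first by rewrite !big_nil.
rewrite !big_cons fineM ?IH//; first exact: fin_num_measure (measurable_pre _ (mA j)).
have -> : (\prod_(i <- J) P (Xs i @^-1` A i) =
    (\prod_(i <- J) fine (P (Xs i @^-1` A i)))%:E)%E.
  elim: J {IH} => [|i J IH]; first by rewrite !big_nil.
  rewrite !big_cons IH EFinM fineK//.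
  exact: fin_num_measure (measurable_pre _ (mA i)).
by [].
Qed.

Let measurable_S m : measurable_fun setT (S m).
Proof. by apply: measurable_sum => j; exact: measurable_funPT. Qed.

(** Adding one variable: the weight W collects the first m variables and the events,
    and the hypothesis on W for the events of X_m is an instance of the induction
    hypothesis with one more event. *)
Let step (m : nat) (J : seq nat) (A : nat -> set R) (g : R -> R) (K w u : R) :
  uniq J -> all (leq m.+1) J -> (forall j, measurable (A j)) ->
  measurable_fun setT g -> (forall x, `|g x| <= K) ->
  (forall (J' : seq nat) (A' : nat -> set R), uniq J' -> all (leq m) J' ->
    (forall j, measurable (A' j)) ->
    \int[P]_t (g (u * S m t) * \1_(evt J' A') t) = w * prb J' A') ->
  \int[P]_t (g (u * S m t) * \1_(evt J A) t * cos (u * Xs m t)) =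
    w * prb J A * complex.Re (phi u) /\
  \int[P]_t (g (u * S m t) * \1_(evt J A) t * sin (u * Xs m t)) =
    w * prb J A * complex.Im (phi u).
Proof.
move=> uJ mJ mA mg gK H.
have mJn : m \notin J.
  by apply/negP => /(allP mJ); rewrite ltnn.
pose W t := g (u * S m t) * \1_(evt J A) t.
have mW : measurable_fun setT W.
  apply: measurable_funM.
    by apply: measurableT_comp => //; exact: measurable_funM.
  by apply: measurable_indic; exact: measurable_evt.
have WK t : `|W t| <= K.
  rewrite normrM -[leRHS]mulr1 ler_pM// indicE normr_nat.
  by case: (_ \in _).
have WY (B : set R) : measurable B ->
    \int[P]_t (W t * \1_(Xs m @^-1` B) t) =
    (w * prb J A) * fine (P (Xs m @^-1` B)).
  (* the event B of X_m joins the events A of the other variables *)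
  move=> mB; pose A' j := if j == m then B else A j.
  have mA' j : measurable (A' j) by rewrite /A'; case: ifP.
  have A'J j : j \in J -> A' j = A j.
    by rewrite /A'; case: eqP => // ->; rewrite (negbTE mJn).
  have A'm : A' m = B by rewrite /A' eqxx.
  have := H (m :: J) A'; rewrite /= mJn uJ leqnn => /(_ isT).
  have -> : all (leq m) J by apply: sub_all mJ => j /ltnW.
  move=> /(_ isT mA'); rewrite /prb big_cons A'm.
  have -> : evt (m :: J) A' = Xs m @^-1` B `&` evt J A.
    rewrite /evt big_cons A'm; congr (_ `&` _).
    by apply: eq_big_seq => j /A'J ->.
  have -> : \prod_(j <- J) fine (P (Xs j @^-1` A' j)) = prb J A.
    by apply: eq_big_seq => j /A'J ->.
  move=> HH; rewrite -mulrA [prb J A * _]mulrC -HH.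
  apply: eq_Rintegral => t _.
  by rewrite /W indicI/= -!mulrA [\1_(evt J A) t * _]mulrC.
have mX : measurable_fun setT (Xs m) := measurable_funPT _.
have mcos : measurable_fun setT (fun x : R => cos (u * x)).
  apply: continuous_measurable_fun => x; apply: continuous_comp.
    exact: mulrl_continuous.
  exact: continuous_cos.
have msin : measurable_fun setT (fun x : R => sin (u * x)).
  apply: continuous_measurable_fun => x; apply: continuous_comp.
    exact: mulrl_continuous.
  exact: continuous_sin.
have mX' : measurable_fun setT X := measurable_funPT _.
split.
- rewrite (factor_bounded mW WK mX WY mcos (fun x => cos_max (u * x))).
  by rewrite (same_law_Rintegral (Xs_law m) mcos (fun x => cos_max (u * x))) Re_char_fun.
- rewrite (factor_bounded mW WK mX WY msin (fun x => sin_max (u * x))).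
  by rewrite (same_law_Rintegral (Xs_law m) msin (fun x => sin_max (u * x))) Im_char_fun.
Qed.

(** Independence is only given for events, so the induction on the number of summands
    has to carry along the indicator of an arbitrary intersection of events of the
    variables not yet in the sum. *)
Let joint (u : R) (m : nat) (J : seq nat) (A : nat -> set R) :
  uniq J -> all (leq m) J -> (forall j, measurable (A j)) ->
  \int[P]_t (cos (u * S m t) * \1_(evt J A) t) =
    complex.Re (phi u ^+ m) * prb J A /\
  \int[P]_t (sin (u * S m t) * \1_(evt J A) t) =
    complex.Im (phi u ^+ m) * prb J A.
Proof.
elim: m J A => [|m IH] J A uJ mJ mA.
  have S0 t : S 0 t = 0 by rewrite /S big_ord0.
  rewrite expr0; split; rewrite -prob_evt//.
    under eq_Rintegral do rewrite S0 mulr0 cos0 mul1r.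
    by rewrite mul1r /Rintegral integral_indic ?setIT//; exact: measurable_evt.
  under eq_Rintegral do rewrite S0 mulr0 sin0 mul0r.
  by rewrite mul0r /Rintegral integral0.
have mcos : measurable_fun setT (@cos R).
  by apply: continuous_measurable_fun; exact: continuous_cos.
have msin : measurable_fun setT (@sin R).
  by apply: continuous_measurable_fun; exact: continuous_sin.
have [cc cs] := step uJ mJ mA mcos (@cos_max R)
  (fun J' A' a b c => (IH J' A' a b c).1).
have [sc ss] := step uJ mJ mA msin (@sin_max R)
  (fun J' A' a b c => (IH J' A' a b c).2).
have SS t : S m.+1 t = S m t + Xs m t by rewrite /S big_ord_recr.
have mX : measurable_fun setT (Xs m) := measurable_funPT _.
have int (f g : R -> R) : measurable_fun setT f -> measurable_fun setT g ->
    (forall x, `|f x| <= 1) -> (forall x, `|g x| <= 1) ->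
    P.-integrable setT (EFin \o
      (fun t => f (u * S m t) * \1_(evt J A) t * g (u * Xs m t))).
  move=> mf mg f1 g1; apply: (@bounded_integrable _ _ _ P _ 1) => [|t].
    apply: measurable_funM; last first.
      by apply: measurableT_comp => //; exact: measurable_funM.
    apply: measurable_funM; last first.
      by apply: measurable_indic; exact: measurable_evt.
    by apply: measurableT_comp => //; exact: measurable_funM.
  rewrite !normrM -[leRHS]mulr1 ler_pM// -[leRHS]mulr1 ler_pM// indicE normr_nat.
  by case: (_ \in _).
have prodE (z w : R[i]) :
    complex.Re (z * w) = complex.Re w * complex.Re z - complex.Im w * complex.Im z
    /\ complex.Im (z * w) = complex.Im w * complex.Re z + complex.Re w * complex.Im z.
  by case: z w => a b [c e] /=; split; ring.
rewrite exprS (prodE _ _).1 (prodE _ _).2; split.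
- transitivity (\int[P]_t (cos (u * S m t) * \1_(evt J A) t * cos (u * Xs m t) -
      sin (u * S m t) * \1_(evt J A) t * sin (u * Xs m t))).
    by apply: eq_Rintegral => t _; rewrite SS mulrDr cosD; ring.
  rewrite RintegralB//; first by rewrite cc ss; ring.
    exact: (int cos cos mcos mcos (@cos_max R) (@cos_max R)).
  exact: (int sin sin msin msin (@sin_max R) (@sin_max R)).
- transitivity (\int[P]_t (sin (u * S m t) * \1_(evt J A) t * cos (u * Xs m t) +
      cos (u * S m t) * \1_(evt J A) t * sin (u * Xs m t))).
    by apply: eq_Rintegral => t _; rewrite SS mulrDr sinD; ring.
  rewrite RintegralD//; first by rewrite sc cs; ring.
    exact: (int sin cos msin mcos (@sin_max R) (@cos_max R)).
  exact: (int cos sin mcos msin (@cos_max R) (@sin_max R)).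
Qed.

Lemma char_fun_sum (u : R) (n : nat) :
  char_fun P (fun t => \sum_(j < n) Xs j t) u = phi u ^+ n.
Proof.
have [hc hs] := @joint u n [::] (fun=> setT) isT isT (fun=> measurableT).
have mS := measurable_S n.
apply/eqP; rewrite eq_complex Re_char_fun// Im_char_fun//.
have e1 t : \1_(evt [::] (fun=> setT)) t = 1 :> R.
  by rewrite /evt big_nil indicE in_setT.
have p1 : prb [::] (fun=> setT) = 1 by rewrite /prb big_nil.
move: hc hs; rewrite p1 !mulr1 => <- <-.
by apply/andP; split; apply/eqP; apply: eq_Rintegral => t _; rewrite e1 mulr1.
Qed.

Lemma char_fun_normalized_sum (u : R) (n : nat) :
  char_fun P (normalized_sum Xs n) u = phi (u / Num.sqrt n%:R) ^+ n.
Proof.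
rewrite -char_fun_sum /char_fun; congr cexpectation; apply/funext => t.
by rewrite /normalized_sum mulrA.
Qed.

Lemma measurable_normalized_sum (n : nat) :
  measurable_fun setT (normalized_sum Xs n).
Proof. by apply: measurable_funM => //; exact: measurable_S. Qed.

End independent_sum.

(** * Gaussian integrals *)

Section poly_growth.
Variable R : realType.
Implicit Types f g : R -> R.

Definition poly_growth f :=
  exists (A : R) (n : nat), 0 <= A /\ forall u, `|f u| <= A * (1 + `|u|) ^+ n.

Lemma poly_growth_bounded f (K : R) : (forall u, `|f u| <= K) -> poly_growth f.
Proof.
move=> fK; exists `|K|, 0%N; split => // u.
by rewrite expr0 mulr1 (le_trans (fK u))// ler_norm.
Qed.

Lemma poly_growth_id : poly_growth id.
Proof. by exists 1, 1%N; split => // u; rewrite mul1r expr1 lerDr. Qed.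

Lemma poly_growthD f g : poly_growth f -> poly_growth g ->
  poly_growth (fun u => f u + g u).
Proof.
move=> [A [n [A0 fA]]] [B [m [B0 gB]]].
exists (A + B), (n + m)%N; split; first exact: addr_ge0.
move=> u; rewrite (le_trans (ler_normD _ _))// mulrDl.
have u1 : 1 <= 1 + `|u| by rewrite lerDl.
apply: lerD.
  by rewrite (le_trans (fA u))// ler_wpM2l// ler_weXn2l// leq_addr.
by rewrite (le_trans (gB u))// ler_wpM2l// ler_weXn2l// leq_addl.
Qed.

Lemma poly_growthM f g : poly_growth f -> poly_growth g ->
  poly_growth (fun u => f u * g u).
Proof.
move=> [A [n [A0 fA]]] [B [m [B0 gB]]].
exists (A * B), (n + m)%N; split; first exact: mulr_ge0.
by move=> u; rewrite normrM exprD mulrACA ler_pM.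
Qed.

Lemma poly_growthN f : poly_growth f -> poly_growth (fun u => - f u).
Proof.
by move=> [A [n [A0 fA]]]; exists A, n; split => // u; rewrite normrN.
Qed.

End poly_growth.

Section gauss_weight.
Variable R : realType.
Implicit Types s u x : R.
Local Notation mu := (@lebesgue_measure R).

(** This is the Fourier transform of the Gaussian density of standard deviation s,
    and up to a constant the Gaussian density of standard deviation 1 / s. *)
Definition gauss_weight s u : R := expR (- (s ^+ 2 * u ^+ 2 / 2)).

Lemma gauss_weight_ge0 s u : 0 <= gauss_weight s u.
Proof. exact: expR_ge0. Qed.

Lemma gauss_weight_le1 s u : gauss_weight s u <= 1.
Proof.
by rewrite /gauss_weight expR_le1 oppr_le0 -exprMn divr_ge0 ?sqr_ge0.
Qed.

Lemma is_derive_gauss_weight s u :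
  is_derive u 1 (gauss_weight s) (- (s ^+ 2 * u * gauss_weight s u)).
Proof.
by rewrite /gauss_weight; apply: is_derive_eq; rewrite /GRing.scale/=; field.
Qed.

Lemma continuous_gauss_weight s : continuous (gauss_weight s).
Proof.
move=> u; apply/differentiable_continuous/derivable1_diffP.
by have [] := is_derive_gauss_weight s u.
Qed.

Lemma gauss_weightE s u : s != 0 -> gauss_weight s u = normal_fun 0 s^-1 u.
Proof.
by move=> s0; rewrite /gauss_weight /normal_fun; congr expR; field.
Qed.

Lemma integrable_gauss_weight s : 0 < s ->
  mu.-integrable setT (EFin \o gauss_weight s).
Proof.
move=> s0; have si0 : s^-1 != 0 by rewrite invr_eq0 gt_eqF.
have := integrable_scaleR (normal_peak s^-1)^-1
  (integrable_normal_pdf (0 : R) s^-1).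
congr (_.-integrable _ _); apply/funext => u /=; congr EFin.
by rewrite normal_pdfE// mulKf ?gauss_weightE ?gt_eqF ?normal_peak_gt0.
Qed.

Lemma Rintegral_gauss_weight s : 0 < s ->
  \int[mu]_u gauss_weight s u = Num.sqrt (2 * pi) / s.
Proof.
move=> s0; have si0 : s^-1 != 0 by rewrite invr_eq0 gt_eqF.
transitivity (\int[mu]_u ((normal_peak s^-1)^-1 * normal_pdf 0 s^-1 u)).
  apply: eq_Rintegral => u _.
  by rewrite normal_pdfE// mulKf ?gauss_weightE ?gt_eqF ?normal_peak_gt0.
rewrite RintegralZl//; last exact: (integrable_normal_pdf (0 : R) s^-1).
rewrite /Rintegral integral_normal_pdf mulr1 /normal_peak invrK.
rewrite (_ : _ *+ 2 = 2 * pi * s^-1 ^+ 2); last by ring.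
rewrite sqrtrM ?mulr_ge0 ?pi_ge0// sqrtr_sqr gtr0_norm ?invr_gt0//.
Qed.

(** Of the exponent s^2 u^2 / 2, three quarters absorb the polynomial factor and one
    quarter remains. *)
Lemma poly_gauss_bound (n : nat) s : 0 < s -> exists2 K : R, 0 <= K &
  forall u, (1 + `|u|) ^+ n * gauss_weight s u <= K * gauss_weight (s / 2) u.
Proof.
move=> s0.
(* s^2 / 2 = c + (s / 2)^2 / 2 *)
pose c := 3 / 8 * s ^+ 2.
have c0 : 0 < c by rewrite mulr_gt0 ?exprn_gt0// divr_gt0.
pose L := 2 ^+ n * (1 + n`!%:R / c ^+ n).
have L0 : 0 <= L.
  by rewrite mulr_ge0 ?exprn_ge0// addr_ge0// divr_ge0// exprn_ge0// ltW.
exists L => // u.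
have -> : gauss_weight s u = expR (- (c * u ^+ 2)) * gauss_weight (s / 2) u.
  by rewrite /gauss_weight -expRD /c; congr expR; field.
rewrite mulrA ler_wpM2r ?gauss_weight_ge0//.
rewrite expRN ler_pdivrMr ?expR_gt0//.
have h1 : (1 + `|u|) ^+ n <= 2 ^+ n * (1 + (u ^+ 2) ^+ n).
  apply: (@le_trans _ _ ((2 * Num.max 1 `|u|) ^+ n)).
    rewrite lerXn2r ?nnegrE ?addr_ge0 ?mulr_ge0 ?le_max ?ler01//.
    by rewrite mulr_natl mulr2n lerD ?le_max ?lexx ?orbT.
  rewrite exprMn ler_wpM2l ?exprn_ge0//.
  have [u1|u1] := leP `|u| 1.
    by rewrite expr1n lerDl exprn_ge0// sqr_ge0.
  apply: (@le_trans _ _ ((u ^+ 2) ^+ n)); last by rewrite lerDr.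
  rewrite lerXn2r ?nnegrE ?sqr_ge0//.
  by rewrite -[u ^+ 2]real_normK ?num_real// expr2 ler_peMl// ltW.
apply: (le_trans h1); rewrite /L -mulrA ler_wpM2l ?exprn_ge0//.
rewrite mulrDl mul1r lerD//.
  by rewrite -expR0 ler_expR mulr_ge0 ?sqr_ge0// ltW.
rewrite mulrAC ler_pdivlMr ?exprn_gt0// -exprMn mulrC.
by apply: pow_le_expR; rewrite mulr_ge0 ?sqr_ge0// ltW.
Qed.

Lemma poly_growth_gauss_bound (f : R -> R) s : 0 < s -> poly_growth f ->
  exists2 K : R, 0 <= K &
  forall u, `|f u * gauss_weight s u| <= K * gauss_weight (s / 2) u.
Proof.
move=> s0 [A [n [A0 fA]]]; have [K K0 HK] := poly_gauss_bound n s0.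
exists (A * K); first exact: mulr_ge0.
move=> u; rewrite normrM (ger0_norm (gauss_weight_ge0 s u)) -mulrA.
apply: (le_trans _ (ler_wpM2l A0 (HK u))).
by rewrite mulrA ler_wpM2r ?gauss_weight_ge0.
Qed.

Lemma integrable_poly_gauss (f : R -> R) s : 0 < s ->
  measurable_fun setT f -> poly_growth f ->
  mu.-integrable setT (EFin \o (fun u => f u * gauss_weight s u)).
Proof.
move=> s0 mf pf; have [K K0 HK] := poly_growth_gauss_bound s0 pf.
apply: (@dominated_integrable _ _ _ mu _ (fun u => K * gauss_weight (s / 2) u)) => //.
  apply: measurable_funM => //.
  by apply: continuous_measurable_fun; exact: continuous_gauss_weight.
apply: integrable_scaleR; apply: integrable_gauss_weight.
by rewrite divr_gt0.
Qed.

End gauss_weight.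

Section stein.
Variable R : realType.
Local Notation mu := (@lebesgue_measure R).

Lemma is_derive_continuous (f df : R -> R) :
  (forall u : R, is_derive u 1 f (df u)) -> continuous f.
Proof.
move=> fdf u; apply/differentiable_continuous/derivable1_diffP.
by have [] := fdf u.
Qed.

(** The integral over [-n, n] is F n - F (- n), of order 1 / n by the decay of F. *)
Lemma Rintegral_derivative0 (F dF : R -> R) (K : R) :
  (forall u : R, is_derive u 1 F (dF u)) -> continuous dF ->
  mu.-integrable setT (EFin \o dF) -> (forall u, `|u| * `|F u| <= K) ->
  \int[mu]_u dF u = 0.
Proof.
move=> FdF cdF idF FK.
have cF := is_derive_continuous FdF.
have mdF : measurable_fun setT dF by exact: continuous_measurable_fun.
pose I (n : nat) : set R := `[- n.+1%:R, n.+1%:R]%classic.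
have IE n u : (u \in I n) = (`|u| <= n.+1%:R).
  by apply/idP/idP; rewrite inE /I/= in_itv/= -ler_norml.
have ftc n : \int[mu]_u (dF \_ (I n)) u = F n.+1%:R - F (- n.+1%:R).
  rewrite -Rintegral_mkcond /Rintegral (@continuous_FTC2 _ _ F)//.
  - by rewrite gtrN// ltr0n.
  - by apply: continuous_subspaceT => u; exact: cdF.
  - split => [u _| |]; first by have [] := FdF u.
      by apply: cvg_at_right_filter; exact: cF.
    by apply: cvg_at_left_filter; exact: cF.
  - by move=> u _; rewrite derive1E; have [_ ->] := FdF u.
have h1 : \int[mu]_u (dF \_ (I n)) u @[n --> \oo] --> \int[mu]_u dF u.
  apply: (@dominated_cvg_Rintegral _ _ _ mu _ _ (fun u => `|dF u|)) => //.
  - move=> n; apply/(measurable_restrictT _ _).1 => //.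
      exact: measurable_itv.
    exact: measurable_funTS.
  - exact: integrable_norm.
  - by move=> n u; rewrite patchE; case: ifP => // _; rewrite normr0.
  - move=> u; apply: cvg_near_cst; near=> n.
    rewrite patchE IE ifT//.
    apply: (@le_trans _ _ n%:R); last by rewrite ler_nat.
    by near: n; exact: nbhs_infty_ger.
have h2 : \int[mu]_u (dF \_ (I n)) u @[n --> \oo] --> (0 : R).
  apply: (@harmonic_rate_cvg _ _ _ (2 * K)); apply: nearW => n.
  have n0 : 0 < n.+1%:R :> R by rewrite ltr0n.
  rewrite ftc subr0 -mulrA mulr_natl mulr2n.
  apply: (le_trans (ler_normB _ _)); apply: lerD; rewrite ler_pdivlMr// mulrC.
    by have := FK n.+1%:R; rewrite ger0_norm.
  by have := FK (- n.+1%:R); rewrite normrN ger0_norm.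
exact: (cvg_unique (@Rhausdorff R) h1 h2).
Unshelve. all: by end_near. Qed.

(** Gaussian integration by parts: the difference of the two sides is the integral of
    the derivative of f times the weight. *)
Lemma stein (f df : R -> R) (s : R) : 0 < s ->
  (forall u : R, is_derive u 1 f (df u)) -> continuous df ->
  poly_growth f -> poly_growth df ->
  \int[mu]_u (df u * gauss_weight s u) =
  s ^+ 2 * \int[mu]_u (u * f u * gauss_weight s u).
Proof.
move=> s0 fdf cdf pf pdf.
have cf := is_derive_continuous fdf.
have cw := @continuous_gauss_weight R s.
pose F u := f u * gauss_weight s u.
have i1 : mu.-integrable setT (EFin \o (fun u => df u * gauss_weight s u)).
  by apply: integrable_poly_gauss => //; exact: continuous_measurable_fun.
have i2 : mu.-integrable setT (EFin \o (fun u => u * f u * gauss_weight s u)).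
  apply: integrable_poly_gauss => //.
    by apply: measurable_funM => //; exact: continuous_measurable_fun.
  by apply: poly_growthM => //; exact: poly_growth_id.
have [K K0 HK] := poly_growth_gauss_bound s0 (poly_growthM (@poly_growth_id R) pf).
suff : \int[mu]_u (df u * gauss_weight s u - s ^+ 2 * (u * f u * gauss_weight s u)) = 0.
  rewrite RintegralB//; last exact: integrable_scaleR.
  by rewrite RintegralZl// => /eqP; rewrite subr_eq0 => /eqP.
apply: (@Rintegral_derivative0 F _ K).
- move=> u; have d1 := fdf u; have d2 := is_derive_gauss_weight s u.
  by apply: is_derive_eq; rewrite /GRing.scale/=; ring.
- move=> u; apply: cvgB; first by apply: cvgM; [exact: cdf|exact: cw].
  apply: cvgM; first exact: cvg_cst.
  by apply: cvgM; [apply: cvgM; [exact: cvg_id|exact: cf]|exact: cw].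
- by apply: integrable_subR => //; exact: integrable_scaleR.
- move=> u; rewrite -normrM mulrA; apply: (le_trans (HK u)).
  by rewrite ler_piMr// gauss_weight_le1.
Qed.

End stein.

Section gauss_fourier.
Variable R : realType.
Local Notation mu := (@lebesgue_measure R).
Variable s : R.
Hypothesis s0 : 0 < s.

Let phase (theta x u : R) : R := u * x + theta.

Let continuous_phase theta x : continuous (phase theta x).
Proof.
move=> u; apply: cvgD; last exact: cvg_cst.
by apply: cvgM; [exact: cvg_id|exact: cvg_cst].
Qed.

Let continuous_cosp theta x : continuous (fun u => cos (phase theta x u)).
Proof.
move=> u; apply: continuous_comp; [exact: continuous_phase|exact: continuous_cos].
Qed.

Let continuous_sinp theta x : continuous (fun u => sin (phase theta x u)).
Proof.
move=> u; apply: continuous_comp; [exact: continuous_phase|exact: continuous_sin].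
Qed.

Let E theta x : R := \int[mu]_u (cos (phase theta x u) * gauss_weight s u).

Let stein_sin theta x :
  x * E theta x = s ^+ 2 * \int[mu]_u (u * sin (phase theta x u) * gauss_weight s u).
Proof.
transitivity (\int[mu]_u (x * cos (phase theta x u) * gauss_weight s u)).
  rewrite -RintegralZl//.
    by apply: eq_Rintegral => u _; rewrite mulrA.
  apply: integrable_poly_gauss => //; first exact: continuous_measurable_fun.
  exact: (poly_growth_bounded (fun u => cos_max _)).
apply: stein => //.
- move=> u; rewrite /phase.
  by apply: is_derive_eq; rewrite /GRing.scale/=; ring.
- by move=> u; apply: cvgM; [exact: cvg_cst|exact: continuous_cosp].
- exact: (poly_growth_bounded (fun u => sin_max _)).
- apply: poly_growthM; first exact: (@poly_growth_bounded _ (fun=> x) `|x|).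
  exact: (poly_growth_bounded (fun u => cos_max _)).
Qed.

(** Differentiating under the integral sign and integrating by parts shows that the
    cosine transform E of the Gaussian weight solves a linear differential equation,
    solved by a Gaussian. *)
Let is_derive_E theta (x : R) : is_derive x 1 (E theta) (- (x / s ^+ 2 * E theta x)).
Proof.
pose f (y u : R) : R := cos (phase theta y u) * gauss_weight s u.
pose G (u : R) : R := `|u| * gauss_weight s u.
have df (y u : R) : is_derive y 1 (f ^~ u) (- (u * sin (phase theta y u) * gauss_weight s u)).
  by rewrite /f /phase; apply: is_derive_eq; rewrite /GRing.scale/=; ring.
have Ix : `]x - 1, x + 1[%classic x.
  by rewrite /= in_itv/= ltrBlDr ltrDl ltr01.
have intf (y : R) : `]x - 1, x + 1[%classic y -> mu.-integrable setT (EFin \o f y).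
  move=> _; apply: integrable_poly_gauss => //.
    by apply: continuous_measurable_fun; exact: continuous_cosp.
  exact: (poly_growth_bounded (fun u => cos_max _)).
have derf (y u : R) : `]x - 1, x + 1[%classic y -> setT u -> derivable (f ^~ u) y 1.
  by move=> _ _; have [] := df y u.
have G0 u : 0 <= G u by rewrite mulr_ge0// gauss_weight_ge0.
have iG : mu.-integrable setT (EFin \o G).
  apply: integrable_poly_gauss => //.
  by have [A [n [A0 H]]] := @poly_growth_id R; exists A, n; split => // u; rewrite normr_id.
have d1E (y u : R) : partial1of2 f y u = - (u * sin (phase theta y u) * gauss_weight s u).
  by rewrite partial1of2E; have [_ ->] := df y u.
have G_ub (y u : R) : `]x - 1, x + 1[%classic y -> setT u -> `|partial1of2 f y u| <= G u.
  move=> _ _; rewrite d1E normrN !normrM (ger0_norm (gauss_weight_ge0 _ _)).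
  by rewrite ler_wpM2r ?gauss_weight_ge0// ler_piMr// sin_max.
have dE := derivable_under_integral measurableT Ix intf derf G0 iG G_ub.
have vE := differentiation_under_integral measurableT Ix intf derf G0 iG G_ub.
split; first exact: dE.
rewrite -derive1E; apply: etrans; first exact: vE.
under eq_Rintegral do rewrite d1E -mulN1r.
rewrite RintegralZl//; last first.
  apply: integrable_poly_gauss => //.
    by apply: measurable_funM => //; apply: continuous_measurable_fun; exact: continuous_sinp.
  apply: poly_growthM; first exact: poly_growth_id.
  exact: (poly_growth_bounded (fun u => sin_max _)).
have := stein_sin theta x; move: (\int[_]_ _ _) => I H.
rewrite mulrAC [x * _]H; field.
by rewrite gt_eqF.
Qed.

Lemma gauss_fourier (theta x : R) :
  \int[mu]_u (cos (u * x + theta) * gauss_weight s u) =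
  cos theta * (Num.sqrt (2 * pi) / s) * expR (- (x ^+ 2 / (2 * s ^+ 2))).
Proof.
(* constant by the differential equation for E *)
pose H y := E theta y * expR (y ^+ 2 / (2 * s ^+ 2)).
have dH (y : R) : is_derive y 1 H 0.
  rewrite /H; have := is_derive_E theta y => dE.
  apply: is_derive_eq; rewrite /GRing.scale/=; field.
  by rewrite gt_eqF.
have : `|H x - H 0| <= 0 * `|x - 0|.
  by apply: (@MVT_bound _ H (fun=> 0)) => // z _; rewrite normr0.
rewrite mul0r normr_le0 subr_eq0 => /eqP.
rewrite /H expr0n mul0r expR0 mulr1 => HE.
rewrite -[LHS]/(E theta x) expRN -[LHS](mulfK (lt0r_neq0 (expR_gt0 (x ^+ 2 / (2 * s ^+ 2))))).
rewrite HE; congr (_ / _); rewrite /E /phase.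
under eq_Rintegral do rewrite mulr0 add0r.
rewrite RintegralZl// ?Rintegral_gauss_weight//.
exact: integrable_gauss_weight.
Qed.

End gauss_fourier.

(** * Hermite polynomials as Gaussian Fourier transforms *)

Section normal_expectation.
Variables (R : realType) (m sigma : R).
Local Notation mu := (@lebesgue_measure R).
Local Notation N := (@normal_prob R m sigma).

(** The density of the normal law is its Radon-Nikodym derivative, which agrees almost
    everywhere with the explicit formula. *)
Lemma ge0_integral_normal_prob (f : R -> R) :
  measurable_fun setT f -> (forall x, 0 <= f x) ->
  (\int[N]_x (f x)%:E = \int[mu]_x (f x * normal_pdf m sigma x)%:E)%E.
Proof.
move=> mf f0.
have dom := @normal_prob_dominates R m sigma.
rewrite -(Radon_Nikodym_SigmaFinite.change_of_variables dom)//; last first.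
  exact/measurable_EFinP.
apply: ae_eq_integral => //.
- apply: emeasurable_funM; first exact/measurable_EFinP.
  apply: (measurable_int mu); exact: Radon_Nikodym_SigmaFinite.f_integrable.
- apply/measurable_EFinP; apply: measurable_funM => //.
  exact: measurable_normal_pdf.
under [X in ae_eq _ _ _ X]eq_fun do rewrite EFinM.
apply: ae_eqe_mul2l => /=.
apply: integral_ae_eq => //=.
- exact: Radon_Nikodym_SigmaFinite.f_integrable.
- by apply/measurable_EFinP; exact: measurable_normal_pdf.
- by move=> E _ mE; rewrite -Radon_Nikodym_SigmaFinite.f_integral.
Qed.

Lemma Rintegral_normal_prob (f : R -> R) : measurable_fun setT f ->
  mu.-integrable setT (EFin \o (fun x => f x * normal_pdf m sigma x)) ->
  \int[N]_x f x = \int[mu]_x (f x * normal_pdf m sigma x).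
Proof.
move=> mf jf.
(* positive and negative parts *)
pose fp x := (`|f x| + f x) / 2; pose fn x := (`|f x| - f x) / 2.
have fE x : f x = fp x - fn x by rewrite /fp /fn; field.
have fp0 x : 0 <= fp x.
  by rewrite divr_ge0// -lerBlDr sub0r -normrN ler_norm.
have fn0 x : 0 <= fn x by rewrite divr_ge0// subr_ge0 ler_norm.
have maf : measurable_fun setT (fun x => `|f x|) by exact: measurableT_comp.
have mfp : measurable_fun setT fp.
  by apply: measurable_funM => //; exact: measurable_funD.
have mfn : measurable_fun setT fn.
  by apply: measurable_funM => //; exact: measurable_funB.
have ib (g : R -> R) : measurable_fun setT g -> (forall x, 0 <= g x <= `|f x|) ->
    mu.-integrable setT (EFin \o (fun x => g x * normal_pdf m sigma x)).
  move=> mg gf.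
  apply: (@dominated_integrable _ _ _ mu _ (fun x => `|f x * normal_pdf m sigma x|)).
  - by apply: measurable_funM => //; exact: measurable_normal_pdf.
  - exact: integrable_norm.
  - move=> x; have /andP[g0 gx] := gf x; rewrite !normrM ler_wpM2r//.
    by rewrite ger0_norm.
have ip : mu.-integrable setT (EFin \o (fun x => fp x * normal_pdf m sigma x)).
  apply: ib => // x; rewrite fp0/= /fp.
  by have := ler_norm (f x); lra.
have iN : mu.-integrable setT (EFin \o (fun x => fn x * normal_pdf m sigma x)).
  apply: ib => // x; rewrite fn0/= /fn.
  by have := ler_norm (- f x); rewrite normrN; lra.
have intN (g : R -> R) : measurable_fun setT g -> (forall x, 0 <= g x) ->
    mu.-integrable setT (EFin \o (fun x => g x * normal_pdf m sigma x)) ->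
    N.-integrable setT (EFin \o g).
  move=> mg g0 ig; apply/integrableP; split; first exact/measurable_EFinP.
  under eq_integral do rewrite /= ger0_norm//.
  rewrite ge0_integral_normal_prob// -ge0_fin_numE.
    exact: integrable_fin_num.
  by apply: integral_ge0 => x _; rewrite lee_fin mulr_ge0// normal_pdf_ge0.
transitivity (\int[N]_x (fp x - fn x)).
  by apply: eq_Rintegral => x _; exact: fE.
rewrite RintegralB//; [|exact: intN|exact: intN].
transitivity (\int[mu]_x (fp x * normal_pdf m sigma x - fn x * normal_pdf m sigma x)).
  rewrite RintegralB//; congr (_ - _); rewrite /Rintegral; congr fine;
  exact: ge0_integral_normal_prob.
by apply: eq_Rintegral => x _; rewrite -mulrBl -fE.
Qed.

End normal_expectation.

Section hermite_fourier.
Variable R : realType.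
Local Notation mu := (@lebesgue_measure R).

(** For k = 0 the factor k kills the term with the predecessor, so only the value at 0
    has to be compared. *)
Lemma hermite_recurrence_unique (alpha beta : R) (A B : nat -> R) :
  A 0%N = B 0%N ->
  (forall k, A k.+1 = alpha * A k - beta * (k%:R * A k.-1)) ->
  (forall k, B k.+1 = alpha * B k - beta * (k%:R * B k.-1)) ->
  forall k, A k = B k.
Proof.
move=> AB0 AS BS k.
suff : A k = B k /\ A k.-1 = B k.-1 by case.
elim: k => [|k [IH1 IH2]]//=; split => //.
by rewrite AS BS IH1 IH2.
Qed.

Section hermite_moments.
Variable x : R.
Let a k (z : R) : R := complex.Re ((x +i* z) ^+ k)%C.
Let b k (z : R) : R := complex.Im ((x +i* z) ^+ k)%C.

Let a0 z : a 0 z = 1. Proof. by []. Qed.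
Let b0 z : b 0 z = 0. Proof. by []. Qed.
Let aS k : a k.+1 = fun z => x * a k z - z * b k z.
Proof.
by apply/funext => z; rewrite /a /b exprS; case: (_ ^+ k) => c e /=.
Qed.
Let bS k : b k.+1 = fun z => x * b k z + z * a k z.
Proof.
by apply/funext => z; rewrite /a /b exprS; case: (_ ^+ k) => c e /=.
Qed.

(** Cauchy-Riemann: the derivative of (x + i z)^k in z is i k (x + i z)^(k-1). *)
Let ab_derive k (z : R) :
  is_derive z 1 (a k) (- (k%:R * b k.-1 z)) /\ is_derive z 1 (b k) (k%:R * a k.-1 z).
Proof.
elim: k z => [|k IH] z.
  by rewrite !mul0r oppr0; split; exact: is_derive_cst.
have [da db] := IH z.
have bE : k%:R * b k z = k%:R * (x * b k.-1 z + z * a k.-1 z).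
  by case: k {IH da db} => [|k]; [rewrite !mul0r|rewrite {1}bS].
have aE : k%:R * a k z = k%:R * (x * a k.-1 z - z * b k.-1 z).
  by case: k {IH da db bE} => [|k]; [rewrite !mul0r|rewrite {1}aS].
rewrite aS bS /= -natr1 !mulrDl !mul1r bE aE; split.
  by apply: is_derive_eq; rewrite /GRing.scale/=; ring.
by apply: is_derive_eq; rewrite /GRing.scale/=; ring.
Qed.

Let ab_growth k : poly_growth (a k) /\ poly_growth (b k).
Proof.
elim: k => [|k [pa pb]].
  split; first by apply: (@poly_growth_bounded _ _ 1) => z; rewrite a0 normr1.
  by apply: (@poly_growth_bounded _ _ 0) => z; rewrite b0 normr0.
have px : poly_growth (fun _ : R => x) by exact: (@poly_growth_bounded _ _ `|x|).
have pi := @poly_growth_id R.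
rewrite aS bS; split; apply: poly_growthD.
- exact: poly_growthM.
- by apply: poly_growthN; exact: poly_growthM.
- exact: poly_growthM.
- exact: poly_growthM.
Qed.

Let continuous_a k : continuous (a k).
Proof. by apply: is_derive_continuous => z; exact: (ab_derive k z).1. Qed.
Let continuous_b k : continuous (b k).
Proof. by apply: is_derive_continuous => z; exact: (ab_derive k z).2. Qed.

Let h k := \int[mu]_z (a k z * gauss_weight 1 z).

Let ia k : mu.-integrable setT (EFin \o (fun z => a k z * gauss_weight 1 z)).
Proof.
apply: integrable_poly_gauss => //; last exact: (ab_growth k).1.
exact: continuous_measurable_fun.
Qed.

Let hS k : h k.+1 = x * h k - 1 * (k%:R * h k.-1).
Proof.
have i2 : mu.-integrable setT (EFin \o (fun z => z * b k z * gauss_weight 1 z)).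
  apply: integrable_poly_gauss => //.
    by apply: measurable_funM => //; exact: continuous_measurable_fun.
  apply: poly_growthM; [exact: poly_growth_id|exact: (ab_growth k).2].
have st : \int[mu]_z (k%:R * a k.-1 z * gauss_weight 1 z) =
    1 ^+ 2 * \int[mu]_z (z * b k z * gauss_weight 1 z).
  apply: stein => //.
  - by move=> z; exact: (ab_derive k z).2.
  - by move=> z; apply: cvgM; [exact: cvg_cst|exact: continuous_a].
  - exact: (ab_growth k).2.
  - apply: poly_growthM; last exact: (ab_growth _).1.
    exact: (@poly_growth_bounded _ _ `|k%:R|).
transitivity (\int[mu]_z (x * (a k z * gauss_weight 1 z) - z * b k z * gauss_weight 1 z)).
  by apply: eq_Rintegral => z _; rewrite aS; ring.
rewrite RintegralB//; last exact: integrable_scaleR.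
rewrite RintegralZl//; congr (_ - _).
rewrite expr1n mul1r in st; rewrite -st mul1r -RintegralZl//.
by apply: eq_Rintegral => z _; rewrite mulrA.
Qed.

Let hermiteE k : hermite k x = (Num.sqrt (2 * pi))^-1 * h k.
Proof.
rewrite /hermite /= unlock -[LHS]/(\int[normal_prob 0 1]_z a k z).
have pdfE z : a k z * normal_pdf 0 1 z = (Num.sqrt (2 * pi))^-1 * (a k z * gauss_weight 1 z).
  rewrite normal_pdfE ?oner_neq0// /normal_peak gauss_weightE ?oner_neq0// invr1.
  by rewrite expr1n mul1r -mulr_natl mulrCA.
have mak : measurable_fun setT (a k) by exact: continuous_measurable_fun.
have iak := integrable_scaleR (Num.sqrt (2 * pi))^-1 (ia k).
rewrite Rintegral_normal_prob//; last first.
  by move: iak; congr (_.-integrable _ _); apply/funext => z /=; rewrite -pdfE.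
under eq_Rintegral do rewrite pdfE.
by rewrite RintegralZl.
Qed.

Lemma hermite0 : hermite 0 x = 1.
Proof.
rewrite hermiteE /h; under eq_Rintegral do rewrite a0 mul1r.
rewrite Rintegral_gauss_weight// divr1 mulVf// gt_eqF// sqrtr_gt0.
by rewrite mulr_gt0// pi_gt0.
Qed.

(** Write (x + i Z)^(k+1) = (x + i Z)^k (x + i Z); integration by parts turns the factor
    Z into a derivative, which is i k (x + i Z)^(k-1). *)
Lemma hermiteS k : hermite k.+1 x = x * hermite k x - k%:R * hermite k.-1 x.
Proof. by rewrite !hermiteE hS; ring. Qed.

End hermite_moments.

Section fourier_moments.
Variables (s x : R).
Hypothesis s0 : 0 < s.
Let p k (u : R) : R[i] := ((0 +i* u) ^+ k * cexp (0 +i* (- (u * x))))%C.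
Let r k u : R := complex.Re (p k u).
Let q k u : R := complex.Im (p k u).

Let pE k u : p k.+1 u = ((0 +i* u) * (r k u +i* q k u))%C.
Proof. by rewrite /r /q /p exprS -mulrA; case: (_ ^+ k * _). Qed.
Let r0 u : r 0 u = cos (u * x).
Proof. by rewrite /r /p expr0 mul1r /= expR0 cosN mul1r. Qed.
Let q0 u : q 0 u = - sin (u * x).
Proof. by rewrite /q /p expr0 mul1r /= expR0 sinN mul1r. Qed.
Let rS k : r k.+1 = fun u => - (u * q k u).
Proof. by apply/funext => u; rewrite [LHS]/r pE /= mul0r sub0r. Qed.
Let qS k : q k.+1 = fun u => u * r k u.
Proof. by apply/funext => u; rewrite [LHS]/q pE /= mul0r add0r. Qed.

Let rq_derive k (u : R) :
  is_derive u 1 (r k) (x * q k u - k%:R * q k.-1 u) /\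
  is_derive u 1 (q k) (k%:R * r k.-1 u - x * r k u).
Proof.
elim: k u => [|k IH] u.
  have -> : r 0 = fun u => cos (u * x) by apply/funext.
  have -> : q 0 = fun u => - sin (u * x) by apply/funext.
  by split; apply: is_derive_eq; rewrite /GRing.scale/=; ring.
have [dr dq] := IH u.
have rE : k%:R * r k u = - (k%:R * (u * q k.-1 u)).
  by case: k {IH dr dq} => [|k]; [rewrite !mul0r oppr0|rewrite {1}rS mulrN].
have qE : k%:R * q k u = k%:R * (u * r k.-1 u).
  by case: k {IH dr dq rE} => [|k]; [rewrite !mul0r|rewrite {1}qS].
rewrite rS qS /= -natr1 !mulrDl !mul1r rE qE; split.
  by apply: is_derive_eq; rewrite /GRing.scale/=; ring.
by apply: is_derive_eq; rewrite /GRing.scale/=; ring.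
Qed.

Let rq_growth k : poly_growth (r k) /\ poly_growth (q k).
Proof.
have pi := @poly_growth_id R.
elim: k => [|k [pr pq]]; last first.
  rewrite rS qS; split; last exact: poly_growthM.
  by apply: poly_growthN; exact: poly_growthM.
split; apply: (@poly_growth_bounded _ _ 1) => z; rewrite ?r0 ?q0 ?normrN.
  exact: cos_max.
exact: sin_max.
Qed.

Let continuous_r k : continuous (r k).
Proof. by apply: is_derive_continuous => z; exact: (rq_derive k z).1. Qed.
Let continuous_q k : continuous (q k).
Proof. by apply: is_derive_continuous => z; exact: (rq_derive k z).2. Qed.

Let I k := \int[mu]_u (r k u * gauss_weight s u).

Let ir k : mu.-integrable setT (EFin \o (fun z => r k z * gauss_weight s z)).
Proof.
apply: integrable_poly_gauss => //; last exact: (rq_growth k).1.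
exact: continuous_measurable_fun.
Qed.

(** The same integration by parts as for the Hermite polynomials, now against the
    oscillating factor e^(- i u x), whose derivative produces x. *)
Let IS k : I k.+1 = x / s ^+ 2 * I k - (s ^+ 2)^-1 * (k%:R * I k.-1).
Proof.
have st : \int[mu]_z ((k%:R * r k.-1 z - x * r k z) * gauss_weight s z) =
    s ^+ 2 * \int[mu]_z (z * q k z * gauss_weight s z).
  apply: stein => //.
  - by move=> z; exact: (rq_derive k z).2.
  - move=> z; apply: cvgB; (apply: cvgM; first exact: cvg_cst);
    exact: continuous_r.
  - exact: (rq_growth k).2.
  - apply: poly_growthD; last apply: poly_growthN.
      apply: poly_growthM; last exact: (rq_growth _).1.
      exact: (@poly_growth_bounded _ _ `|k%:R|).
    apply: poly_growthM; last exact: (rq_growth _).1.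
    exact: (@poly_growth_bounded _ _ `|x|).
have i2 : mu.-integrable setT (EFin \o (fun z => z * q k z * gauss_weight s z)).
  apply: integrable_poly_gauss => //.
    by apply: measurable_funM => //; exact: continuous_measurable_fun.
  apply: poly_growthM; [exact: poly_growth_id|exact: (rq_growth k).2].
have e1 : I k.+1 = -1 * \int[mu]_z (z * q k z * gauss_weight s z).
  rewrite -RintegralZl//; apply: eq_Rintegral => z _; rewrite rS; ring.
have e2 : \int[mu]_z ((k%:R * r k.-1 z - x * r k z) * gauss_weight s z) =
    k%:R * I k.-1 - x * I k.
  rewrite -!RintegralZl// -RintegralB//; [|exact: integrable_scaleR..].
  by apply: eq_Rintegral => z _; ring.
have sn : s != 0 by rewrite gt_eqF.
apply: (@mulfI _ (s ^+ 2)); first by rewrite expf_neq0.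
rewrite e1 mulN1r mulrN -st e2; field.
exact: sn.
Qed.

Lemma integrable_fourier_monomial_gauss k : mu.-integrable setT (EFin \o (fun u =>
  complex.Re ((0 +i* u) ^+ k * cexp (0 +i* (- (u * x))))%C * gauss_weight s u)).
Proof. exact: ir. Qed.

(** Both sides obey the recurrence of the Hermite polynomials rescaled by s. *)
Lemma fourier_monomial_gauss k :
  \int[mu]_u (complex.Re ((0 +i* u) ^+ k * cexp (0 +i* (- (u * x))))%C *
    gauss_weight s u) =
  (Num.sqrt (2 * pi) / s) * expR (- (x ^+ 2 / (2 * s ^+ 2))) *
  (s ^+ k)^-1 * hermite k (x / s).
Proof.
have sn : s != 0 by rewrite gt_eqF.
rewrite -[LHS]/(I k).
pose B k := (Num.sqrt (2 * pi) / s) * expR (- (x ^+ 2 / (2 * s ^+ 2))) *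
  (s ^+ k)^-1 * hermite k (x / s).
rewrite -[RHS]/(B k); move: k.
apply: (@hermite_recurrence_unique (x / s ^+ 2) (s ^+ 2)^-1 I B _ IS).
  rewrite /B expr0 invr1 hermite0 !mulr1 /I.
  under eq_Rintegral do rewrite r0 -[_ * x]addr0.
  by rewrite gauss_fourier// cos0 mul1r.
move=> k; rewrite /B hermiteS.
case: k => [|k] /=.
  by rewrite expr0 expr1; field.
move: (Num.sqrt _) (expR _) (hermite k _) (hermite k.+1 _) => A0 A1 A2 A3.
rewrite !exprS; field.
by rewrite sn expf_neq0.
Qed.

End fourier_moments.
End hermite_fourier.

(** * Fourier inversion *)

Section continuity_dominated.
Context d (T : measurableType d) (R : realType) (mu : {measure set T -> \bar R}).

Lemma dominated_continuous (f : R -> T -> R) (g : T -> R) :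
  (forall x, measurable_fun setT (f x)) ->
  mu.-integrable setT (EFin \o g) -> (forall x t, `|f x t| <= g t) ->
  (forall t, continuous (f ^~ t)) ->
  continuous (fun x => \int[mu]_t f x t).
Proof.
move=> mf ig fg cf x.
have := @continuity_under_integral R _ T mu f setT measurableT (x - 1) (x + 1)
  _ _ g ig _ x.
apply => //.
- by move=> y _; exact: (dominated_integrable (mf y) ig (fg y)).
- by apply: aeW => t _ y _; exact: cf.
- by move=> y _; apply: aeW => t _; exact: fg.
- by rewrite inE/= in_itv/= ltrBlDr ltrDl ltr01.
Qed.

End continuity_dominated.

Section fourier_inversion_formula.
Variable R : realType.
Local Notation mu := (@lebesgue_measure R).
Local Open Scope complex_scope.
Implicit Types (g : R -> R[i]) (x u : R).

(** Taking the real part loses nothing when g u and g (- u) are conjugate, as they are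
    for characteristic functions. *)
Definition fourier_inv g x : R :=
  (2 * pi)^-1 * \int[mu]_u complex.Re (cexp (0 +i* (- (u * x))) * g u).

Definition cintegrable g : Prop :=
  [/\ measurable_fun setT (fun u => complex.Re (g u)),
      measurable_fun setT (fun u => complex.Im (g u)) &
      mu.-integrable setT (EFin \o (fun u => normc (g u)))].

Lemma Re_fourier_kernel g x u :
  complex.Re (cexp (0 +i* (- (u * x))) * g u) =
  cos (u * x) * complex.Re (g u) + sin (u * x) * complex.Im (g u).
Proof. by case: (g u) => a b /=; rewrite expR0 cosN sinN; ring. Qed.

Lemma fourier_kernel_le g x u :
  `|complex.Re (cexp (0 +i* (- (u * x))) * g u)| <= normc (g u).
Proof.
by apply: (le_trans (normc_ge_Re _)); rewrite normcM normc_cexp /= expR0 mul1r.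
Qed.

Let mcos (x : R) : measurable_fun setT (fun u : R => cos (u * x)).
Proof.
apply: continuous_measurable_fun => u; apply: continuous_comp.
  exact: mulrr_continuous.
exact: continuous_cos.
Qed.

Let msin (x : R) : measurable_fun setT (fun u : R => sin (u * x)).
Proof.
apply: continuous_measurable_fun => u; apply: continuous_comp.
  exact: mulrr_continuous.
exact: continuous_sin.
Qed.

Lemma measurable_fourier_kernel g x : cintegrable g ->
  measurable_fun setT (fun u => complex.Re (cexp (0 +i* (- (u * x))) * g u)).
Proof.
move=> [mr mi _]; under eq_fun do rewrite Re_fourier_kernel.
by apply: measurable_funD; apply: measurable_funM.
Qed.

Lemma integrable_fourier_kernel g x : cintegrable g ->
  mu.-integrable setT
    (EFin \o (fun u => complex.Re (cexp (0 +i* (- (u * x))) * g u))).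
Proof.
move=> ig; have [_ _ jg] := ig.
apply: (@dominated_integrable _ _ _ mu _ _ _ jg); last exact: fourier_kernel_le.
exact: measurable_fourier_kernel.
Qed.

Let pi20 : 0 < (2 * pi)^-1 :> R.
Proof. by rewrite invr_gt0 mulr_gt0// pi_gt0. Qed.

Lemma fourier_inv_le g x : cintegrable g ->
  `|fourier_inv g x| <= (2 * pi)^-1 * \int[mu]_u normc (g u).
Proof.
move=> ig; have [_ _ jg] := ig.
rewrite normrM (gtr0_norm pi20) ler_pM2l//.
apply: dominated_Rintegral => //; last exact: fourier_kernel_le.
exact: measurable_fourier_kernel.
Qed.

Lemma continuous_fourier_inv g : cintegrable g -> continuous (fourier_inv g).
Proof.
move=> ig; have [_ _ jg] := ig.
move=> x; apply: cvgM; first exact: cvg_cst.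
apply: (@dominated_continuous _ _ R mu
  (fun x u => complex.Re (cexp (0 +i* (- (u * x))) * g u)) _ _ jg).
- by move=> y; exact: measurable_fourier_kernel.
- by move=> y u; exact: fourier_kernel_le.
- move=> u y; under eq_fun do rewrite Re_fourier_kernel.
  apply: cvgD; apply: cvgM; try exact: cvg_cst.
    by apply: continuous_comp; [exact: mulrl_continuous|exact: continuous_cos].
  by apply: continuous_comp; [exact: mulrl_continuous|exact: continuous_sin].
Qed.

Lemma fourier_invB g h x : cintegrable g -> cintegrable h ->
  fourier_inv g x - fourier_inv h x = fourier_inv (fun u => g u - h u) x.
Proof.
move=> ig ih; rewrite -mulrBr -RintegralB//; last 2 first.
- exact: integrable_fourier_kernel.
- exact: integrable_fourier_kernel.
by congr (_ * _); apply: eq_Rintegral => u _; rewrite mulrBr raddfB.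
Qed.

Lemma cintegrableB g h : cintegrable g -> cintegrable h ->
  cintegrable (fun u => g u - h u).
Proof.
move=> [mr mi ig] [nr ni ih].
have ReB u : complex.Re (g u - h u) = complex.Re (g u) - complex.Re (h u).
  by case: (g u) (h u) => a b [].
have ImB u : complex.Im (g u - h u) = complex.Im (g u) - complex.Im (h u).
  by case: (g u) (h u) => a b [].
have mR : measurable_fun setT (fun u => complex.Re (g u - h u)).
  by under eq_fun do rewrite ReB; exact: measurable_funB.
have mI : measurable_fun setT (fun u => complex.Im (g u - h u)).
  by under eq_fun do rewrite ImB; exact: measurable_funB.
split => //.
apply: (@dominated_integrable _ _ _ mu _ (fun u => normc (g u) + normc (h u))).
- have -> : (fun u => normc (g u - h u)) = (fun u => Num.sqrt
     (complex.Re (g u - h u) ^+ 2 + complex.Im (g u - h u) ^+ 2)).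
    by apply/funext => u; case: (_ - _).
  apply: (measurableT_comp (f := @Num.sqrt R)).
    by apply: continuous_measurable_fun; exact: sqrt_continuous.
  by apply: measurable_funD; exact: measurable_funX.
- exact: integrable_addR.
- move=> u; rewrite ger0_norm ?normc_ge0// -[normc (h u)]normcN.
  exact: le_normcD.
Qed.

Lemma cintegrable_weight g (w : R -> R) : cintegrable g ->
  measurable_fun setT w -> (forall u, 0 <= w u <= 1) ->
  cintegrable (fun u => (w u)%:C * g u).
Proof.
move=> [mr mi ig] mw w1.
have E u : (w u)%:C * g u = (w u * complex.Re (g u)) +i* (w u * complex.Im (g u)).
  by case: (g u) => a b; apply/eqP; rewrite eq_complex /=; apply/andP; split; apply/eqP; ring.
split.
- by under eq_fun do rewrite E; exact: measurable_funM.
- by under eq_fun do rewrite E; exact: measurable_funM.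
have nE u : normc ((w u)%:C * g u) = w u * normc (g u).
  by have /andP[w0 _] := w1 u; rewrite normcM normc_real ger0_norm.
apply: (@dominated_integrable _ _ _ mu _ (fun u => normc (g u))) => //.
  under eq_fun do rewrite nE; apply: measurable_funM => //.
  exact: (@measurable_of_integrable _ _ _ mu).
move=> u; rewrite nE; have /andP[w0 w1'] := w1 u.
by rewrite ger0_norm ?mulr_ge0 ?normc_ge0// ler_piMl ?normc_ge0.
Qed.

(** The integrals are extended real so that the lemma also transports integrability. *)
Lemma Rintegral_affine (G : R -> R) (a b : R) : 0 < a -> continuous G ->
  (forall x, 0 <= G x) ->
  (\int[mu]_x (G x)%:E = \int[mu]_x (a * G (a * x + b))%:E)%E.
Proof.
move=> a0 cG G0.
pose F (x : R) := a * x + b.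
have F'E : F^`()%classic = cst a.
  apply/funext => x; rewrite derive1E.
  have d : is_derive x 1 F a by apply: is_derive_eq; rewrite /GRing.scale/=; ring.
  by have [_ ->] := d.
rewrite (@increasing_ge0_integration_by_substitutionT _ F)//.
- by apply: eq_integral => x _; rewrite F'E /= mulrC.
- by move=> x y xy; rewrite /F ltrD2r ltr_pM2l.
- by rewrite F'E => x; exact: cvg_cst.
- by rewrite F'E; exact: is_cvg_cst.
- by rewrite F'E; exact: is_cvg_cst.
- apply/cvgrNyPle => A; near=> x; rewrite /F -lerBrDr mulrC -(ler_pdivlMr _ _ a0).
  by near: x; apply: nbhs_ninfty_le; exact: num_real.
- apply/cvgryPge => A; near=> x; rewrite /F -lerBlDr mulrC -(ler_pdivrMr _ _ a0).
  by near: x; apply: nbhs_pinfty_ge; exact: num_real.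
Unshelve. all: by end_near. Qed.

End fourier_inversion_formula.

Section fubini_dominated.
Context d (T : measurableType d) (R : realType) (P : probability T R).
Local Notation mu := (@lebesgue_measure R).

Lemma Rintegral_Fubini_dominated (f : T -> R -> R) (w : R -> R) :
  measurable_fun setT (fun z : T * measurableTypeR R => f z.1 z.2) ->
  mu.-integrable setT (EFin \o w) -> (forall t x, `|f t x| <= w x) ->
  \int[P]_t \int[mu]_x f t x = \int[mu]_x \int[P]_t f t x.
Proof.
move=> mf iw fw.
have mw := @measurable_of_integrable _ _ _ mu _ iw.
have w0 x : 0 <= w x by apply: le_trans (fw point x).
pose F (z : T * measurableTypeR R) := (f z.1 z.2)%:E.
have mF : measurable_fun setT F by exact/measurable_EFinP.
have mf1 t : measurable_fun setT (f t : measurableTypeR R -> R).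
  exact: (measurableT_comp mf (measurable_pair1 t)).
have mf2 x : measurable_fun setT (f ^~ x).
  exact: (measurableT_comp mf (measurable_pair2 x)).
have i1 t : mu.-integrable setT (EFin \o f t).
  exact: (@dominated_integrable _ _ _ mu _ _ (mf1 t) iw (fw t)).
have i2 x : P.-integrable setT (EFin \o (f ^~ x)).
  exact: (@bounded_integrable _ _ _ P _ (w x) (mf2 x) (fun t => fw t x)).
have jF : (P \x mu)%E.-integrable setT F.
  apply/integrable12ltyP => //.
  apply: (@le_lt_trans _ _ (\int[P]_t (\int[mu]_x w x)%:E)%E).
    apply: ge0_le_integral => //.
    - by move=> t _; apply: integral_ge0.
    - apply: (measurable_fun_fubini_tonelli_F (fun z => `|F z|%E)) => //=.
      by apply/measurable_EFinP; exact: measurableT_comp.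
    move=> t _; rewrite -EFin_Rintegral//.
    apply: ge0_le_integral => //=.
    - by apply/measurable_EFinP; apply: measurableT_comp => //; exact: mf1.
    - exact/measurable_EFinP.
    - by move=> x _; rewrite lee_fin.
  rewrite integral_cst//= [X in (_ * X)%E](@probability_setT _ _ _ P) mule1.
  by rewrite ltry.
have := Fubini jF; rewrite /F /=.
have -> : (fun t => (\int[mu]_x (f t x)%:E)%E) = (fun t => (\int[mu]_x f t x)%:E).
  by apply/funext => t; exact: EFin_Rintegral.
have -> : (fun x => (\int[P]_t (f t x)%:E)%E) = (fun x => (\int[P]_t f t x)%:E).
  by apply/funext => x; exact: EFin_Rintegral.
by rewrite /Rintegral => ->.
Qed.

End fubini_dominated.

Section gauss_density_theory.
Variables (R : realType) (e : R).
Hypothesis e0 : 0 < e.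
Local Notation mu := (@lebesgue_measure R).
Implicit Types x y : R.

Lemma gauss_densityE x :
  gauss_density e x = (Num.sqrt (2 * pi) * e)^-1 * gauss_weight e^-1 x.
Proof.
rewrite /gauss_density sqrtrM ?mulr_ge0 ?pi_ge0// sqrtr_sqr gtr0_norm//.
by congr (_ * expR (- _)); field; rewrite gt_eqF.
Qed.

Let sqrt2pi0 : 0 < Num.sqrt (2 * pi) :> R.
Proof. by rewrite sqrtr_gt0 mulr_gt0// pi_gt0. Qed.

Let peak0 : 0 < (Num.sqrt (2 * pi) * e)^-1.
Proof. by rewrite invr_gt0 mulr_gt0. Qed.

Let ei0 : 0 < e^-1. Proof. by rewrite invr_gt0. Qed.

Lemma gauss_density_ge0 x : 0 <= gauss_density e x.
Proof. by rewrite gauss_densityE mulr_ge0 ?gauss_weight_ge0// ltW. Qed.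

Lemma gauss_density_le x : gauss_density e x <= (Num.sqrt (2 * pi) * e)^-1.
Proof. by rewrite gauss_densityE ler_piMr ?gauss_weight_le1// ltW. Qed.

Lemma continuous_gauss_density : continuous (gauss_density e).
Proof.
have -> : gauss_density e =
    (fun x => (Num.sqrt (2 * pi) * e)^-1 * gauss_weight e^-1 x).
  by apply/funext => x; exact: gauss_densityE.
by move=> x; apply: cvgM; [exact: cvg_cst|exact: continuous_gauss_weight].
Qed.

Lemma integrable_gauss_density : mu.-integrable setT (EFin \o gauss_density e).
Proof.
have := integrable_scaleR (Num.sqrt (2 * pi) * e)^-1 (integrable_gauss_weight ei0).
by congr (_.-integrable _ _); apply/funext => x /=; rewrite gauss_densityE.
Qed.

Lemma Rintegral_gauss_density : \int[mu]_x gauss_density e x = 1.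
Proof.
under eq_Rintegral do rewrite gauss_densityE.
rewrite RintegralZl//; last exact: integrable_gauss_weight.
by rewrite Rintegral_gauss_weight// invrK mulVf// gt_eqF// mulr_gt0.
Qed.

Lemma integrable_gauss_density_sq :
  mu.-integrable setT (EFin \o (fun x => x ^+ 2 * gauss_density e x)).
Proof.
have : mu.-integrable setT (EFin \o (fun x => x ^+ 2 * gauss_weight e^-1 x)).
  apply: integrable_poly_gauss => //.
  by apply: (@poly_growthM _ id id); exact: poly_growth_id.
move=> /(integrable_scaleR (Num.sqrt (2 * pi) * e)^-1).
by congr (_.-integrable _ _); apply/funext => x /=; rewrite gauss_densityE mulrCA.
Qed.

Lemma Rintegral_gauss_density_sq :
  \int[mu]_x (x ^+ 2 * gauss_density e x) = e ^+ 2.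
Proof.
have := @stein R id (fun=> 1) e^-1 ei0 _ _ _ _.
move=> /(_ _ _ (@poly_growth_id R) _) H.
have {H} : \int[mu]_u (1 * gauss_weight e^-1 u) =
    e^-1 ^+ 2 * \int[mu]_u (u * id u * gauss_weight e^-1 u).
  apply: H.
  - by move=> u; exact: cvg_cst.
  - by apply: (@poly_growth_bounded _ _ 1) => u; rewrite normr1.
under eq_Rintegral do rewrite mul1r.
rewrite Rintegral_gauss_weight// invrK => H.
transitivity (\int[mu]_x ((Num.sqrt (2 * pi) * e)^-1 * (x * x * gauss_weight e^-1 x))).
  by apply: eq_Rintegral => x _; rewrite gauss_densityE expr2 mulrCA.
rewrite RintegralZl//; last first.
  apply: integrable_poly_gauss => //; first exact: measurable_funM.
  by apply: poly_growthM; exact: poly_growth_id.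
have -> : \int[mu]_x (x * x * gauss_weight e^-1 x) = e ^+ 2 * (Num.sqrt (2 * pi) * e).
  by rewrite H exprVn mulVKf// expf_neq0// gt_eqF.
by rewrite mulrC mulfK// gt_eqF// mulr_gt0.
Qed.

Lemma gauss_density_fourier y :
  (2 * pi)^-1 * \int[mu]_u (cos (u * y) * gauss_weight e u) = gauss_density e y.
Proof.
under eq_Rintegral do rewrite -[_ * y]addr0.
rewrite gauss_fourier// cos0 mul1r /gauss_density.
have pi2 : 0 <= 2 * pi :> R by rewrite mulr_ge0 ?pi_ge0.
have -> : Num.sqrt (2 * pi * e ^+ 2) = Num.sqrt (2 * pi) * e.
  by rewrite (sqrtrM _ pi2) sqrtr_sqr gtr0_norm.
rewrite mulrA; congr (_ * _); rewrite -[X in X^-1 * _](sqr_sqrtr pi2).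
move: sqrt2pi0; move: (Num.sqrt (2 * pi)) => r r0; field.
by rewrite !gt_eqF.
Qed.

Let integrable_shift (G : R -> R) y : continuous G -> (forall x, 0 <= G x) ->
  mu.-integrable setT (EFin \o G) ->
  mu.-integrable setT (EFin \o (fun x => G (x - y))) /\
  \int[mu]_x G (x - y) = \int[mu]_x G x.
Proof.
move=> cG G0 iG.
have E : (\int[mu]_x (G (x - y))%:E = \int[mu]_x (G x)%:E)%E.
  rewrite (Rintegral_affine (- y) ltr01 cG G0).
  by apply: eq_integral => x _; rewrite !mul1r.
split; last by rewrite /Rintegral E.
apply/integrableP; split.
  apply/measurable_EFinP; apply: continuous_measurable_fun => x.
  apply: continuous_comp; last exact: cG.
  by apply: cvgB; [exact: cvg_id|exact: cvg_cst].
under eq_integral do rewrite /= ger0_norm//.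
by rewrite E -ge0_fin_numE ?integrable_fin_num// integral_ge0// => x _; rewrite lee_fin.
Qed.

Variables (a b eta : R).
Hypothesis eta0 : 0 < eta.

(** The indicator of [a, b] convolved with a Gaussian density of width e. *)
Definition gauss_smooth y : R :=
  \int[mu]_x (gauss_density e (x - y) * \1_(`[a, b]%classic) x).

Let ishift y := integrable_shift y continuous_gauss_density gauss_density_ge0
  integrable_gauss_density.

Let cgd2 : continuous (fun x => x ^+ 2 * gauss_density e x).
Proof.
move=> x; apply: cvgM; last exact: continuous_gauss_density.
exact: exprn_continuous.
Qed.

Let gd20 x : 0 <= x ^+ 2 * gauss_density e x.
Proof. by rewrite mulr_ge0 ?sqr_ge0 ?gauss_density_ge0. Qed.

Let ishift2 y := integrable_shift y cgd2 gd20 integrable_gauss_density_sq.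

Let measurable_shift y : measurable_fun setT (fun x => gauss_density e (x - y)).
Proof. exact: (@measurable_of_integrable _ _ _ mu _ (ishift y).1). Qed.

Let integrable_smooth (A : set R) y : measurable A ->
  mu.-integrable setT (EFin \o (fun x => gauss_density e (x - y) * \1_A x)).
Proof.
move=> mA; apply: (@dominated_integrable _ _ _ mu _ _ _ (ishift y).1).
  by apply: measurable_funM => //; exact: measurable_shift.
move=> x; rewrite normrM (ger0_norm (gauss_density_ge0 _)) ler_piMr//.
  exact: gauss_density_ge0.
by rewrite indicE normr_nat; case: (_ \in _).
Qed.

Lemma gauss_smooth_ge0 y : 0 <= gauss_smooth y.
Proof. by apply: Rintegral_ge0 => x _; rewrite mulr_ge0 ?gauss_density_ge0. Qed.

Lemma gauss_smooth_le1 y : gauss_smooth y <= 1.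
Proof.
rewrite -Rintegral_gauss_density -(ishift y).2; apply: le_Rintegral => //.
- exact: integrable_smooth.
- exact: (ishift y).1.
- by move=> x _; rewrite ler_piMr ?gauss_density_ge0.
Qed.

Lemma continuous_gauss_smooth : continuous gauss_smooth.
Proof.
pose C := (Num.sqrt (2 * pi) * e)^-1.
apply: (@dominated_continuous _ _ R mu
  (fun y x => gauss_density e (x - y) * \1_(`[a, b]%classic) x)
  (fun x => C * \1_(`[a, b]%classic) x)).
- move=> y; apply: measurable_funM; first exact: measurable_shift.
  by apply: measurable_indic; exact: measurable_itv.
- by apply: integrable_scaleR; exact: integrable_indic_itv.
- move=> y x; rewrite normrM [`|\1_ _ _|]ger0_norm// ler_wpM2r//.
  by rewrite ger0_norm ?gauss_density_ge0// gauss_density_le.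
- move=> x y; apply: cvgM; last exact: cvg_cst.
  apply: (@continuous_comp _ _ _ (fun y => x - y)); last exact: continuous_gauss_density.
  by apply: cvgB; [exact: cvg_cst|exact: cvg_id].
Qed.

(** Chebyshev's inequality: x and y are at distance at least eta on the domain of
    integration, and the Gaussian has variance e^2. *)
Lemma gauss_smooth_outside y : ~~ (a - eta <= y <= b + eta) ->
  gauss_smooth y <= e ^+ 2 / eta ^+ 2.
Proof.
move=> yo; rewrite mulrC -Rintegral_gauss_density_sq -(ishift2 y).2 -RintegralZl//; last exact: (ishift2 y).1.
apply: le_Rintegral => //; first exact: integrable_smooth.
  exact: integrable_scaleR (ishift2 y).1.
move=> x _; rewrite indicE; have [xab|_] := boolP (x \in _); last first.
  by rewrite mulr0 mulr_ge0// invr_ge0 sqr_ge0.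
move: xab; rewrite inE/= in_itv/= => /andP[ax xb].
rewrite mulr1 mulrA ler_peMl ?gauss_density_ge0//.
rewrite mulrC ler_pdivlMr ?exprn_gt0// mul1r.
move: yo; rewrite negb_and -!ltNge => /orP[h|h]; have := ltW eta0; nra.
Qed.

Lemma gauss_smooth_inside y : a + eta <= y <= b - eta ->
  1 - e ^+ 2 / eta ^+ 2 <= gauss_smooth y.
Proof.
move=> /andP[ya yb]; rewrite lerBlDr -lerBlDl.
rewrite -{1}Rintegral_gauss_density -(ishift y).2 -RintegralB//; last 2 first.
- exact: (ishift y).1.
- exact: integrable_smooth.
rewrite mulrC -Rintegral_gauss_density_sq -(ishift2 y).2 -RintegralZl//; last exact: (ishift2 y).1.
apply: le_Rintegral => //.
- by apply: integrable_subR; [exact: (ishift y).1|exact: integrable_smooth].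
- exact: integrable_scaleR (ishift2 y).1.
move=> x _; rewrite indicE; have [_|xab] := boolP (x \in _).
  by rewrite mulr1 subrr mulr_ge0// invr_ge0 sqr_ge0.
have {xab} : ~~ (a <= x <= b).
  by apply: contraNN xab => h; rewrite inE/= in_itv.
rewrite mulr0 subr0 negb_and -!ltNge => xo.
rewrite mulrA ler_peMl ?gauss_density_ge0//.
rewrite mulrC ler_pdivlMr ?exprn_gt0// mul1r.
by move: xo => /orP[h|h]; have := ltW eta0; nra.
Qed.

End gauss_density_theory.

Section density_measure.
Variables (R : realType) (rho : R -> R).
Hypothesis mrho : measurable_fun setT rho.
Hypothesis rho0 : forall x, 0 <= rho x.
Local Notation mu := (@lebesgue_measure R).

Definition density_measure (A : set (measurableTypeR R)) : \bar R :=
  (\int[mu]_(x in A) (rho x)%:E)%E.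

Let density_measure0 : density_measure set0 = 0%E.
Proof. by rewrite /density_measure integral_set0. Qed.

Let density_measure_ge0 A : (0 <= density_measure A)%E.
Proof. by apply: integral_ge0 => x _; rewrite lee_fin. Qed.

Let density_measure_sigma_additive : semi_sigma_additive density_measure.
Proof.
move=> /= A mA tA mUA; rewrite /density_measure ge0_integral_bigcup//.
- apply: is_cvg_ereal_nneg_natsum_cond => n _ _.
  by apply: integral_ge0 => x _; rewrite lee_fin.
- by apply/measurable_EFinP; exact: measurable_funTS.
- by move=> x _; rewrite lee_fin.
Qed.

HB.instance Definition _ := isMeasure.Build _ _ _ density_measure
  density_measure0 density_measure_ge0 density_measure_sigma_additive.

(** Half-open intervals generate the Borel sets and are stable by intersection. *)
Lemma density_of_intervals d (T : measurableType d) (P : probability T R)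
    (Y : T -> R) : measurable_fun setT Y ->
  (forall a b : R, a < b ->
    P (Y @^-1` `]a, b]) = (\int[mu]_(x in `]a, b]) (rho x)%:E)%E) ->
  forall A, measurable A ->
    P (Y @^-1` A) = (\int[mu]_(x in A) (rho x)%:E)%E.
Proof.
move=> mY Yab A mA.
have mY' : (Y : T -> measurableTypeR R) \in mfun by rewrite inE; exact: mY.
pose g (n : nat) : set (measurableTypeR R) := `]- n%:R, n%:R]%classic.
apply: (@measure_unique _ R (measurableTypeR R) (@ocitv R) g _ _ _ _
  (distribution P (mfun_Sub mY')) density_measure _ _ A mA) => //.
- exact: ocitvI.
- by move=> n; exists (- n%:R, n%:R).
- rewrite -subTset => x _.
  have xb := archi_boundP (normr_ge0 (x : R)).
  exists (Num.bound `|x : R|) => //; rewrite /g /= in_itv/=.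
  move: xb; rewrite ltr_norml => /andP[-> /ltW ->]; by [].
- move=> B [[a b] _ <-] /=.
  have [ab|ba] := ltP a b; first exact: Yab.
  rewrite set_itv_ge ?bnd_simp -?leNgt//.
  by rewrite !measure0.
- move=> n; apply: (@le_lt_trans _ _ 1%E); last by rewrite ltry.
  by apply: probability_le1; exact: measurable_itv.
Qed.

End density_measure.

Section inversion.
Context d (T : measurableType d) (R : realType) (P : probability T R).
Variable Y : T -> R.
Hypothesis mY : measurable_fun setT Y.
Local Notation mu := (@lebesgue_measure R).
Local Notation psi := (char_fun P Y).
Hypothesis ipsi : cintegrable psi.
Local Open Scope complex_scope.

Let rho := fourier_inv psi.
Let f_ e x := fourier_inv (fun u => (gauss_weight e u)%:C * psi u) x.
Let M0 := (2 * pi)^-1 * \int[mu]_u normc (psi u).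

Let iw e : cintegrable (fun u => (gauss_weight e u)%:C * psi u).
Proof.
apply: cintegrable_weight => //.
  by apply: continuous_measurable_fun; exact: continuous_gauss_weight.
by move=> u; rewrite gauss_weight_ge0 gauss_weight_le1.
Qed.

Let f_le e x : `|f_ e x| <= M0.
Proof.
have [_ _ jpsi] := ipsi; have [_ _ jw] := iw e.
apply: (le_trans (fourier_inv_le x (iw e))).
rewrite ler_wpM2l ?invr_ge0 ?mulr_ge0 ?pi_ge0//.
apply: le_Rintegral => // u _; rewrite normcM normc_real.
by rewrite ger0_norm ?gauss_weight_ge0// ler_piMl ?normc_ge0// gauss_weight_le1.
Qed.

Let e_ n : R := n.+1%:R^-1.
Let e_gt0 n : 0 < e_ n. Proof. by rewrite invr_gt0. Qed.
Let e_cvg : e_ n @[n --> \oo] --> (0 : R). Proof. exact: cvg_harmonic. Qed.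

Let gauss_weight_cvg u : gauss_weight (e_ n) u @[n --> \oo] --> (1 : R).
Proof.
have h : continuous (fun e => gauss_weight e u).
  move=> e; apply: continuous_comp; last exact: continuous_expR.
  apply: cvgN; apply: cvgM; last exact: cvg_cst.
  by apply: cvgM; [exact: exprn_continuous|exact: cvg_cst].
have -> : (1 : R) = gauss_weight 0 u.
  by rewrite /gauss_weight expr0n !mul0r oppr0 expR0.
by apply: (cvg_comp e_ (fun e => gauss_weight e u)); [exact: e_cvg|exact: h].
Qed.

Let Re_weight (w : R) (x u : R) :
  complex.Re (cexp (0 +i* (- (u * x))) * (w%:C * psi u)) =
  w * complex.Re (cexp (0 +i* (- (u * x))) * psi u).
Proof. by rewrite mulrCA; case: (cexp _ * _) => a b /=; ring. Qed.

Let f_cvg x : f_ (e_ n) x @[n --> \oo] --> rho x.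
Proof.
have [_ _ jpsi] := ipsi.
apply: cvgM; first exact: cvg_cst.
apply: (@dominated_cvg_Rintegral _ _ _ mu _ _ (fun u => normc (psi u))) => //.
- by move=> n; exact: measurable_fourier_kernel.
- exact: measurable_fourier_kernel.
- move=> n u; rewrite Re_weight normrM (ger0_norm (gauss_weight_ge0 _ _)).
  apply: (le_trans (ler_wpM2l (gauss_weight_ge0 _ _) (fourier_kernel_le psi x u))).
  by rewrite ler_piMl ?normc_ge0// gauss_weight_le1.
- move=> u.
  under eq_fun do rewrite Re_weight.
  set c := complex.Re _.
  have : gauss_weight (e_ n) u * c @[n --> \oo] --> 1 * c.
    by apply: cvgM; [exact: gauss_weight_cvg|exact: cvg_cst].
  by rewrite mul1r.
Qed.

(** The Gaussian factor, of which the Gaussian density is the Fourier transform, makes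
    the double integral absolutely convergent, so that the integrals over u and over
    the probability space may be exchanged. *)
Lemma smoothed_density e x : 0 < e ->
  f_ e x = \int[P]_t gauss_density e (x - Y t).
Proof.
move=> e0.
have pi2 : 2 * pi != 0 :> R by rewrite mulf_neq0// gt_eqF// pi_gt0.
have mcw : measurable_fun setT (fun z : T * measurableTypeR R =>
    cos (z.2 * (x - Y z.1)) * gauss_weight e z.2).
  apply: measurable_funM.
    apply: (measurableT_comp (f := @cos R)).
      by apply: continuous_measurable_fun; exact: continuous_cos.
    apply: measurable_funM; first exact: measurable_snd.
    apply: measurable_funB => //.
    exact: measurableT_comp.
  apply: (measurableT_comp (f := gauss_weight e)); last exact: measurable_snd.
  by apply: continuous_measurable_fun; exact: continuous_gauss_weight.
have igw := integrable_gauss_weight e0.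
have cwle t u : `|cos (u * (x - Y t)) * gauss_weight e u| <= gauss_weight e u.
  rewrite normrM (ger0_norm (gauss_weight_ge0 _ _)) ler_piMl ?gauss_weight_ge0//.
  exact: cos_max.
have swap := @Rintegral_Fubini_dominated _ T R P
  (fun t u => cos (u * (x - Y t)) * gauss_weight e u) _ mcw igw cwle.
have igd : P.-integrable setT (EFin \o (fun t => gauss_density e (x - Y t))).
  apply: (@bounded_integrable _ _ _ P _ (Num.sqrt (2 * pi) * e)^-1) => [|t].
    apply: (measurableT_comp (f := gauss_density e)).
      apply: continuous_measurable_fun; exact: continuous_gauss_density.
    exact: measurable_funB.
  by rewrite ger0_norm ?gauss_density_ge0// gauss_density_le.
have -> : \int[P]_t gauss_density e (x - Y t) = (2 * pi)^-1 *
    \int[P]_t \int[mu]_u (cos (u * (x - Y t)) * gauss_weight e u).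
  under [in RHS]eq_Rintegral => t _.
    rewrite (_ : \int[mu]_u _ = 2 * pi * gauss_density e (x - Y t)); last first.
      by rewrite -gauss_density_fourier// mulVKf.
    over.
  by rewrite RintegralZl// mulKf.
rewrite swap; congr (_ * _); apply: eq_Rintegral => u _.
rewrite Re_weight Re_fourier_kernel mulrC -Rintegral_cos_sin// -RintegralZr//.
  apply: eq_Rintegral => t _; congr (_ * _).
  by rewrite mulrBr cosB.
by apply: integrable_addR; apply: integrable_scaleR;
  [exact: integrable_cosX|exact: integrable_sinX].
Qed.

Let rho_ge0 x : 0 <= rho x.
Proof.
apply: (cvgr_to_ge (@f_cvg x)); apply: nearW => n.
rewrite smoothed_density//; apply: Rintegral_ge0 => t _.
exact: gauss_density_ge0.
Qed.

Let rho_le x : `|rho x| <= M0. Proof. exact: fourier_inv_le. Qed.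

Let M0_ge0 : 0 <= M0. Proof. exact: le_trans (normr_ge0 _) (rho_le 0). Qed.

Let crho : continuous rho. Proof. exact: continuous_fourier_inv. Qed.

Let I (a b : R) : set R := `[a, b]%classic.

Let integrable_I a b : mu.-integrable setT (EFin \o \1_(I a b)).
Proof. exact: integrable_indic_itv. Qed.

Let mI a b : measurable (I a b). Proof. exact: measurable_itv. Qed.

Let inI a b x : (x \in I a b) = (a <= x <= b).
Proof. by apply/idP/idP; rewrite inE /I/= in_itv. Qed.

Let dominated_I (g : R -> R) (K a b : R) : continuous g ->
  (forall x, `|g x| <= K) ->
  mu.-integrable setT (EFin \o (fun x => g x * \1_(I a b) x)).
Proof.
move=> cg gK; apply: (@dominated_integrable _ _ _ mu _ (fun x => K * \1_(I a b) x)).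
- apply: measurable_funM; first exact: continuous_measurable_fun.
  by apply: measurable_indic; exact: mI.
- by apply: integrable_scaleR; exact: integrable_I.
- move=> x; rewrite normrM [`|\1_ _ _|]ger0_norm//.
  by rewrite ler_wpM2r.
Qed.

Let smooth_interval e a b : 0 < e ->
  \int[mu]_x (f_ e x * \1_(I a b) x) = \int[P]_t gauss_smooth e a b (Y t).
Proof.
move=> e0.
pose C := (Num.sqrt (2 * pi) * e)^-1.
have mgd : measurable_fun setT (gauss_density e : measurableTypeR R -> R).
  by apply: continuous_measurable_fun; exact: continuous_gauss_density.
have mf : measurable_fun setT (fun z : T * measurableTypeR R =>
    gauss_density e (z.2 - Y z.1) * \1_(I a b) z.2).
  apply: measurable_funM.
    apply: (measurableT_comp mgd).
    apply: measurable_funB; first exact: measurable_snd.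
    exact: measurableT_comp.
  apply: (measurableT_comp (f := (\1_(I a b) : measurableTypeR R -> R))).
    by apply: measurable_indic; exact: mI.
  exact: measurable_snd.
have iC := integrable_scaleR C (integrable_I a b).
have fC t x : `|gauss_density e (x - Y t) * \1_(I a b) x| <= C * \1_(I a b) x.
  rewrite normrM [`|\1_ _ _|]ger0_norm// ler_wpM2r//.
  by rewrite ger0_norm ?gauss_density_ge0// gauss_density_le.
rewrite /gauss_smooth.
have -> := @Rintegral_Fubini_dominated _ T R P
  (fun t x => gauss_density e (x - Y t) * \1_(I a b) x) _ mf iC fC.
apply: eq_Rintegral => x _; rewrite smoothed_density// RintegralZr//.
apply: (@bounded_integrable _ _ _ P _ C) => [|t].
  apply: (measurableT_comp mgd); exact: measurable_funB.
by rewrite ger0_norm ?gauss_density_ge0// gauss_density_le.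
Qed.

Let rhoI a b := \int[mu]_x (rho x * \1_(I a b) x).

Let rhoI_cvg a b : \int[mu]_x (f_ (e_ n) x * \1_(I a b) x) @[n --> \oo] --> rhoI a b.
Proof.
apply: (@dominated_cvg_Rintegral _ _ _ mu _ _ (fun x => M0 * \1_(I a b) x)) => //.
- move=> n; apply: measurable_funM; last by apply: measurable_indic; exact: mI.
  by apply: continuous_measurable_fun; exact: continuous_fourier_inv.
- apply: measurable_funM; last by apply: measurable_indic; exact: mI.
  exact: continuous_measurable_fun.
- by apply: integrable_scaleR; exact: integrable_I.
- by move=> n x; rewrite normrM [`|\1_ _ _|]ger0_norm// ler_wpM2r.
- by move=> x; apply: cvgM; [exact: f_cvg|exact: cvg_cst].
Qed.

Let q_ (eta : R) n := e_ n ^+ 2 / eta ^+ 2.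

Let q_cvg eta : q_ eta n @[n --> \oo] --> (0 : R).
Proof.
have : e_ n * e_ n * (eta ^- 2) @[n --> \oo] --> (0 * 0 * (eta ^- 2) : R).
  by apply: cvgM; [apply: cvgM; exact: e_cvg|exact: cvg_cst].
by rewrite !mul0r; under eq_fun do rewrite -expr2.
Qed.

Let Rintegral_indicY (A : set R) : measurable A ->
  P.-integrable setT (EFin \o (fun t => \1_A (Y t))) /\
  \int[P]_t \1_A (Y t) = fine (P (Y @^-1` A)).
Proof.
move=> mA; have mYA : measurable (Y @^-1` A).
  by rewrite -[X in measurable X]setTI; exact: mY.
split; last by rewrite /Rintegral integral_indic ?setIT.
exact: integrable_indic.
Qed.

Let integrable_smoothY e a b : 0 < e ->
  P.-integrable setT (EFin \o (fun t => gauss_smooth e a b (Y t))).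
Proof.
move=> e0; apply: (@bounded_integrable _ _ _ P _ 1) => [|t]; last first.
  by rewrite ger0_norm ?gauss_smooth_ge0// gauss_smooth_le1.
apply: (measurableT_comp (f := gauss_smooth e a b)) => //.
by apply: continuous_measurable_fun; exact: continuous_gauss_smooth.
Qed.

(** Up to e^2 / eta^2, the smoothed indicator of [a, b] dominates the indicator of the
    interval shrunk by eta; the width e tends to 0 with eta fixed. *)
Let sandwich_lower eta a b : 0 < eta ->
  fine (P (Y @^-1` I (a + eta) (b - eta))) <= rhoI a b.
Proof.
move=> eta0; set p := fine _.
have h : \int[mu]_x (f_ (e_ n) x * \1_(I a b) x) + q_ eta n @[n --> \oo] --> rhoI a b + 0.
  by apply: cvgD; [exact: rhoI_cvg|exact: q_cvg].
rewrite addr0 in h; apply: (cvgr_to_ge h); apply: nearW => n.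
have [i1 E1] := Rintegral_indicY (mI (a + eta) (b - eta)).
rewrite smooth_interval// -lerBlDr /p -E1 -[q_ _ _](Rintegral_prob_cst P).
rewrite -RintegralB//; last exact: finite_measure_integrable_cst.
apply: le_Rintegral => //.
- by apply: integrable_subR => //; exact: finite_measure_integrable_cst.
- exact: integrable_smoothY.
move=> t _; rewrite indicE inI; have [tab|_] := boolP (_ <= _ <= _).
  exact: gauss_smooth_inside.
rewrite sub0r (@le_trans _ _ 0)// ?gauss_smooth_ge0// oppr_le0.
by rewrite mulr_ge0 ?sqr_ge0// invr_ge0 sqr_ge0.
Qed.

Let sandwich_upper eta a b : 0 < eta ->
  rhoI a b <= fine (P (Y @^-1` I (a - eta) (b + eta))).
Proof.
move=> eta0; set p := fine _.
have h : \int[mu]_x (f_ (e_ n) x * \1_(I a b) x) - q_ eta n @[n --> \oo] --> rhoI a b - 0.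
  by apply: cvgB; [exact: rhoI_cvg|exact: q_cvg].
rewrite subr0 in h; apply: (cvgr_to_le h); apply: nearW => n.
have [i1 E1] := Rintegral_indicY (mI (a - eta) (b + eta)).
rewrite smooth_interval// lerBlDr /p -E1 -[q_ _ _](Rintegral_prob_cst P).
rewrite -RintegralD//; last exact: finite_measure_integrable_cst.
apply: le_Rintegral => //.
- exact: integrable_smoothY.
- by apply: integrable_addR => //; exact: finite_measure_integrable_cst.
move=> t _; rewrite indicE inI; have [_|h'] := boolP (_ <= _ <= _).
  rewrite (le_trans (gauss_smooth_le1 _ _ _ _))// lerDl.
  by rewrite mulr_ge0 ?sqr_ge0// invr_ge0 sqr_ge0.
by rewrite add0r; exact: gauss_smooth_outside.
Qed.

(** As rho is bounded by M0, the loss of length in the sandwich costs at most M0 times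
    that length. *)
Let rhoI_extend a b c e : a <= b -> b <= c -> c <= e ->
  rhoI a e <= rhoI b c + M0 * (b - a) + M0 * (e - c).
Proof.
move=> ab bc ce.
have len x y : x <= y -> M0 * (y - x) = \int[mu]_z (M0 * \1_(I x y) z).
  move=> xy; rewrite (RintegralZl M0 measurableT (integrable_I x y)).
  rewrite /Rintegral integral_indic ?setIT//; last exact: mI.
  rewrite [X in fine X](lebesgue_measure_itv `[x, y])/= lte_fin.
  by case: ltgtP xy => // -> _; rewrite subrr.
have ir x y : mu.-integrable setT (EFin \o (fun z => rho z * \1_(I x y) z)).
  exact: (dominated_I x y crho rho_le).
have iM x y : mu.-integrable setT (EFin \o (fun z => M0 * \1_(I x y) z)).
  by apply: integrable_scaleR; exact: integrable_I.
rewrite (len _ _ ab) (len _ _ ce) /rhoI.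
rewrite -RintegralD// -RintegralD//; last exact: integrable_addR.
apply: le_Rintegral => //.
  by apply: integrable_addR => //; exact: integrable_addR.
move=> z _; rewrite !indicE !inI.
have rz : rho z <= M0 by apply: le_trans (ler_norm _) (rho_le z).
have r0 := rho_ge0 z.
have [az|za] := leP a z; have [ze|ez] := leP z e; rewrite /= ?andbF ?andbT/=; last 3 first.
- by rewrite mulr0 !addr_ge0// mulr_ge0.
- by rewrite mulr0 !addr_ge0// mulr_ge0.
- by rewrite mulr0 !addr_ge0// mulr_ge0.
have [bz|zb] := leP b z; have [zc|cz] := leP z c; rewrite /= ?andbF ?andbT/= ?mulr1 ?mulr0 ?add0r ?addr0.
- by rewrite -addrA lerDl addr_ge0// mulr_ge0.
- by rewrite (ltW cz) mulr1 (le_trans rz)// lerDr mulr_ge0.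
- by rewrite (ltW zb) mulr1 (le_trans rz)// lerDl mulr_ge0.
- by rewrite (ltW zb) mulr1 (le_trans rz)// lerDl mulr_ge0.
Qed.

Let rhoI_interval a b : a < b -> fine (P (Y @^-1` `]a, b])) = rhoI a b.
Proof.
move=> ab; apply/eqP; rewrite eq_le.
have mYA (A : set R) : measurable A -> measurable (Y @^-1` A).
  by move=> mA; rewrite -[X in measurable X]setTI; exact: mY.
have le_prob (A B : set R) : measurable A -> measurable B -> A `<=` B ->
    fine (P (Y @^-1` A)) <= fine (P (Y @^-1` B)).
  move=> mA mB AB; apply: fine_le; [exact: fin_num_measure (mYA _ mA)|
    exact: fin_num_measure (mYA _ mB)|].
  by apply: le_measure; rewrite ?inE; [exact: mYA|exact: mYA|move=> t; exact: AB].
apply/andP; split; apply/ler_addgt0Pr => z z0.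
  pose eta := z / (2 * (M0 + 1)).
  have eta0 : 0 < eta by rewrite divr_gt0// mulr_gt0// ltr_wpDl.
  have := sandwich_lower (a - eta) (b + eta) eta0; rewrite subrK addrK => h.
  apply: le_trans; first apply: (le_trans _ h).
    apply: le_prob; [exact: measurable_itv|exact: mI|].
    by move=> x; rewrite /I/= !in_itv/= => /andP[/ltW -> ->].
  apply: (le_trans (@rhoI_extend (a - eta) a b (b + eta) _ (ltW ab) _)).
  - by rewrite gerBl ltW.
  - by rewrite lerDl ltW.
  have : eta * (2 * (M0 + 1)) = z.
    by rewrite divfK// gt_eqF// mulr_gt0// ltr_wpDl.
  by have := M0_ge0; move: (eta) eta0 => y; nra.
(* the left end point moves by 2 eta to turn the closed interval into a half-open one *)
pose eta := Num.min (z / (3 * (M0 + 1))) ((b - a) / 3).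
have eta0 : 0 < eta.
  rewrite lt_min; apply/andP; split; apply: divr_gt0 => //.
    by rewrite mulr_gt0// ltr_wpDl.
  by rewrite subr_gt0.
have eta_le : 3 * eta <= b - a.
  by rewrite mulrC -ler_pdivlMr// /eta ge_min lexx orbT.
have eta_z : 3 * eta * M0 <= z.
  have : eta <= z / (3 * (M0 + 1)) by rewrite /eta ge_min lexx.
  rewrite ler_pdivlMr ?mulr_gt0 ?ltr_wpDl//; have := M0_ge0; nra.
have := @sandwich_upper eta (a + 2 * eta) (b - eta) eta0; rewrite subrK => h.
apply: (le_trans (@rhoI_extend a (a + 2 * eta) (b - eta) b _ _ _)).
- by rewrite lerDl mulr_ge0// ltW.
- lra.
- by rewrite gerBl ltW.
have h2 : fine (P (Y @^-1` I (a + 2 * eta - eta) b)) <= fine (P (Y @^-1` `]a, b])).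
  apply: le_prob; [exact: mI|exact: measurable_itv|].
  move=> x; rewrite /I/= !in_itv/= => /andP[ax ->]; rewrite andbT.
  by apply: lt_le_trans ax; lra.
rewrite -addrA; apply: lerD; first exact: le_trans h h2.
by apply: le_trans eta_z; rewrite -mulrDr mulrC; apply: ler_wpM2r => //; lra.
Qed.

(** Nonnegativity and the masses of intervals pass to the limit from the Gaussian
    regularizations f_ e, whose values are expectations of Gaussian densities. *)
Theorem fourier_inversion : continuous rho /\ is_density P Y rho.
Proof.
split; first exact: crho.
have mrho : measurable_fun setT rho by exact: continuous_measurable_fun crho.
split => // A mA; apply: density_of_intervals => // a b ab.
have mYA : measurable (Y @^-1` `]a, b]).
  by rewrite -[X in measurable X]setTI; apply: mY => //; exact: measurable_itv.
rewrite -[LHS](fineK (fin_num_measure P _ mYA)) rhoI_interval//.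
have iab : mu.-integrable `[a, b] (EFin \o rho).
  apply/integrable_mkcond; first exact: measurable_itv.
  rewrite restrict_EFin patch_indic.
  exact: (dominated_I a b crho rho_le).
have iab' : mu.-integrable `]a, b] (EFin \o rho).
  apply: (integrableS _ _ _ iab); [exact: measurable_itv|exact: measurable_itv|].
  exact: subset_itv_oc_cc.
rewrite -(@fineK _ (\int[mu]_(x in `]a, b]) (rho x)%:E)%E); last first.
  apply: integrable_fin_num; first exact: measurable_itv.
  exact: iab'.
congr EFin.
rewrite -[RHS]/(\int[mu]_(x in `]a, b]) rho x) Rintegral_itv_obnd_cbnd//.
by rewrite Rintegral_mkcond patch_indic.
Qed.

End inversion.

(** * The Fourier transform of the corrected density *)

Section cintegrable_intro.
Variable R : realType.
Local Notation mu := (@lebesgue_measure R).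
Local Open Scope complex_scope.
Implicit Types (g h : R -> R[i]).

Lemma cintegrable_dominated g (W : R -> R) :
  measurable_fun setT (fun u => complex.Re (g u)) ->
  measurable_fun setT (fun u => complex.Im (g u)) ->
  mu.-integrable setT (EFin \o W) -> (forall u, normc (g u) <= W u) ->
  cintegrable g.
Proof.
move=> mR mI iW gW; split => //.
apply: (@dominated_integrable _ _ _ mu _ W) => //; last first.
  by move=> u; rewrite ger0_norm ?normc_ge0.
have -> : (fun u => normc (g u)) = (fun u => Num.sqrt
   (complex.Re (g u) ^+ 2 + complex.Im (g u) ^+ 2)).
  by apply/funext => u; case: (g u).
apply: (measurableT_comp (f := @Num.sqrt R)).
  by apply: continuous_measurable_fun; exact: sqrt_continuous.
by apply: measurable_funD; exact: measurable_funX.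
Qed.

Lemma measurable_complexM g h :
  measurable_fun setT (fun u => complex.Re (g u)) ->
  measurable_fun setT (fun u => complex.Im (g u)) ->
  measurable_fun setT (fun u => complex.Re (h u)) ->
  measurable_fun setT (fun u => complex.Im (h u)) ->
  measurable_fun setT (fun u => complex.Re (g u * h u)) /\
  measurable_fun setT (fun u => complex.Im (g u * h u)).
Proof.
move=> gR gI hR hI.
have ReM u : complex.Re (g u * h u) =
    complex.Re (g u) * complex.Re (h u) - complex.Im (g u) * complex.Im (h u).
  by case: (g u) (h u) => a b [].
have ImM u : complex.Im (g u * h u) =
    complex.Re (g u) * complex.Im (h u) + complex.Im (g u) * complex.Re (h u).
  by case: (g u) (h u) => a b [].
under eq_fun do rewrite ReM; under [X in _ /\ measurable_fun _ X]eq_fun do rewrite ImM.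
by split; [apply: measurable_funB|apply: measurable_funD]; exact: measurable_funM.
Qed.

Lemma measurable_complexX g n :
  measurable_fun setT (fun u => complex.Re (g u)) ->
  measurable_fun setT (fun u => complex.Im (g u)) ->
  measurable_fun setT (fun u => complex.Re (g u ^+ n)) /\
  measurable_fun setT (fun u => complex.Im (g u ^+ n)).
Proof.
move=> gR gI; elim: n => [|n [IR II]].
  under eq_fun do rewrite expr0; under [X in _ /\ measurable_fun _ X]eq_fun do rewrite expr0.
  by split; exact: measurable_cst.
under eq_fun do rewrite exprS; under [X in _ /\ measurable_fun _ X]eq_fun do rewrite exprS.
exact: measurable_complexM.
Qed.

End cintegrable_intro.

Section edgeworth_function.
Variable R : realType.
Local Notation mu := (@lebesgue_measure R).
Local Open Scope complex_scope.
Variables (sigma c : R) (k : nat).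
Hypothesis sigma0 : 0 < sigma.

(** The Fourier transform of the Gaussian density with its first correction: exp W
    replaced by 1 + W for W = c (i u)^k. *)
Definition edgeworth_fourier (u : R) : R[i] :=
  (gauss_weight sigma u)%:C * (1 + c%:C * (0 +i* u) ^+ k).

Lemma normc_edgeworth_fourier u :
  normc (edgeworth_fourier u) <= (1 + `|c| * `|u| ^+ k) * gauss_weight sigma u.
Proof.
rewrite normcM normc_real ger0_norm ?gauss_weight_ge0// mulrC.
rewrite ler_wpM2r ?gauss_weight_ge0// (le_trans (le_normcD _ _))//.
by rewrite normc1 normcM normc_real normc_iX.
Qed.

Lemma cintegrable_edgeworth : cintegrable edgeworth_fourier.
Proof.
have mw : measurable_fun setT (gauss_weight sigma).
  by apply: continuous_measurable_fun; exact: continuous_gauss_weight.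
have [pR pI] := @measurable_complexX _ (fun u : R => (0 +i* u)) k
   (measurable_cst (0 : R)) (@measurable_id _ R setT).
have [cR cI] := @measurable_complexM _ (fun u : R => c%:C) (fun u : R => (0 +i* u) ^+ k)
   (measurable_cst c) (measurable_cst (0 : R)) pR pI.
have [R1 I1] : measurable_fun setT (fun u : R => complex.Re (1 + c%:C * (0 +i* u) ^+ k)) /\
    measurable_fun setT (fun u : R => complex.Im (1 + c%:C * (0 +i* u) ^+ k)).
  have E (u : R) : 1 + c%:C * (0 +i* u) ^+ k =
      (1 + complex.Re (c%:C * (0 +i* u) ^+ k)) +i* complex.Im (c%:C * (0 +i* u) ^+ k).
    by case: (_ * _) => a b; apply/eqP; rewrite eq_complex /= add0r !eqxx.
  under eq_fun do rewrite E; under [X in _ /\ measurable_fun _ X]eq_fun do rewrite E.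
  by split => //; exact: measurable_funD.
have [gR gI] := @measurable_complexM _ (fun u : R => (gauss_weight sigma u)%:C)
  (fun u : R => 1 + c%:C * (0 +i* u) ^+ k) mw (measurable_cst (0 : R)) R1 I1.
apply: (cintegrable_dominated gR gI); last exact: normc_edgeworth_fourier.
have pabs : poly_growth (fun u : R => `|u|).
  by have [A [n [A0 H]]] := @poly_growth_id R; exists A, n; split => // u; rewrite normr_id.
have pow : poly_growth (fun u : R => `|u| ^+ k).
  elim: {pR pI cR cI R1 I1 gR gI} k => [|j IH].
    by apply: (@poly_growth_bounded _ _ 1) => u; rewrite expr0 normr1.
  by under eq_fun do rewrite exprS; exact: poly_growthM.
apply: integrable_poly_gauss => //.
  apply: measurable_funD => //; apply: measurable_funM => //.
  by apply: (measurable_funX (f := fun u : R => `|u|)); exact: normr_measurable.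
apply: poly_growthD; first exact: (@poly_growth_bounded _ _ `|1 : R|).
by apply: poly_growthM => //; exact: (@poly_growth_bounded _ _ (`| (`|c|) |)).
Qed.

Lemma fourier_inv_edgeworth x :
  fourier_inv edgeworth_fourier x =
  gauss_density sigma x +
  c / sigma ^+ k * hermite k (x / sigma) * gauss_density sigma x.
Proof.
have sn : sigma != 0 by rewrite gt_eqF.
have i0 := @integrable_fourier_monomial_gauss _ _ x sigma0.
rewrite /fourier_inv.
transitivity ((2 * pi)^-1 * \int[mu]_u
  (complex.Re ((0 +i* u) ^+ 0 * cexp (0 +i* (- (u * x)))) * gauss_weight sigma u +
   c * (complex.Re ((0 +i* u) ^+ k * cexp (0 +i* (- (u * x)))) * gauss_weight sigma u))).
  congr (_ * _); apply: eq_Rintegral => u _.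
  rewrite expr0 mul1r /edgeworth_fourier.
  move: (cexp _) ((0 +i* u) ^+ k) (gauss_weight _ _) => [a1 b1] [a2 b2] w /=.
  ring.
rewrite RintegralD//; last exact: integrable_scaleR.
rewrite RintegralZl// !fourier_monomial_gauss// hermite0 expr0 invr1 !mulr1.
rewrite gauss_densityE// /gauss_weight.
have -> : sigma^-1 ^+ 2 * x ^+ 2 / 2 = x ^+ 2 / (2 * sigma ^+ 2) by field.
have pi2 : 0 <= 2 * pi :> R by rewrite mulr_ge0 ?pi_ge0.
rewrite -[X in X^-1 * _](sqr_sqrtr pi2).
have r0 : Num.sqrt (2 * pi) != 0 :> R by rewrite gt_eqF// sqrtr_gt0 mulr_gt0// pi_gt0.
have sk : sigma ^+ k != 0 by rewrite expf_neq0.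
move: (Num.sqrt _) r0 (sigma ^+ k) sk (expR _) (hermite _ _) => r r0 S S0 E H; field.
by rewrite S0 r0 sn.
Qed.

End edgeworth_function.

(** * Comparison of the Fourier transforms *)

Section low_frequencies.
Variable R : realType.
Local Open Scope complex_scope.
Variables (sigma c C delta : R) (k : nat).
Hypotheses (k_ge3 : (3 <= k)%N) (C0 : 0 <= C).
Hypotheses (delta0 : 0 < delta) (delta1 : delta <= 1).
Hypothesis small : (`|c| + C) * delta <= sigma ^+ 2 / 4.

(** With t = u / s and W = n (c (i t)^k + r), the difference is the Gaussian weight
    times (exp W - 1 - W) + n r.  The bound |W| <= K |u|^k / s^(k-2) gives the power of
    s for the square, and |W| <= sigma^2 u^2 / 4 keeps exp |W| below the square root
    of the inverse Gaussian weight. *)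
Lemma edgeworth_low_frequency (s : R) (n : nat) (u : R) (r : R[i]) :
  1 <= s -> s ^+ 2 = n%:R -> `|u| <= delta * s ->
  normc r <= C * `|u / s| ^+ k.+1 ->
  normc (cexp ((- (sigma ^+ 2 * (u / s) ^+ 2 / 2))%:C +
               (c%:C * (0 +i* (u / s)) ^+ k + r)) ^+ n -
         edgeworth_fourier sigma (c * (s ^+ (k - 2))^-1) k u) <=
  (s ^+ (k - 1))^-1 * ((5 * (`|c| + C) ^+ 2 + C) *
    ((1 + `|u|) ^+ (2 * k) * gauss_weight (sigma / 2) u)).
Proof.
move=> s1 sn us rC.
have s0 : 0 < s by rewrite (lt_le_trans _ s1).
have sN : s != 0 by rewrite gt_eqF.
have [m km] : exists m, k = m.+3 by exists (k - 3)%N; rewrite -{1}(subnK k_ge3) addn3.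
set t := u / s in rC *.
have uE : u = t * s by rewrite /t mulfVK.
have td : `|t| <= delta by rewrite /t normrM normfV (gtr0_norm s0) ler_pdivrMr.
clearbody t.
have t1 : `|t| <= 1 by rewrite (le_trans td).
pose K : R := `|c| + C; have K0 : 0 <= K by rewrite addr_ge0.
pose W : R[i] := n%:R * (c%:C * (0 +i* t) ^+ k + r).
have nC : n%:R = (n%:R : R)%:C :> R[i] by rewrite rmorph_nat.
have normW : normc W <= s ^+ 2 * (K * `|t| ^+ k).
  rewrite /W nC normcM normc_real normr_nat -sn ler_wpM2l ?sqr_ge0//.
  rewrite (le_trans (le_normcD _ _))// normcM normc_real normc_iX mulrDl lerD2l.
  rewrite (le_trans rC)// ler_wpM2l// exprS ler_piMl// exprn_ge0//.
have WM : normc W <= K * `|u| ^+ k * (s ^+ (k - 2))^-1.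
  rewrite (le_trans normW)// uE normrM (gtr0_norm s0) exprMn km subSS subSS subn0.
  rewrite [s ^+ m.+3](_ : _ = s ^+ 2 * s ^+ m.+1); last by rewrite -exprD.
  have sm : s ^+ m.+1 != 0 by rewrite expf_neq0.
  move: (s ^+ m.+1) sm (`|t| ^+ _) => y y0 z.
  by rewrite (_ : _ / y = s ^+ 2 * (K * z)) //; field.
have WL : normc W <= sigma ^+ 2 * u ^+ 2 / 4.
  rewrite (le_trans normW)// uE exprMn.
  have -> : sigma ^+ 2 * (t ^+ 2 * s ^+ 2) / 4 =
    s ^+ 2 * (sigma ^+ 2 / 4 * t ^+ 2) by field.
  rewrite ler_wpM2l ?sqr_ge0// -(real_normK (num_real t)) km.
  have -> : K * `|t| ^+ m.+3 = K * `|t| * `|t| ^+ m * `|t| ^+ 2 by rewrite !exprS; ring.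
  rewrite ler_wpM2r ?sqr_ge0// (le_trans _ small)//.
  rewrite (@le_trans _ _ (K * `|t|))//; last by rewrite ler_wpM2l.
  by rewrite ler_piMr ?mulr_ge0// exprn_ile1.
have nE : cexp ((- (sigma ^+ 2 * t ^+ 2 / 2))%:C + (c%:C * (0 +i* t) ^+ k + r)) ^+ n
   = (gauss_weight sigma u)%:C * cexp W.
  rewrite -cexpM_nat mulrDr cexpD; congr (_ * _).
  rewrite nC -rmorphM /= -sn /gauss_weight uE /cexp cos0 sin0 mulr1 mulr0.
  by congr (expR _ +i* _); field.
have E1 : (c * (s ^+ (k - 2))^-1)%:C * (0 +i* u) ^+ k = n%:R * (c%:C * (0 +i* t) ^+ k).
  have -> : (0 +i* u) = s%:C * (0 +i* t).
    by apply/eqP; rewrite eq_complex /= uE !mul0r !mulr0 subr0 addr0 mulrC !eqxx.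
  rewrite exprMn nC -sn mulrA -!rmorphXn -rmorphM mulrA -rmorphM.
  congr (_%:C * _) => /=; rewrite km subSS subSS subn0.
  rewrite (_ : s ^+ m.+3 = s ^+ 2 * s ^+ m.+1); last by rewrite -exprD.
  have sm : s ^+ m.+1 != 0 by rewrite expf_neq0.
  by move: (s ^+ m.+1) sm => y y0; field.
rewrite nE /edgeworth_fourier E1 -mulrBr.
have -> : cexp W - (1 + n%:R * (c%:C * (0 +i* t) ^+ k)) = (cexp W - 1 - W) + n%:R * r.
  by rewrite /W; ring.
rewrite normcM normc_real (ger0_norm (gauss_weight_ge0 _ _)).
have B1 := cexp_sub1D_bound WM WL.
have B2 : normc (n%:R * r) <= C * `|u| ^+ k.+1 * (s ^+ (k - 1))^-1.
  rewrite nC normcM normc_real normr_nat -sn.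
  rewrite (le_trans (ler_wpM2l (sqr_ge0 s) rC))// uE normrM (gtr0_norm s0) exprMn km subSS subn0.
  rewrite [s ^+ m.+4](_ : _ = s ^+ 2 * s ^+ m.+2); last by rewrite -exprD.
  have sm : s ^+ m.+2 != 0 by rewrite expf_neq0.
  move: (s ^+ m.+2) sm (`|t| ^+ _) => y y0 z.
  by rewrite (_ : _ / y = s ^+ 2 * (C * z)) //; field.
have u1 : 1 <= 1 + `|u| by rewrite lerDl.
have pk j : (j <= 2 * k)%N -> `|u| ^+ j <= (1 + `|u|) ^+ (2 * k).
  move=> jk; rewrite (@le_trans _ _ ((1 + `|u|) ^+ j))//; last exact: ler_weXn2l.
  by rewrite lerXn2r ?nnegrE ?addr_ge0// lerDr.
set U := (1 + `|u|) ^+ _ in pk *; set S := (s ^+ (k - 1))^-1 in B2 *.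
have S0 : 0 <= S by rewrite invr_ge0 exprn_ge0// ltW.
have L0 : 1 <= expR (sigma ^+ 2 * u ^+ 2 / 4).
  by rewrite -expR0 ler_expR divr_ge0// mulr_ge0 ?sqr_ge0.
have M2 : (K * `|u| ^+ k * (s ^+ (k - 2))^-1) ^+ 2 <= K ^+ 2 * U * S.
  rewrite !exprMn -mulrA -[leRHS]mulrA ler_wpM2l ?sqr_ge0// ler_pM ?sqr_ge0//.
    by rewrite -exprM mulnC pk.
  rewrite exprVn lef_pV2 ?posrE ?exprn_gt0// -exprM ler_weXn2l// km.
  by rewrite !subSS !subn0 muln2 -addnn addSn addnS !ltnS leq_addr.
have H : normc (cexp W - 1 - W + n%:R * r) <=
    S * ((5 * K ^+ 2 + C) * U) * expR (sigma ^+ 2 * u ^+ 2 / 4).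
  rewrite (le_trans (le_normcD _ _))//.
  have -> : S * ((5 * K ^+ 2 + C) * U) * expR (sigma ^+ 2 * u ^+ 2 / 4) =
    5 * (K ^+ 2 * U * S) * expR (sigma ^+ 2 * u ^+ 2 / 4) +
    C * U * S * expR (sigma ^+ 2 * u ^+ 2 / 4) by ring.
  rewrite lerD//.
    by rewrite (le_trans B1)// ler_wpM2r ?expR_ge0// ler_wpM2l.
  rewrite (le_trans B2)// -[leLHS]mulr1 ler_pM// ?mulr_ge0// ?exprn_ge0//.
  by rewrite ler_wpM2r// ler_wpM2l// pk// mul2n -addnn -addn1 leq_add2l km.
rewrite (le_trans (ler_wpM2l (gauss_weight_ge0 _ _) H))//.
have G : gauss_weight sigma u * expR (sigma ^+ 2 * u ^+ 2 / 4) <= gauss_weight (sigma / 2) u.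
  rewrite /gauss_weight -expRD ler_expR.
  have := mulr_ge0 (sqr_ge0 sigma) (sqr_ge0 u).
  rewrite expr_div_n; move: (sigma ^+ 2) (u ^+ 2) => a b; lra.
have Q0 : 0 <= S * ((5 * K ^+ 2 + C) * U).
  rewrite !mulr_ge0// ?addr_ge0 ?mulr_ge0 ?sqr_ge0//.
  by rewrite exprn_ge0// (le_trans ler01).
by have := ler_wpM2l Q0 G; rewrite !mulrA mulrC => h; rewrite mulrC !mulrA; lra.
Qed.

(** The power of s is produced by 1 <= (|u| / (delta s))^(k-1), at the price of a
    polynomial factor in u. *)
Lemma edgeworth_high_frequency (s u : R) : 1 <= s -> delta * s <= `|u| ->
  normc (edgeworth_fourier sigma (c * (s ^+ (k - 2))^-1) k u) <=
  (s ^+ (k - 1))^-1 * ((1 + `|c|) * (delta ^+ (k - 1))^-1 *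
    ((1 + `|u|) ^+ (2 * k) * gauss_weight (sigma / 2) u)).
Proof.
move=> s1 us; have s0 : 0 < s by rewrite (lt_le_trans _ s1).
have u1 : 1 <= 1 + `|u| by rewrite lerDl.
have k1 : (k - 1 <= k)%N by exact: leq_subr.
have ds0 : 0 < delta * s by rewrite mulr_gt0.
(* the polynomial factor pays for the missing power of s *)
have pay : 1 <= (s ^+ (k - 1))^-1 * (delta ^+ (k - 1))^-1 * (1 + `|u|) ^+ k.
  rewrite -invfM -exprMn [s * _]mulrC [leRHS]mulrC ler_pdivlMr ?exprn_gt0// mul1r.
  rewrite (@le_trans _ _ (`|u| ^+ (k - 1)))//.
    by rewrite lerXn2r ?nnegrE// ltW.
  rewrite (@le_trans _ _ ((1 + `|u|) ^+ (k - 1)))//; last exact: ler_weXn2l.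
  by rewrite lerXn2r ?nnegrE ?addr_ge0// lerDr.
have cs : `|c * (s ^+ (k - 2))^-1| <= `|c|.
  rewrite normrM ler_piMr// ger0_norm ?invr_ge0 ?exprn_ge0 ?(ltW s0)//.
  by rewrite invf_le1 ?exprn_gt0// exprn_ege1.
have G : gauss_weight sigma u <= gauss_weight (sigma / 2) u.
  rewrite /gauss_weight ler_expR.
  have := mulr_ge0 (sqr_ge0 sigma) (sqr_ge0 u).
  rewrite expr_div_n; move: (sigma ^+ 2) (u ^+ 2) => a b; lra.
have pol : 1 + `|c * (s ^+ (k - 2))^-1| * `|u| ^+ k <= (1 + `|c|) * (1 + `|u|) ^+ k.
  rewrite mulrDl mul1r lerD ?exprn_ege1// ler_pM ?exprn_ge0//.
  by rewrite lerXn2r ?nnegrE ?addr_ge0// lerDr.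
have B0 : 0 <= (1 + `|c|) * (1 + `|u|) ^+ k * gauss_weight (sigma / 2) u.
  by rewrite !mulr_ge0 ?gauss_weight_ge0 ?exprn_ge0 ?addr_ge0.
rewrite (le_trans (normc_edgeworth_fourier _ _ _ _))//.
rewrite (@le_trans _ _ ((1 + `|c|) * (1 + `|u|) ^+ k * gauss_weight (sigma / 2) u))//.
  by rewrite ler_pM ?gauss_weight_ge0// addr_ge0// mulr_ge0// exprn_ge0.
have := ler_wpM2l B0 pay; rewrite mulr1 => /le_trans; apply.
by rewrite mul2n -addnn exprD le_eqVlt; apply/orP; left; apply/eqP; ring.
Qed.

End low_frequencies.

Section edgeworth_estimate.
Variable R : realType.
Local Notation mu := (@lebesgue_measure R).
Local Open Scope complex_scope.
Variables (phi : R -> R[i]) (sigma c : R) (k V : nat).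
Hypothesis sigma0 : 0 < sigma.
Hypothesis k_ge3 : (3 <= k)%N.
Hypothesis phi_Re : continuous (fun u => complex.Re (phi u)).
Hypothesis phi_Im : continuous (fun u => complex.Im (phi u)).
Hypothesis phi_normc : continuous (fun u => normc (phi u)).
Hypothesis phi1 : forall u, normc (phi u) <= 1.
Hypothesis phiV : mu.-integrable setT (EFin \o (fun u => normc (phi u) ^+ V)).
Hypothesis phi_away : forall delta : R, 0 < delta ->
  exists2 q : R, 0 < q < 1 & forall u, delta <= `|u| -> normc (phi u) <= q.
Hypothesis phi_expansion : exists C delta : R,
  [/\ 0 <= C, 0 < delta & forall u : R, `|u| <= delta ->
  exists2 r : R[i], normc r <= C * `|u| ^+ k.+1 &
  phi u = cexp ((- (sigma ^+ 2 * u ^+ 2 / 2))%:C + (c%:C * (0 +i* u) ^+ k + r))].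

Let continuous_rescale (f : R -> R) (s : R) : continuous f ->
  continuous (fun u : R => f (u / s)).
Proof.
move=> cf u; apply: (@continuous_comp _ _ _ (fun u : R => u / s) f); last exact: cf.
by apply: cvgM; [exact: cvg_id|exact: cvg_cst].
Qed.

Let rescaled_power (s : R) : 0 < s ->
  mu.-integrable setT (EFin \o (fun u => normc (phi (u / s)) ^+ V)) /\
  \int[mu]_u (normc (phi (u / s)) ^+ V) = s * \int[mu]_u (normc (phi u) ^+ V).
Proof.
move=> s0; have sn : s != 0 by rewrite gt_eqF.
pose G (u : R) : R := normc (phi u) ^+ V.
have cG : continuous G.
  by move=> u; apply: (@continuous_comp _ _ _ (fun u : R => normc (phi u)) (fun y : R => y ^+ V));
    [exact: phi_normc|exact: exprn_continuous].
have G0 u : 0 <= G u by rewrite exprn_ge0// normc_ge0.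
have si : 0 < s^-1 by rewrite invr_gt0.
have E := Rintegral_affine 0 si cG G0.
have cH : continuous (fun u : R => s^-1 * G (s^-1 * u + 0)).
  have -> : (fun u : R => s^-1 * G (s^-1 * u + 0)) = (fun u => s^-1 * G (u / s)).
    by apply/funext => u; rewrite addr0 [_ * u]mulrC.
  move=> u; apply: cvgM; first exact: cvg_cst.
  exact: continuous_rescale.
have iH : mu.-integrable setT (EFin \o (fun u => s^-1 * G (s^-1 * u + 0))).
  apply/integrableP; split; first by apply/measurable_EFinP; exact: continuous_measurable_fun.
  have := phiV => /integrableP[_]; apply: le_lt_trans.
  rewrite le_eqVlt; apply/orP; left; apply/eqP.
  transitivity (\int[mu]_u (s^-1 * G (s^-1 * u + 0))%:E)%E.
    by apply: eq_integral => u _; rewrite /= ger0_norm// mulr_ge0// ltW.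
  by rewrite -E; apply: eq_integral => u _; rewrite /= ger0_norm//; exact: G0.
have HE : (fun u => normc (phi (u / s)) ^+ V) = (fun u => s * (s^-1 * G (s^-1 * u + 0))).
  by apply/funext => u; rewrite mulVKf// addr0 [_ * u]mulrC.
rewrite HE; split; first exact: integrable_scaleR.
by rewrite RintegralZl//; congr (_ * _); rewrite /Rintegral -E.
Qed.

(** V of the n factors give integrability, the others are bounded by 1. *)
Lemma cintegrable_rescaled_power n (s : R) : (V <= n)%N -> 0 < s ->
  cintegrable (fun u => phi (u / s) ^+ n).
Proof.
move=> Vn s0; have [iP _] := rescaled_power s0.
have [mR mI] := @measurable_complexX _ (fun u => phi (u / s)) n
  (continuous_measurable_fun (@continuous_rescale _ s phi_Re))
  (continuous_measurable_fun (@continuous_rescale _ s phi_Im)).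
apply: (cintegrable_dominated mR mI iP) => u.
by rewrite normcX ler_wiXn2l ?normc_ge0.
Qed.

(** The inverse transforms differ by at most the L^1 distance of the transforms, for
    which the low and high frequency bounds are added up. *)
Theorem edgeworth_fourier_inv : exists C, forall n, (V <= n)%N -> (0 < n)%N ->
  forall x,
  `|fourier_inv (fun u => phi (u / Num.sqrt n%:R) ^+ n) x -
    fourier_inv (edgeworth_fourier sigma (c * (Num.sqrt n%:R ^+ (k - 2))^-1) k) x|
  <= C * (Num.sqrt n%:R ^+ (k - 1))^-1.
Proof.
have [C [d0 [C0 d00 expansion]]] := phi_expansion.
have D0 : 0 < `|c| + C + 1 by rewrite ltr_wpDl ?addr_ge0.
have s4 : 0 < sigma ^+ 2 / 4 by rewrite divr_gt0 ?exprn_gt0.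
(* the last bound makes |W| <= sigma^2 u^2 / 4 for |u| <= delta s *)
pose delta := Num.min (Num.min 1 d0) (sigma ^+ 2 / 4 / (`|c| + C + 1)).
have delta0 : 0 < delta by rewrite !lt_min ltr01 d00 divr_gt0.
have delta1 : delta <= 1 by rewrite !ge_min lexx.
have deltad : delta <= d0 by rewrite !ge_min lexx orbT.
have small : (`|c| + C) * delta <= sigma ^+ 2 / 4.
  rewrite (@le_trans _ _ ((`|c| + C + 1) * delta))//.
    by rewrite ler_wpM2r ?(ltW delta0)// lerDl.
  by rewrite mulrC -ler_pdivlMr// !ge_min lexx !orbT.
clearbody delta.
have [q q01 awayq] := phi_away delta0; have /andP[q0 q1] := q01.
have [K HK] := geometric_pow_bounded k q01.
pose A : R := 5 * (`|c| + C) ^+ 2 + C + (1 + `|c|) * (delta ^+ (k - 1))^-1.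
have A1 : 0 <= 5 * (`|c| + C) ^+ 2 + C by rewrite addr_ge0// mulr_ge0// sqr_ge0.
have A2 : 0 <= (1 + `|c|) * (delta ^+ (k - 1))^-1.
  by rewrite mulr_ge0 ?addr_ge0// invr_ge0 exprn_ge0// ltW.
pose p (u : R) : R := (1 + `|u|) ^+ (2 * k) * gauss_weight (sigma / 2) u.
have p0 u : 0 <= p u by rewrite mulr_ge0 ?gauss_weight_ge0// exprn_ge0// addr_ge0.
have ip : mu.-integrable setT (EFin \o p).
  apply: integrable_poly_gauss; first by rewrite divr_gt0.
    apply: (measurable_funX (f := fun u : R => 1 + `|u|)).
    by apply: measurable_funD => //; exact: normr_measurable.
  by exists 1, (2 * k)%N; split => // u; rewrite mul1r ger0_norm// exprn_ge0// addr_ge0.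
pose J := \int[mu]_u (normc (phi u) ^+ V).
have J0 : 0 <= J by apply: Rintegral_ge0 => u _; rewrite exprn_ge0// normc_ge0.
exists ((2 * pi)^-1 * (A * \int[mu]_u p u + (q ^+ V)^-1 * `|K| * J)) => n Vn n0 x.
set s := Num.sqrt n%:R.
have sn : s ^+ 2 = n%:R by rewrite sqr_sqrtr.
have s1 : 1 <= s by rewrite -(sqrtr1 R) ler_wsqrtr// ler1n.
have s0 : 0 < s by rewrite (lt_le_trans _ s1).
clearbody s.
set g := edgeworth_fourier _ _ _; set S := (s ^+ (k - 1))^-1.
have S0 : 0 <= S by rewrite invr_ge0 exprn_ge0// ltW.
have ig : cintegrable g by exact: cintegrable_edgeworth.
have iz := cintegrable_rescaled_power Vn s0.
have [iP JP] := rescaled_power s0.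
have izg := cintegrableB iz ig.
rewrite fourier_invB// (le_trans (fourier_inv_le x izg))// -[leRHS]mulrA.
rewrite ler_wpM2l ?invr_ge0 ?mulr_ge0 ?pi_ge0//.
(* the pointwise bound: low frequencies in the first term, high ones in both *)
pose w (u : R) : R := S * (A * p u) + q ^+ (n - V) * normc (phi (u / s)) ^+ V.
have qV0 u : 0 <= q ^+ (n - V) * normc (phi (u / s)) ^+ V.
  by rewrite mulr_ge0 ?exprn_ge0 ?normc_ge0// ltW.
have zw u : normc (phi (u / s) ^+ n - g u) <= w u.
  have [us|us] := leP `|u| (delta * s).
    have [|r rC rE] := expansion (u / s).
      by rewrite normrM normfV (gtr0_norm s0) ler_pdivrMr// (le_trans us)// ler_wpM2r// ltW.
    rewrite rE (le_trans (edgeworth_low_frequency k_ge3 C0 delta1 small s1 sn us rC))//.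
    rewrite -/S -[leLHS]addr0 /w lerD// ler_wpM2l// ler_wpM2r ?(p0 u)//.
    by rewrite /A lerDl.
  rewrite [_ - g u]addrC (le_trans (le_normcD _ _))// normcN /w lerD//.
    rewrite (le_trans (edgeworth_high_frequency sigma c k delta0 s1 (ltW us)))//.
    rewrite ler_wpM2l// ler_wpM2r ?(p0 u)//.
    by rewrite /A lerDr.
  rewrite normcX -{1}(subnK Vn) exprD ler_wpM2r ?exprn_ge0 ?normc_ge0//.
  rewrite lerXn2r ?nnegrE ?normc_ge0 ?(ltW q0)// awayq//.
  by rewrite normrM normfV (gtr0_norm s0) ler_pdivlMr// ltW.
have i1 : mu.-integrable setT (EFin \o (fun u => S * (A * p u))).
  by apply: integrable_scaleR; exact: integrable_scaleR.
have i2 : mu.-integrable setT (EFin \o (fun u => q ^+ (n - V) * normc (phi (u / s)) ^+ V)).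
  exact: integrable_scaleR.
have [_ _ nzg] := izg.
have := @dominated_Rintegral _ _ _ mu _ w (measurable_of_integrable nzg)
  (integrable_addR i1 i2).
rewrite ger0_norm; last by apply: Rintegral_ge0 => u _; exact: normc_ge0.
move=> /(_ _) /le_trans; apply; first by move=> u; rewrite ger0_norm ?normc_ge0.
rewrite /w RintegralD// !RintegralZl//; last exact: integrable_scaleR.
rewrite JP -/J [leRHS]mulrDl lerD//.
  by rewrite [leRHS]mulrC.
have kk : (k - 1).+1 = k by rewrite subn1 prednK// (leq_trans _ k_ge3).
have sS : s = s ^+ k * S.
  have -> : s ^+ k = s * s ^+ (k - 1) by rewrite -exprS kk.
  by rewrite /S mulfK// expf_neq0// gt_eqF.
(* the geometric decay absorbs the k powers of s that are missing *)
have qs : q ^+ (n - V) * s ^+ k <= (q ^+ V)^-1 * `|K|.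
  rewrite ler_pdivlMl ?exprn_gt0// mulrA -exprD subnKC//.
  rewrite (le_trans _ (le_trans (HK n) (ler_norm K)))// ler_wpM2l ?exprn_ge0 ?(ltW q0)//.
  by rewrite lerXn2r ?nnegrE ?(ltW s0)// -sn expr2 ler_peMl// ltW.
by rewrite mulrA [leRHS]mulrAC ler_wpM2r// {1}sS mulrA ler_wpM2r//.
Qed.

End edgeworth_estimate.

(** * The local limit theorem *)

Section edgeworth_hypotheses.
Context d (T : measurableType d) (R : realType) (P : probability T R).
Local Notation mu := (@lebesgue_measure R).

Lemma integrable_square (X : T -> R) (a : R) : measurable_fun setT X ->
  (\int[P]_t (X t ^+ 2)%:E = a%:E)%E ->
  P.-integrable setT (EFin \o (fun t => X t ^+ 2)) /\ \int[P]_t (X t ^+ 2) = a.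
Proof.
move=> mX XE; split; last by rewrite /Rintegral XE.
apply/integrableP; split.
  by apply/measurable_EFinP; exact: measurable_funX.
under eq_integral do rewrite /= ger0_norm ?sqr_ge0//.
by rewrite XE ltry.
Qed.

(** If X vanished almost surely, phi would be constantly 1, against its being bounded
    away from 1 outside a neighbourhood of the origin. *)
Lemma variance_neq0 (X : T -> R) (v : R) : measurable_fun setT X ->
  P.-integrable setT (EFin \o (fun t => X t ^+ 2)) -> 0 <= v ->
  (\int[mu]_u (normc (char_fun P X u) `^ v)%:E < +oo)%E ->
  \int[P]_t (X t ^+ 2) != 0.
Proof.
move=> mX iX2 v0 phiv; apply/eqP => EX2.
have [q /andP[_ q1] away] := char_fun_bounded_away mX iX2 v0 ltr01 phiv.
have := away 1; rewrite normr1 lexx => /(_ isT).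
apply/negP; rewrite -ltNge (lt_le_trans q1)//.
apply: (le_trans _ (le_trans (ler_norm _) (normc_ge_Re _))).
rewrite Re_char_fun// -subr_le0 -[X in X - _](Rintegral_prob_cst P).
have i1 : P.-integrable setT (EFin \o (fun _ : T => 1 : R)).
  exact: finite_measure_integrable_cst.
have ic := integrable_cosX P mX 1.
rewrite -RintegralB// -EX2.
apply: le_Rintegral => //; first exact: integrable_subR.
move=> t _; rewrite mul1r (le_trans (ler_norm _))// (le_trans (one_sub_cos_le _))//.
by have := sqr_ge0 (X t); lra.
Qed.

Lemma integrable_power_nat (f : R -> R) (v : R) (V : nat) : continuous f ->
  (forall u, 0 <= f u <= 1) -> 0 < v -> v <= V%:R ->
  (\int[mu]_u (f u `^ v)%:E < +oo)%E ->
  mu.-integrable setT (EFin \o (fun u => f u ^+ V)).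
Proof.
move=> cf f01 v0 vV fv.
have mf : measurable_fun setT f by exact: continuous_measurable_fun.
apply/integrableP; split; first by apply/measurable_EFinP; exact: measurable_funX.
apply: le_lt_trans fv; apply: ge0_le_integral => //.
- by apply/measurable_EFinP; apply: measurableT_comp => //; exact: measurable_funX.
- by apply/measurable_EFinP; exact: (measurableT_comp (measurable_powR v) mf).
move=> u _ /=; have /andP[f0 f1] := f01 u.
rewrite lee_fin ger0_norm ?exprn_ge0// -powR_mulrn//.
move: f0; rewrite le_eqVlt => /orP[/eqP <-|f0]; last by rewrite ger_powR// f0.
by rewrite !powR0// gt_eqF// (lt_le_trans v0).
Qed.

End edgeworth_hypotheses.

Theorem theorem7p10 (R : realType) (d : measure_display) (T : measurableType d)
    (P : probability T R) (X : {RV P >-> R}) (Xs : nat -> {RV P >-> R})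
    (sigma : R) (k : nat) (kappa : nat -> R) (v : R)
    (Xs_indep : independent_RVs Xs)
    (Xs_law : forall j, same_law (Xs j) X)
    (X_mean : ('E_P[X] = 0)%E)
    (sigma_ge0 : 0 <= sigma)
    (X_var : ('E_P[fun t => (X t ^+ 2)%R] = (sigma ^+ 2)%:E)%E)
    (k_ge3 : (3 <= k)%N)
    (X_cumulants : is_cumulants P X k kappa)
    (kappa_lt_k : forall j, (3 <= j < k)%N -> kappa j = 0)
    (kappa_k : kappa k != 0)
    (v_ge1 : 1 <= v)
    (phi_integrable :
      (\int[lebesgue_measure]_u (normc (char_fun P X u) `^ v)%:E < +oo)%E) :
  exists rho : nat -> R -> R,
    (\forall n \near \oo,
       continuous (rho n) /\ is_density P (normalized_sum Xs n) (rho n)) /\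
    exists C : R, \forall n \near \oo, forall x : R,
      `| rho n x
         - (gauss_density sigma x
            + (Num.sqrt n%:R ^+ (k - 2))^-1
              * (kappa k / (k`!%:R * sigma ^+ k))
              * hermite k (x / sigma) * gauss_density sigma x) |
      <= C * (Num.sqrt n%:R ^+ (k - 1))^-1.
Proof.
have mX : measurable_fun setT X by exact: measurable_funPT.
have EX : \int[P]_t X t = 0 by move: X_mean; rewrite unlock /Rintegral => ->.
have [iX2 EX2] : P.-integrable setT (EFin \o (fun t => X t ^+ 2)) /\
    \int[P]_t (X t ^+ 2) = sigma ^+ 2.
  by apply: integrable_square => //; move: X_var; rewrite unlock.
have v0 : 0 < v by exact: lt_le_trans v_ge1.
have sigma_gt0 : 0 < sigma.
  have := variance_neq0 mX iX2 (ltW v0) phi_integrable.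
  by rewrite EX2 expf_eq0 /= lt_def sigma_ge0 andbT.
pose V := Num.bound v.
have vV : v <= V%:R by rewrite ltW// archi_boundP// ltW.
set phi := char_fun P X in phi_integrable.
have phi01 u : 0 <= normc (phi u) <= 1 by rewrite normc_ge0 normc_char_fun_le1.
have phi_normc := continuous_normc_char_fun mX iX2.
have phiV := integrable_power_nat phi_normc phi01 v0 vV phi_integrable.
have phiRe := continuous_Re_char_fun mX iX2.
have phiIm := continuous_Im_char_fun mX iX2.
have away delta (delta0 : 0 < delta) :=
  char_fun_bounded_away mX iX2 (ltW v0) delta0 phi_integrable.
have expansion := cumulant_expansion mX iX2 k_ge3 kappa_lt_k X_cumulants EX EX2.
have psiE n : char_fun P (normalized_sum Xs n) = fun u => phi (u / Num.sqrt n%:R) ^+ n.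
  by apply/funext => u; exact: char_fun_normalized_sum Xs_indep Xs_law u n.
have sqrt_gt0 n : (0 < n)%N -> 0 < Num.sqrt n%:R :> R by move=> n0; rewrite sqrtr_gt0 ltr0n.
exists (fun n => fourier_inv (char_fun P (normalized_sum Xs n))); split.
  exists (maxn V 1) => // n /=; rewrite geq_max => /andP[Vn n0].
  apply: fourier_inversion; first exact: measurable_normalized_sum.
  rewrite psiE; apply: (cintegrable_rescaled_power phiRe phiIm phi_normc _ phiV Vn).
    by move=> u; have /andP[] := phi01 u.
  exact: sqrt_gt0.
have [C HC] := edgeworth_fourier_inv sigma_gt0 k_ge3 phiRe phiIm phi_normc
  (fun u => normc_char_fun_le1 P mX u) phiV away expansion.
exists C; exists (maxn V 1) => // n /=; rewrite geq_max => /andP[Vn n0] x.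
have := HC n Vn n0 x; rewrite psiE fourier_inv_edgeworth//.
congr (`| _ - (_ + _ * _ * _)| <= _).
have sk : sigma ^+ k != 0 by rewrite expf_neq0// gt_eqF.
have kf : k`!%:R != 0 :> R by rewrite pnatr_eq0 -lt0n fact_gt0.
have ss : Num.sqrt n%:R ^+ (k - 2) != 0 :> R by rewrite expf_neq0// gt_eqF// sqrt_gt0.
by move: (Num.sqrt _ ^+ _) ss (k`!%:R) kf (sigma ^+ k) sk => a a0 b b0 e e0; field; rewrite a0 b0 e0.
Qed.
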